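(* For $k$-linear Grothendieck categories $\mathcal{C}$ and $\mathcal{D}$, there is an equivalence of categories $$\mathcal{C} \boxtimes \mathcal{D} \cong \mathcal{C} \boxtimes_{\mathsf{LP}} \mathcal{D}.$$
   Context: $k$ is a commutative ring; all categories, functors and constructions are $k$-linear (enriched over $\mathrm{Mod}(k)$). A $k$-linear category is locally presentable if it is cocomplete and for some small regular cardinal $\alpha$ it has a set of strong generators $G$ that are $\alpha$-presented, i.e. $\mathrm{Hom}(G,-)$ preserves $\alpha$-filtered colimits. Every Grothendieck category is locally presentable. Tensor product $\boxtimes_{\mathsf{LP}}$: for locally presentable $\mathcal{A}, \mathcal{B}$, $\mathcal{A} \boxtimes_{\mathsf{LP}} \mathcal{B}$ is the locally presentable $k$-linear category such that for every cocomplete $k$-linear category $\mathcal{E}$ there is a natural equivalence $\mathrm{Cocont}(\mathcal{A} \boxtimes_{\mathsf{LP}} \mathcal{B}, \mathcal{E}) \cong \mathrm{Cocont}(\mathcal{A}, \mathcal{B}; \mathcal{E})$, where $\mathrm{Cocont}(-,-)$ denotes $k$-linear functors preserving colimits and $\mathrm{Cocont}(\mathcal{A}, \mathcal{B}; \mathcal{E})$ denotes functors $\mathcal{A} \times \mathcal{B} \to \mathcal{E}$ that are $k$-linear and cocontinuous in each variable. It exists, and one can take $\mathcal{A} \boxtimes_{\mathsf{LP}} \mathcal{B} = \mathrm{Cont}(\mathcal{A}^{\mathrm{op}}, \mathcal{B})$, the category of $k$-linear limit-preserving functors. Tensor product $\boxtimes$ of Grothendieck categories. For a small $k$-linear category $\mathfrak{a}$,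 $\mathrm{Mod}(\mathfrak{a})$ is the category of $k$-linear functors $\mathfrak{a}^{\mathrm{op}} \to \mathrm{Mod}(k)$. A sieve on $A \in \mathfrak{a}$ is a submodule $R \subseteq \mathfrak{a}(-,A)$; for $f : A' \to A$, $f^{-1}R = \{g \mid fg \in R\}$. A (linear) topology $\mathcal{T}$ on $\mathfrak{a}$ specifies for every $A$ a collection $\mathcal{T}(A)$ of sieves on $A$ such that: $\mathfrak{a}(-,A) \in \mathcal{T}(A)$; $R \in \mathcal{T}(A)$ and $f : A' \to A$ imply $f^{-1}R \in \mathcal{T}(A')$; if $R \in \mathcal{T}(A)$ and $S$ is a sieve on $A$ with $f^{-1}S \in \mathcal{T}(A')$ for all $f \in R(A')$, then $S \in \mathcal{T}(A)$. A family $(A_i \to A)_i$ is covering if the sieve it generates is in $\mathcal{T}(A)$. $\mathrm{Sh}(\mathfrak{a}, \mathcal{T}) \subseteq \mathrm{Mod}(\mathfrak{a})$ consists of those $F$ with $F(A) \cong \mathrm{Hom}(\mathfrak{a}(-,A),F) \to \mathrm{Hom}(R,F)$ an isomorphism for all $R \in \mathcal{T}(A)$. $\mathfrak{a} \otimes \mathfrak{b}$ has objects the pairs $(A,B)$ and Hom-modules $\mathfrak{a}(A',A) \otimes_k \mathfrak{b}(B',B)$. For sieves $R$ on $A$ and $S$ on $B$, $R \boxtimes S$ is the image of $R \otimes S \to (\mathfrak{a} \otimes \mathfrak{b})(-,(A,B))$, where $(R\otimes S)(A',B') = R(A')\otimes_k S(B')$. $\mathcal{T}_{\mathfrak{a}}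 \boxtimes \mathcal{T}_{\mathfrak{b}}$ is the smallest topology on $\mathfrak{a} \otimes \mathfrak{b}$ containing all $R \boxtimes \mathfrak{b}(-,B)$ with $R \in \mathcal{T}_{\mathfrak{a}}(A)$ and all $\mathfrak{a}(-,A) \boxtimes S$ with $S \in \mathcal{T}_{\mathfrak{b}}(B)$. A $k$-linear functor $u : (\mathfrak{a}, \mathcal{T}_{\mathfrak{a}}) \to \mathcal{C}$ from a site to a Grothendieck category is an LC morphism if: (G) every $C \in \mathcal{C}$ admits a jointly epimorphic family $(u(A_i) \to C)_i$; (F) for every $c : u(A) \to u(A')$ there are a covering family $a_i : A_i \to A$ and $f_i : A_i \to A'$ with $c\,u(a_i) = u(f_i)$; (FF) for every $a : A \to A'$ with $u(a) = 0$ there is a covering family $a_i : A_i \to A$ with $a a_i = 0$; and a sieve $R$ on $A$ is in $\mathcal{T}_{\mathfrak{a}}(A)$ iff $(u(f))_{f \in R}$ is jointly epimorphic. In that case $\mathcal{C} \cong \mathrm{Sh}(\mathfrak{a}, \mathcal{T}_{\mathfrak{a}})$. For arbitrary LC morphisms $(\mathfrak{a}, \mathcal{T}_{\mathfrak{a}}) \to \mathcal{C}$ and $(\mathfrak{b}, \mathcal{T}_{\mathfrak{b}}) \to \mathcal{D}$, one defines $\mathcal{C} \boxtimes \mathcal{D} = \mathrm{Sh}(\mathfrak{a} \otimes \mathfrak{b}, \mathcal{T}_{\mathfrak{a}} \boxtimes \mathcal{T}_{\mathfrak{b}})$, which is well defined up to equivalence of categories. *)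

(* Defs.v *)
(* Size conventions.  [small] is the universe of small sets.  The definitions
   below force it to coincide with the universe of the carriers of modules
   ([small_of_lmod] and the module structure on [pshom]), so that the
   Hom-modules are exactly the small ones.  [slcat] is the type of k-linear
   categories with a small set of objects, [lcat] that of k-linear categories
   with a possibly large type of objects. *)
From HB Require Import structures.
From mathcomp Require Import all_boot all_algebra.
From mathcomp Require Import boolp.

Set Implicit Arguments.
Unset Strict Implicit.
Unset Printing Implicit Defensive.

Import GRing.Theory.
Local Open Scope ring_scope.
Local Open Scope quotient_scope.

Definition small := Type.
Definition small_of_lmod (k : pzRingType) (V : lmodType k) : small := V.

Section LinearMaps.
Context (k : comPzRingType).
Implicit Types U V W : lmodType k.

Definition mklinear U V (f : U -> V) (fP : linear f) : {linear U -> V} :=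
  HB.pack f (GRing.isLinear.Build k U V *:%R f fP).

Lemma linear_ext U V (f g : {linear U -> V}) : f =1 g -> f = g.
Proof.
case: f g => [f cf] [g cg] /= /funext fg; subst g.
case: cf cg => [[c1] [c2]] [[d1] [d2]].
by rewrite (Prop_irrelevance c1 d1) (Prop_irrelevance c2 d2).
Qed.

Section LinearLmod.
Context (U V : lmodType k).
Local Notation L := {linear U -> V}.

HB.instance Definition _ := gen_eqMixin L.
HB.instance Definition _ := gen_choiceMixin L.

Fact lin0P : linear (fun _ : U => 0 : V).
Proof. by move=> a x y; rewrite scaler0 addr0. Qed.
Fact linDP (f g : L) : linear (fun x => f x + g x).
Proof. by move=> a x y; rewrite !linearP scalerDr addrACA. Qed.
Fact linNP (f : L) : linear (fun x => - f x).
Proof. by move=> a x y; rewrite linearP opprD scalerN. Qed.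
Fact linZP (c : k) (f : L) : linear (fun x => c *: f x).
Proof. by move=> a x y; rewrite linearP scalerDr !scalerA mulrC. Qed.

Let add (f g : L) : L := mklinear (linDP f g).
Let opp (f : L) : L := mklinear (linNP f).
Let scale c (f : L) : L := mklinear (linZP c f).
Let zero : L := mklinear lin0P.

Fact linaddA : associative add.
Proof. by move=> f g h; apply: linear_ext => x /=; rewrite addrA. Qed.
Fact linaddC : commutative add.
Proof. by move=> f g; apply: linear_ext => x /=; rewrite addrC. Qed.
Fact linadd0 : left_id zero add.
Proof. by move=> f; apply: linear_ext => x /=; rewrite add0r. Qed.
Fact linaddN : left_inverse zero opp add.
Proof. by move=> f; apply: linear_ext => x /=; rewrite addNr. Qed.
HB.instance Definition _ :=
  GRing.isZmodule.Build L linaddA linaddC linadd0 linaddN.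

Fact linscaleA a b f : scale a (scale b f) = scale (a * b) f.
Proof. by apply: linear_ext => x /=; rewrite scalerA. Qed.
Fact linscale1 : left_id 1 scale.
Proof. by move=> f; apply: linear_ext => x /=; rewrite scale1r. Qed.
Fact linscaleDr : right_distributive scale +%R.
Proof. by move=> a f g; apply: linear_ext => x /=; rewrite scalerDr. Qed.
Fact linscaleDl f : {morph scale^~ f : a b / a + b}.
Proof. by move=> a b; apply: linear_ext => x /=; rewrite scalerDl. Qed.
HB.instance Definition _ :=
  GRing.Zmodule_isLmodule.Build k L linscaleA linscale1 linscaleDr linscaleDl.

Lemma lin_linE a (f g : L) x : (a *: f + g) x = a *: f x + g x.
Proof. by []. Qed.

End LinearLmod.

Definition lin_id U : {linear U -> U} := mklinear (f := fun x : U => x) (fun a x y => erefl).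
Fact lin_comp_subproof U V W (g : {linear V -> W}) (f : {linear U -> V}) :
  linear (fun x => g (f x)).
Proof. by move=> a x y; rewrite !linearP. Qed.
Definition lin_comp U V W (g : {linear V -> W}) (f : {linear U -> V}) :=
  mklinear (lin_comp_subproof g f).

End LinearMaps.

Section Submodules.
Context (k : comPzRingType).

Record submodule (V : lmodType k) := Submodule {
  smem :> V -> Prop;
  smem0 : smem 0;
  smemP : forall a x y, smem x -> smem y -> smem (a *: x + y) }.

Context (V : lmodType k) (S : submodule V).

Lemma smemD x y : S x -> S y -> S (x + y).
Proof. by move=> Sx Sy; rewrite -[x]scale1r; apply: smemP. Qed.
Lemma smemZ a x : S x -> S (a *: x).
Proof. by move=> Sx; rewrite -[_ *: _]addr0; apply: smemP => //; apply: smem0. Qed.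
Lemma smemN x : S x -> S (- x).
Proof. by move=> Sx; rewrite -scaleN1r; apply: smemZ. Qed.
Lemma smem_sum (I : Type) (r : seq I) (F : I -> V) :
  (forall i, S (F i)) -> S (\sum_(i <- r) F i).
Proof.
move=> SF; elim: r => [|i r IH]; first by rewrite big_nil; apply: smem0.
by rewrite big_cons; apply: smemD.
Qed.

Record submod := Submod { sval :> V; svalP : S sval }.

Lemma submod_ext (x y : submod) : sval x = sval y -> x = y.
Proof.
case: x y => [x Sx] [y Sy] /= xy; subst y.
by rewrite (Prop_irrelevance Sx Sy).
Qed.

HB.instance Definition _ := gen_eqMixin submod.
HB.instance Definition _ := gen_choiceMixin submod.

Let add (x y : submod) := Submod (smemD (svalP x) (svalP y)).
Let opp (x : submod) := Submod (smemN (svalP x)).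
Let scale a (x : submod) := Submod (smemZ a (svalP x)).
Let zero := Submod (smem0 S).

Fact subaddA : associative add.
Proof. by move=> x y z; apply: submod_ext; rewrite /= addrA. Qed.
Fact subaddC : commutative add.
Proof. by move=> x y; apply: submod_ext; rewrite /= addrC. Qed.
Fact subadd0 : left_id zero add.
Proof. by move=> x; apply: submod_ext; rewrite /= add0r. Qed.
Fact subaddN : left_inverse zero opp add.
Proof. by move=> x; apply: submod_ext; rewrite /= addNr. Qed.
HB.instance Definition _ :=
  GRing.isZmodule.Build submod subaddA subaddC subadd0 subaddN.

Fact subscaleA a b x : scale a (scale b x) = scale (a * b) x.
Proof. by apply: submod_ext; rewrite /= scalerA. Qed.
Fact subscale1 : left_id 1 scale.
Proof. by move=> x; apply: submod_ext; rewrite /= scale1r. Qed.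
Fact subscaleDr : right_distributive scale +%R.
Proof. by move=> a x y; apply: submod_ext; rewrite /= scalerDr. Qed.
Fact subscaleDl x : {morph scale^~ x : a b / a + b}.
Proof. by move=> a b; apply: submod_ext; rewrite /= scalerDl. Qed.
HB.instance Definition _ := GRing.Zmodule_isLmodule.Build k submod
  subscaleA subscale1 subscaleDr subscaleDl.

Fact sval_linear : linear sval. Proof. by []. Qed.
Definition submod_incl : {linear submod -> V} := mklinear sval_linear.

End Submodules.

Section TensorProduct.
Context (k : comPzRingType).
Implicit Types M N V : lmodType k.

(* [bilinear_for] of sesquilinear.v assumes 1 != 0 in [k]. *)
Definition bilin M N V (b : M -> N -> V) : Prop :=
  (forall y, linear (b^~ y)) /\ (forall x, linear (b x)).

Section Construction.
Context (M N : lmodType k).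

Definition formal_eval V (b : M -> N -> V) (s : seq (M * N)) : V :=
  \sum_(p <- s) b p.1 p.2.

(* [s] stands for the formal sum of the (m, n) in [s].  Two formal sums are
   identified when all bilinear maps agree on them; every element of the
   tensor product is a sum of elementary tensors, whence this encoding. *)
Definition tens_eq (s t : seq (M * N)) : bool :=
  `[< forall V (b : M -> N -> V), bilin b ->
        formal_eval b s = formal_eval b t >].

Fact tens_eq_refl : reflexive tens_eq.
Proof. by move=> s; apply/asboolP. Qed.
Fact tens_eq_sym : symmetric tens_eq.
Proof. by move=> s t; apply/asboolP/asboolP => + V b bb => ->. Qed.
Fact tens_eq_trans : transitive tens_eq.
Proof.
move=> t s u /asboolP st /asboolP tu; apply/asboolP => V b bb.
by rewrite st // tu.
Qed.
Canonical tens_equiv := EquivRel tens_eq tens_eq_refl tens_eq_sym tens_eq_trans.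

Definition tensor := {eq_quot tens_equiv}.
HB.instance Definition _ := Choice.on tensor.

Lemma tens_piP s t : \pi_tensor s = \pi_tensor t <->
  forall V (b : M -> N -> V), bilin b -> formal_eval b s = formal_eval b t.
Proof.
split; first by move/eqP; rewrite -[_ == _]/(_ == _ :> {eq_quot _}) eqmodE => /asboolP.
by move=> H; apply/eqP; rewrite -[_ == _]/(_ == _ :> {eq_quot _}) eqmodE; apply/asboolP.
Qed.

Lemma tens_reprP (s : seq (M * N)) V (b : M -> N -> V) : bilin b ->
  formal_eval b (repr (\pi_tensor s)) = formal_eval b s.
Proof. by move=> bb; have /tens_piP -> := reprK (\pi_tensor s). Qed.

Lemma tens_ext (x y : tensor) :
  (forall V (b : M -> N -> V), bilin b ->
     formal_eval b (repr x) = formal_eval b (repr y)) -> x = y.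
Proof. by rewrite -{2}[x]reprK -{2}[y]reprK => H; apply/tens_piP. Qed.

Definition tens_add (x y : tensor) : tensor := \pi_tensor (repr x ++ repr y).
Definition tens_opp (x : tensor) : tensor :=
  \pi_tensor [seq (- p.1, p.2) | p <- repr x].
Definition tens_scale (a : k) (x : tensor) : tensor :=
  \pi_tensor [seq (a *: p.1, p.2) | p <- repr x].
Definition tens_zero : tensor := \pi_tensor [::].

Section Eval.
Context V (b : M -> N -> V) (bb : bilin b).
Lemma eval_add x y : formal_eval b (repr (tens_add x y)) =
  formal_eval b (repr x) + formal_eval b (repr y).
Proof. by rewrite tens_reprP // /formal_eval big_cat. Qed.
Lemma eval_opp x :
  formal_eval b (repr (tens_opp x)) = - formal_eval b (repr x).
Proof.
rewrite tens_reprP // /formal_eval big_map -sumrN; apply: eq_bigr => p _ /=.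
by rewrite -[RHS](linearN (mklinear (bb.1 p.2))).
Qed.
Lemma eval_scale a x :
  formal_eval b (repr (tens_scale a x)) = a *: formal_eval b (repr x).
Proof.
rewrite tens_reprP // /formal_eval big_map scaler_sumr.
by apply: eq_bigr => p _ /=; rewrite -[RHS](linearZ_LR (mklinear (bb.1 p.2))).
Qed.
Lemma eval_zero : formal_eval b (repr tens_zero) = 0.
Proof. by rewrite tens_reprP // /formal_eval big_nil. Qed.
End Eval.

Fact tens_addA : associative tens_add.
Proof. by move=> x y z; apply: tens_ext => V b bb; rewrite !eval_add // addrA. Qed.
Fact tens_addC : commutative tens_add.
Proof. by move=> x y; apply: tens_ext => V b bb; rewrite !eval_add // addrC. Qed.
Fact tens_add0 : left_id tens_zero tens_add.
Proof.
by move=> x; apply: tens_ext => V b bb; rewrite eval_add // eval_zero // add0r.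
Qed.
Fact tens_addN : left_inverse tens_zero tens_opp tens_add.
Proof.
move=> x; apply: tens_ext => V b bb.
by rewrite eval_add // eval_opp // eval_zero // addNr.
Qed.
HB.instance Definition _ :=
  GRing.isZmodule.Build tensor tens_addA tens_addC tens_add0 tens_addN.

Fact tens_scaleA a c x : tens_scale a (tens_scale c x) = tens_scale (a * c) x.
Proof. by apply: tens_ext => V b bb; rewrite !eval_scale // scalerA. Qed.
Fact tens_scale1 : left_id 1 tens_scale.
Proof. by move=> x; apply: tens_ext => V b bb; rewrite eval_scale // scale1r. Qed.
Fact tens_scaleDr : right_distributive tens_scale +%R.
Proof.
move=> a x y; apply: tens_ext => V b bb.
by rewrite eval_scale // !eval_add // !eval_scale // scalerDr.
Qed.
Fact tens_scaleDl x : {morph tens_scale^~ x : a c / a + c}.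
Proof.
move=> a c; apply: tens_ext => V b bb.
by rewrite eval_scale // eval_add // !eval_scale // scalerDl.
Qed.
HB.instance Definition _ := GRing.Zmodule_isLmodule.Build k tensor
  tens_scaleA tens_scale1 tens_scaleDr tens_scaleDl.

Definition tens (x : M) (y : N) : tensor := \pi_tensor [:: (x, y)].

Lemma tens_bilin : bilin tens.
Proof.
split=> [y a x x' | x a y y']; apply: tens_ext => V b bb;
  rewrite eval_add // eval_scale // !tens_reprP // /formal_eval !big_seq1 /=.
- exact: bb.1.
- exact: bb.2.
Qed.

Definition tens_lift V (b : M -> N -> V) (x : tensor) : V :=
  formal_eval b (repr x).

Lemma tens_lift_linear V (b : M -> N -> V) : bilin b -> linear (tens_lift b).
Proof. by move=> bb a x y; rewrite /tens_lift eval_add // eval_scale. Qed.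

Lemma tens_liftE V (b : M -> N -> V) x y : bilin b ->
  tens_lift b (tens x y) = b x y.
Proof. by move=> bb; rewrite /tens_lift tens_reprP // /formal_eval big_seq1. Qed.

Lemma tens_sum (x : tensor) : x = \sum_(p <- repr x) tens p.1 p.2.
Proof.
rewrite -{1}[x]reprK; elim: (repr x) => [|p s IH]; first by rewrite big_nil.
rewrite big_cons -IH; apply: tens_ext => V b bb.
rewrite eval_add // !tens_reprP // /formal_eval big_cons big_seq1; by [].
Qed.

Lemma tens_lin_ext V (f g : {linear tensor -> V}) :
  (forall x y, f (tens x y) = g (tens x y)) -> f =1 g.
Proof.
move=> fg x; rewrite [x]tens_sum !linear_sum.
by apply: eq_bigr => p _; apply: fg.
Qed.

End Construction.

Fact tens_map_bilin M N M' N' (f : {linear M -> M'}) (g : {linear N -> N'}) :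
  bilin (fun x y => tens (f x) (g y)).
Proof.
split=> [y a x x' | x a y y']; rewrite linearP.
- exact: (tens_bilin M' N').1.
- exact: (tens_bilin M' N').2.
Qed.

Definition tens_map M N M' N' (f : {linear M -> M'}) (g : {linear N -> N'}) :
    {linear tensor M N -> tensor M' N'} :=
  mklinear (tens_lift_linear (tens_map_bilin f g)).

Lemma tens_mapE M N M' N' (f : {linear M -> M'}) (g : {linear N -> N'}) x y :
  tens_map f g (tens x y) = tens (f x) (g y).
Proof. exact: (tens_liftE _ _ (tens_map_bilin f g)). Qed.

End TensorProduct.

Section LinearCategories.
Context (k : comPzRingType).

Record lcat_on (O : Type) := LcatOn {
  on_hom : O -> O -> lmodType k;
  on_id : forall A, on_hom A A;
  on_comp : forall A B C, on_hom B C -> on_hom A B -> on_hom A C;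
  on_comp_linr : forall A B C (g : on_hom B C), linear (@on_comp A B C g);
  on_comp_linl : forall A B C (f : on_hom A B), linear ((@on_comp A B C)^~ f);
  on_compA : forall A B C D (h : on_hom C D) (g : on_hom B C) (f : on_hom A B),
    on_comp h (on_comp g f) = on_comp (on_comp h g) f;
  on_comp1l : forall A B (f : on_hom A B), on_comp (on_id B) f = f;
  on_comp1r : forall A B (f : on_hom A B), on_comp f (on_id A) = f }.

Record lcat := Lcat { obj :> Type; lcat_str : lcat_on obj }.
Record slcat := Slcat { sobj : small; slcat_str : lcat_on sobj }.
Coercion lcat_of_slcat (a : slcat) : lcat := Lcat (slcat_str a).

Definition hom (C : lcat) : C -> C -> lmodType k := on_hom (lcat_str C).
Definition idm (C : lcat) (A : C) : hom A A := on_id (lcat_str C) A.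
Definition comp (C : lcat) (X Y Z : C) (g : hom Y Z) (f : hom X Y) : hom X Z :=
  on_comp (l := lcat_str C) g f.

Local Notation "g \oc f" := (comp g f) (at level 40, left associativity).

Section Laws.
Context (C : lcat).
Lemma comp_linr (X Y Z : C) (g : hom Y Z) : linear (@comp C X Y Z g).
Proof. exact: on_comp_linr. Qed.
Lemma comp_linl (X Y Z : C) (f : hom X Y) : linear ((@comp C X Y Z)^~ f).
Proof. exact: on_comp_linl. Qed.
Lemma compA (X Y Z W : C) (h : hom Z W) (g : hom Y Z) (f : hom X Y) :
  h \oc (g \oc f) = h \oc g \oc f.
Proof. exact: on_compA. Qed.
Lemma comp1l (X Y : C) (f : hom X Y) : idm Y \oc f = f.
Proof. exact: on_comp1l. Qed.
Lemma comp1r (X Y : C) (f : hom X Y) : f \oc idm X = f.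
Proof. exact: on_comp1r. Qed.

Definition is_iso (X Y : C) (f : hom X Y) : Prop :=
  exists g : hom Y X, g \oc f = idm X /\ f \oc g = idm Y.
Definition mono (X Y : C) (f : hom X Y) : Prop :=
  forall Z (g h : hom Z X), f \oc g = f \oc h -> g = h.
Definition epi (X Y : C) (f : hom X Y) : Prop :=
  forall Z (g h : hom Y Z), g \oc f = h \oc f -> g = h.
Definition jointly_epi (I : small) (X : I -> C) (Y : C)
    (f : forall i, hom (X i) Y) : Prop :=
  forall Z (g h : hom Y Z), (forall i, g \oc f i = h \oc f i) -> g = h.
End Laws.

Section Opposite.
Context (O : Type) (S : lcat_on O).
Definition op_on : lcat_on O := @LcatOn O (fun A B => on_hom S B A) (on_id S)
  (fun A B C g f => on_comp f g)
  (fun A B C g => @on_comp_linl _ S C B A g)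
  (fun A B C f => @on_comp_linr _ S C B A f)
  (fun A B C D h g f => esym (on_compA f g h))
  (fun A B f => on_comp1r f) (fun A B f => on_comp1l f).
End Opposite.
Definition opcat (C : lcat) : lcat := Lcat (op_on (lcat_str C)).

Record lfunctor (C D : lcat) := Lfunctor {
  fobj :> C -> D;
  fmap : forall X Y : C, hom X Y -> hom (fobj X) (fobj Y);
  fmap_lin : forall X Y, linear (@fmap X Y);
  fmap1 : forall X, fmap (idm X) = idm (fobj X);
  fmapM : forall X Y Z (g : hom Y Z) (f : hom X Y),
    fmap (g \oc f) = fmap g \oc fmap f }.

Record lnat (C D : lcat) (F G : lfunctor C D) := Lnat {
  napp :> forall X : C, hom (F X) (G X);
  nnat : forall (X Y : C) (f : hom X Y),
    napp Y \oc fmap F f = fmap G f \oc napp X }.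

Lemma lnat_ext C D (F G : lfunctor C D) (s t : lnat F G) :
  (forall X, s X = t X) -> s = t.
Proof.
case: s t => [s sP] [t tP] /= st.
have {}st : s = t by apply: functional_extensionality_dep.
by subst t; rewrite (Prop_irrelevance sP tP).
Qed.

Definition lfunctor_id (C : lcat) : lfunctor C C :=
  @Lfunctor C C id (fun _ _ f => f) (fun _ _ _ _ _ => erefl)
    (fun _ => erefl) (fun _ _ _ _ _ => erefl).

Section FunctorComp.
Context (C D E : lcat) (G : lfunctor D E) (F : lfunctor C D).
Fact fcomp_lin X Y : linear (fun f : hom X Y => fmap G (fmap F f)).
Proof. by move=> a f g; rewrite !fmap_lin. Qed.
Fact fcomp1 X : fmap G (fmap F (idm X)) = idm (G (F X)).
Proof. by rewrite !fmap1. Qed.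
Fact fcompM X Y Z (g : hom Y Z) (f : hom X Y) :
  fmap G (fmap F (g \oc f)) = fmap G (fmap F g) \oc fmap G (fmap F f).
Proof. by rewrite !fmapM. Qed.
Definition lfunctor_comp : lfunctor C E :=
  @Lfunctor C E (fun X => G (F X)) _ fcomp_lin fcomp1 fcompM.
End FunctorComp.

Definition nat_iso (C D : lcat) (F G : lfunctor C D) : Prop :=
  exists s : lnat F G, forall X, is_iso (s X).

Definition equivalent (C D : lcat) : Prop :=
  exists (F : lfunctor C D) (G : lfunctor D C),
    nat_iso (lfunctor_comp G F) (lfunctor_id C) /\
    nat_iso (lfunctor_comp F G) (lfunctor_id D).

Fact modk_linr (U V W : lmodType k) (g : {linear V -> W}) :
  linear (@lin_comp k U V W g).
Proof. by move=> a f h; apply: linear_ext => x /=; rewrite linearP. Qed.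
Fact modk_linl (U V W : lmodType k) (f : {linear U -> V}) :
  linear ((@lin_comp k U V W)^~ f).
Proof. by move=> a g h; apply: linear_ext. Qed.
Fact modk_compA (U V W Z : lmodType k) (h : {linear W -> Z})
    (g : {linear V -> W}) (f : {linear U -> V}) :
  lin_comp h (lin_comp g f) = lin_comp (lin_comp h g) f.
Proof. exact: linear_ext. Qed.
Fact modk_comp1l (U V : lmodType k) (f : {linear U -> V}) :
  lin_comp (lin_id V) f = f.
Proof. exact: linear_ext. Qed.
Fact modk_comp1r (U V : lmodType k) (f : {linear U -> V}) :
  lin_comp f (lin_id U) = f.
Proof. exact: linear_ext. Qed.

Definition Modk : lcat := Lcat (@LcatOn (lmodType k)
  (fun U V => {linear U -> V}) (@lin_id k) (@lin_comp k)
  modk_linr modk_linl modk_compA modk_comp1l modk_comp1r).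

Section HomFunctor.
Context (C : lcat) (G : C).
Definition homf_map (X Y : C) (f : hom X Y) : {linear hom G X -> hom G Y} :=
  mklinear (@comp_linr C G X Y f).
Fact homf_lin X Y : linear (@homf_map X Y).
Proof. by move=> a f g; apply: linear_ext => h /=; rewrite comp_linl. Qed.
Fact homf1 X : homf_map (idm X) = lin_id (hom G X).
Proof. by apply: linear_ext => h /=; rewrite comp1l. Qed.
Fact homfM X Y Z (g : hom Y Z) (f : hom X Y) :
  homf_map (g \oc f) = lin_comp (homf_map g) (homf_map f).
Proof. by apply: linear_ext => h /=; rewrite compA. Qed.
Definition hom_functor : lfunctor C Modk :=
  @Lfunctor C Modk (hom G) homf_map homf_lin homf1 homfM.
End HomFunctor.

Record icat := Icat {
  iob : small;
  imor : iob -> iob -> small;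
  iid : forall i, imor i i;
  icomp : forall i j l, imor j l -> imor i j -> imor i l;
  icompA : forall i j l m (h : imor l m) (g : imor j l) (f : imor i j),
    icomp h (icomp g f) = icomp (icomp h g) f;
  icomp1l : forall i j (f : imor i j), icomp (iid j) f = f;
  icomp1r : forall i j (f : imor i j), icomp f (iid i) = f }.

Record diagram (J : icat) (C : lcat) := Diagram {
  dob :> iob J -> C;
  dmap : forall i j, imor i j -> hom (dob i) (dob j);
  dmap1 : forall i, dmap (iid i) = idm (dob i);
  dmapM : forall i j l (g : imor j l) (f : imor i j),
    dmap (icomp g f) = dmap g \oc dmap f }.

Record cocone (J : icat) (C : lcat) (D : diagram J C) := Cocone {
  apex : C;
  leg : forall j, hom (D j) apex;
  leg_nat : forall i j (f : imor i j), leg j \oc dmap D f = leg i }.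

Definition is_colimit J C (D : diagram J C) (L : cocone D) : Prop :=
  forall L' : cocone D,
    exists! h : hom (apex L) (apex L'), forall j, h \oc leg L j = leg L' j.

Definition cocomplete (C : lcat) : Prop :=
  forall (J : icat) (D : diagram J C), exists L : cocone D, is_colimit L.

Section ImageDiagram.
Context (C E : lcat) (F : lfunctor C E) (J : icat) (D : diagram J C).
Fact map_diagram1 i : fmap F (dmap D (iid i)) = idm (F (D i)).
Proof. by rewrite dmap1 fmap1. Qed.
Fact map_diagramM i j l (g : imor j l) (f : imor i j) :
  fmap F (dmap D (icomp g f)) = fmap F (dmap D g) \oc fmap F (dmap D f).
Proof. by rewrite dmapM fmapM. Qed.
Definition map_diagram : diagram J E :=
  @Diagram J E (fun i => F (D i)) _ map_diagram1 map_diagramM.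
Fact map_cocone_nat (L : cocone D) i j (f : imor i j) :
  fmap F (leg L j) \oc dmap map_diagram f = fmap F (leg L i).
Proof. by rewrite /= -fmapM leg_nat. Qed.
Definition map_cocone (L : cocone D) : cocone map_diagram :=
  @Cocone J E map_diagram (F (apex L)) _ (@map_cocone_nat L).
End ImageDiagram.

Definition preserves_colimits_of_shape (J : icat) (C E : lcat)
    (F : lfunctor C E) : Prop :=
  forall (D : diagram J C) (L : cocone D),
    is_colimit L -> is_colimit (map_cocone F L).

Definition cocontinuous (C E : lcat) (F : lfunctor C E) : Prop :=
  forall J : icat, preserves_colimits_of_shape J F.

(* A cardinal is represented by a small set of that cardinality; by choice,
   [card_lt X Y] means |X| < |Y|. *)
Definition card_lt (X Y : small) : Prop := ~ exists f : Y -> X, injective f.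

Definition regular (K : small) : Prop :=
  (exists f : nat -> K, injective f) /\
  forall (I : small) (X : I -> small),
    card_lt I K -> (forall i, card_lt (X i) K) -> card_lt {i : I & X i} K.

Record ifunctor (I J : icat) := Ifunctor {
  ifob :> iob I -> iob J;
  ifmap : forall i j, imor i j -> imor (ifob i) (ifob j);
  ifmap1 : forall i, ifmap (iid i) = iid (ifob i);
  ifmapM : forall i j l (g : imor j l) (f : imor i j),
    ifmap (icomp g f) = icomp (ifmap g) (ifmap f) }.

Definition arrows (I : icat) : small := {p : iob I * iob I & imor p.1 p.2}.

Definition filtered_for (K : small) (J : icat) : Prop :=
  forall (I : icat) (D : ifunctor I J), card_lt (arrows I) K ->
    exists (j : iob J) (c : forall i, imor (D i) j),
      forall i i' (f : imor i i'), icomp (c i') (ifmap D f) = c i.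

Definition filtered : icat -> Prop := filtered_for nat.

Definition presented (K : small) (C : lcat) (G : C) : Prop :=
  forall J, filtered_for K J -> preserves_colimits_of_shape J (hom_functor G).

(* Kelly's notion: the functors Hom(G i, -) are jointly conservative. *)
Definition strong_generators (C : lcat) (I : small) (G : I -> C) : Prop :=
  forall (X Y : C) (f : hom X Y),
    (forall i, bijective (fun h : hom (G i) X => f \oc h)) -> is_iso f.

Definition locally_presentable (C : lcat) : Prop :=
  cocomplete C /\
  exists K : small, regular K /\
    exists (I : small) (G : I -> C),
      strong_generators G /\ forall i, presented K (G i).

Section Abelian.
Context (C : lcat).

(* [i] is a kernel of [f]; in [is_cokernel], [p] is a cokernel of [f]. *)
Definition is_kernel (X Y Z : C) (i : hom X Y) (f : hom Y Z) : Prop :=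
  f \oc i = 0 /\
  forall W (g : hom W Y), f \oc g = 0 -> exists! h : hom W X, i \oc h = g.

Definition is_cokernel (X Y Z : C) (p : hom Y Z) (f : hom X Y) : Prop :=
  p \oc f = 0 /\
  forall W (g : hom Y W), g \oc f = 0 -> exists! h : hom Z W, h \oc p = g.

Definition short_exact (X Y Z : C) (f : hom X Y) (g : hom Y Z) : Prop :=
  is_kernel f g /\ is_cokernel g f.

Definition has_zero : Prop := exists Z : C, idm Z = 0.

Definition has_biproducts : Prop := forall X Y : C,
  exists (S : C) (i1 : hom X S) (i2 : hom Y S) (p1 : hom S X) (p2 : hom S Y),
    [/\ p1 \oc i1 = idm X, p2 \oc i2 = idm Y, p1 \oc i2 = 0, p2 \oc i1 = 0
      & i1 \oc p1 + i2 \oc p2 = idm S].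

Record abelian : Prop := Abelian {
  ab_zero : has_zero;
  ab_biproducts : has_biproducts;
  ab_kernels : forall (X Y : C) (f : hom X Y),
    exists (Z : C) (i : hom Z X), is_kernel i f;
  ab_cokernels : forall (X Y : C) (f : hom X Y),
    exists (Z : C) (p : hom Y Z), is_cokernel p f;
  ab_mono : forall (X Y : C) (i : hom X Y),
    mono i -> exists (Z : C) (f : hom Y Z), is_kernel i f;
  ab_epi : forall (X Y : C) (p : hom X Y),
    epi p -> exists (Z : C) (f : hom Z X), is_cokernel p f }.

Definition exact_filtered_colimits : Prop :=
  forall (J : icat) (D1 D2 D3 : diagram J C)
    (s : forall j, hom (D1 j) (D2 j)) (t : forall j, hom (D2 j) (D3 j)),
  filtered J ->
  (forall i j (f : imor i j), s j \oc dmap D1 f = dmap D2 f \oc s i) ->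
  (forall i j (f : imor i j), t j \oc dmap D2 f = dmap D3 f \oc t i) ->
  (forall j, short_exact (s j) (t j)) ->
  forall (L1 : cocone D1) (L2 : cocone D2) (L3 : cocone D3)
    (f : hom (apex L1) (apex L2)) (g : hom (apex L2) (apex L3)),
  is_colimit L1 -> is_colimit L2 -> is_colimit L3 ->
  (forall j, f \oc leg L1 j = leg L2 j \oc s j) ->
  (forall j, g \oc leg L2 j = leg L3 j \oc t j) ->
  short_exact f g.

Definition has_generator : Prop :=
  exists G : C, forall (X Y : C) (f g : hom X Y),
    (forall h : hom G X, f \oc h = g \oc h) -> f = g.

Record grothendieck : Prop := Grothendieck {
  gr_abelian : abelian;
  gr_cocomplete : cocomplete C;
  gr_exact : exact_filtered_colimits;
  gr_generator : has_generator }.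

End Abelian.

Section Sites.
Context (a : slcat).

Record sieve (A : sobj a) := Sieve {
  sv : forall A' : sobj a, submodule (hom (A' : a) A);
  svM : forall (A' A'' : a) (f : hom A' A) (g : hom A'' A'),
    sv A' f -> sv A'' (f \oc g) }.

Definition max_sieve (A : sobj a) : sieve A :=
  @Sieve A (fun A' => @Submodule k (hom (A' : a) A) (fun _ => True) I
                        (fun _ _ _ _ _ => I))
         (fun _ _ _ _ _ => I).

Section Pullback.
Context (A A' : sobj a) (f : hom (A' : a) A) (R : sieve A).
Fact pull0 X : sv R X (f \oc (0 : hom (X : a) A')).
Proof.
have -> : f \oc (0 : hom (X : a) A') = 0 := linear0 (mklinear (comp_linr f)).
exact: smem0.
Qed.
Fact pullP X c (g h : hom (X : a) A') :
  sv R X (f \oc g) -> sv R X (f \oc h) -> sv R X (f \oc (c *: g + h)).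
Proof. by move=> Rg Rh; rewrite comp_linr; apply: smemP. Qed.
Fact pullM (X Y : a) (g : hom X A') (h : hom Y X) :
  sv R X (f \oc g) -> sv R Y (f \oc (g \oc h)).
Proof. by rewrite compA; apply: svM. Qed.
Definition pullback_sieve : sieve A' :=
  @Sieve A' (fun X => @Submodule k (hom (X : a) A')
                        (fun g => sv R X (f \oc g)) (pull0 X) (@pullP X))
         pullM.
End Pullback.

Record topology := Topology {
  tcov :> forall A : sobj a, sieve A -> Prop;
  tcov_max : forall A, tcov (max_sieve A);
  tcov_pull : forall A (R : sieve A), tcov R ->
    forall (A' : a) (f : hom A' (A : a)), tcov (pullback_sieve f R);
  tcov_glue : forall A (R S : sieve A), tcov R ->
    (forall (A' : a) (f : hom A' (A : a)), sv R A' f ->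
       tcov (pullback_sieve f S)) -> tcov S }.

Definition generated_by (I : small) (A : sobj a) (X : I -> a)
    (f : forall i, hom (X i) A) (R : sieve A) : Prop :=
  (forall i, sv R (X i) (f i)) /\
  forall S : sieve A, (forall i, sv S (X i) (f i)) ->
    forall (A' : a) (g : hom A' (A : a)), sv R A' g -> sv S A' g.

Definition covering (T : topology) (I : small) (A : sobj a) (X : I -> a)
    (f : forall i, hom (X i) A) : Prop :=
  exists R : sieve A, generated_by f R /\ T A R.

Definition presheaf := lfunctor (opcat a) Modk.
Definition pval (F : presheaf) (A : sobj a) : lmodType k := F A.
Definition pres (F : presheaf) (A A' : a) (f : hom A' A) :
  {linear pval F A -> pval F A'} := @fmap (opcat a) Modk F A A' f.

Record pshom (F G : presheaf) : small := Pshom {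
  papp : forall A : sobj a, {linear pval F A -> pval G A};
  pnat : forall (A A' : a) (f : hom A' A) (x : pval F A),
    papp A' (pres F f x) = pres G f (papp A x) }.

Lemma pshom_ext F G (s t : pshom F G) :
  (forall A x, papp s A x = papp t A x) -> s = t.
Proof.
case: s t => [s sP] [t tP] /= st.
have {}st : s = t.
  apply: functional_extensionality_dep => A; apply: linear_ext => x. exact: st.
by subst t; rewrite (Prop_irrelevance sP tP).
Qed.

Section PshomLmod.
Context (F G : presheaf).
Local Notation H := (pshom F G).
HB.instance Definition _ := gen_eqMixin H.
HB.instance Definition _ := gen_choiceMixin H.

Fact ps0P (A A' : a) (f : hom A' A) (x : pval F A) :
  (0 : {linear pval F A' -> pval G A'}) (pres F f x) =
  pres G f ((0 : {linear pval F A -> pval G A}) x).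
Proof. by rewrite /= linear0. Qed.
Fact psDP (s t : H) (A A' : a) (f : hom A' A) (x : pval F A) :
  (papp s A' + papp t A') (pres F f x) = pres G f ((papp s A + papp t A) x).
Proof. by rewrite /= !pnat linearD. Qed.
Fact psNP (s : H) (A A' : a) (f : hom A' A) (x : pval F A) :
  (- papp s A') (pres F f x) = pres G f ((- papp s A) x).
Proof. by rewrite /= !pnat linearN. Qed.
Fact psZP c (s : H) (A A' : a) (f : hom A' A) (x : pval F A) :
  (c *: papp s A') (pres F f x) = pres G f ((c *: papp s A) x).
Proof. by rewrite /= !pnat linearZ_LR. Qed.

Let zero : H := Pshom ps0P.
Let add (s t : H) : H := Pshom (psDP s t).
Let opp (s : H) : H := Pshom (psNP s).
Let scale c (s : H) : H := Pshom (psZP c s).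

Fact psaddA : associative add.
Proof. by move=> s t u; apply: pshom_ext => A x /=; rewrite addrA. Qed.
Fact psaddC : commutative add.
Proof. by move=> s t; apply: pshom_ext => A x /=; rewrite addrC. Qed.
Fact psadd0 : left_id zero add.
Proof. by move=> s; apply: pshom_ext => A x /=; rewrite add0r. Qed.
Fact psaddN : left_inverse zero opp add.
Proof. by move=> s; apply: pshom_ext => A x /=; rewrite addNr. Qed.
HB.instance Definition _ := GRing.isZmodule.Build H psaddA psaddC psadd0 psaddN.

Fact psscaleA c d s : scale c (scale d s) = scale (c * d) s.
Proof. by apply: pshom_ext => A x /=; rewrite scalerA. Qed.
Fact psscale1 : left_id 1 scale.
Proof. by move=> s; apply: pshom_ext => A x /=; rewrite scale1r. Qed.
Fact psscaleDr : right_distributive scale +%R.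
Proof. by move=> c s t; apply: pshom_ext => A x /=; rewrite scalerDr. Qed.
Fact psscaleDl s : {morph scale^~ s : c d / c + d}.
Proof. by move=> c d; apply: pshom_ext => A x /=; rewrite scalerDl. Qed.
HB.instance Definition _ := GRing.Zmodule_isLmodule.Build k H
  psscaleA psscale1 psscaleDr psscaleDl.
End PshomLmod.

Fact ps_id_nat (F : presheaf) (A A' : a) (f : hom A' A) (x : pval F A) :
  lin_id _ (pres F f x) = pres F f (lin_id _ x).
Proof. by []. Qed.
Definition ps_id (F : presheaf) : pshom F F := Pshom (@ps_id_nat F).

Fact ps_comp_nat (F G H : presheaf) (t : pshom G H) (s : pshom F G)
    (A A' : a) (f : hom A' A) (x : pval F A) :
  lin_comp (papp t A') (papp s A') (pres F f x) =
  pres H f (lin_comp (papp t A) (papp s A) x).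
Proof. by rewrite /= !pnat. Qed.
Definition ps_comp (F G H : presheaf) (t : pshom G H) (s : pshom F G) :
  pshom F H := Pshom (ps_comp_nat t s).

Section SievePresheaf.
Context (A : sobj a) (R : sieve A).
Definition sv_val (X : sobj a) : lmodType k := submod (sv R X).
Definition sv_act_fun (X Y : a) (g : hom Y X) (f : sv_val X) : sv_val Y :=
  Submod (svM g (svalP f)).
Fact sv_act_lin (X Y : a) (g : hom Y X) : linear (sv_act_fun g).
Proof. by move=> c f f'; apply: submod_ext => /=; rewrite comp_linl. Qed.
Definition sv_act (X Y : a) (g : hom Y X) : {linear sv_val X -> sv_val Y} :=
  mklinear (sv_act_lin g).
Fact sv_act_linear (X Y : opcat a) :
  linear (fun g : hom (X : opcat a) Y => sv_act g : hom (sv_val X : Modk) (sv_val Y)).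
Proof.
move=> c g h; apply: linear_ext => f; apply: submod_ext => /=.
exact: (@comp_linr a).
Qed.
Fact sv_act1 (X : opcat a) : sv_act (idm X) = lin_id (sv_val X).
Proof. by apply: linear_ext => f; apply: submod_ext; apply: (@comp1r a). Qed.
Fact sv_actM (X Y Z : opcat a) (h : hom Y Z) (g : hom X Y) :
  sv_act (h \oc g) = lin_comp (sv_act h) (sv_act g).
Proof. by apply: linear_ext => f; apply: submod_ext; apply: (@compA a). Qed.
Definition sieve_presheaf : presheaf :=
  @Lfunctor (opcat a) Modk sv_val (fun X Y g => sv_act g)
    sv_act_linear sv_act1 sv_actM.
End SievePresheaf.

(* The map F(A) = Hom(a(-,A),F) -> Hom(R,F) sends [x] to f |-> F(f)(x). *)
Definition is_sheaf (T : topology) (F : presheaf) : Prop :=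
  forall (A : sobj a) (R : sieve A), T A R ->
  forall s : pshom (sieve_presheaf R) F,
    exists! x : pval F A, forall (A' : sobj a) (f : submod (sv R A')),
      papp s A' f = pres F (sval f) x.

Section Sheaves.
Context (T : topology).
Local Notation sheaf := {F : presheaf | is_sheaf T F}.
Fact sh_linr (F G H : sheaf) (t : pshom (proj1_sig G) (proj1_sig H)) :
  linear (@ps_comp (proj1_sig F) _ _ t).
Proof. by move=> c r s; apply: pshom_ext => A x /=; rewrite linearP. Qed.
Fact sh_linl (F G H : sheaf) (s : pshom (proj1_sig F) (proj1_sig G)) :
  linear ((@ps_comp _ _ (proj1_sig H))^~ s).
Proof. by move=> c t r; apply: pshom_ext. Qed.
Fact sh_compA (F G H K : sheaf) (t : pshom (proj1_sig H) (proj1_sig K))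
    (s : pshom (proj1_sig G) (proj1_sig H))
    (r : pshom (proj1_sig F) (proj1_sig G)) :
  ps_comp t (ps_comp s r) = ps_comp (ps_comp t s) r.
Proof. exact: pshom_ext. Qed.
Fact sh_comp1l (F G : sheaf) (s : pshom (proj1_sig F) (proj1_sig G)) :
  ps_comp (ps_id _) s = s.
Proof. exact: pshom_ext. Qed.
Fact sh_comp1r (F G : sheaf) (s : pshom (proj1_sig F) (proj1_sig G)) :
  ps_comp s (ps_id _) = s.
Proof. exact: pshom_ext. Qed.
Definition Sh : lcat := Lcat (@LcatOn sheaf
  (fun F G => pshom (proj1_sig F) (proj1_sig G)) (fun F => ps_id (proj1_sig F))
  (fun F G H => @ps_comp (proj1_sig F) (proj1_sig G) (proj1_sig H))
  sh_linr sh_linl sh_compA sh_comp1l sh_comp1r).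
End Sheaves.

Section LC.
Context (T : topology) (C : lcat) (u : lfunctor a C).

Record LC_morphism : Prop := LCMorphism {
  lc_G : forall Y : C, exists (I : small) (A : I -> a)
    (c : forall i, hom (u (A i)) Y), jointly_epi c;
  lc_F : forall (A A' : a) (c : hom (u A) (u A')),
    exists (I : small) (X : I -> a) (x : forall i, hom (X i) A)
           (f : forall i, hom (X i) A'),
      covering T x /\ forall i, c \oc fmap u (x i) = fmap u (f i);
  lc_FF : forall (A A' : a) (f : hom A A'), fmap u f = 0 ->
    exists (I : small) (X : I -> a) (x : forall i, hom (X i) A),
      covering T x /\ forall i, f \oc x i = 0;
  lc_top : forall (A : sobj a) (R : sieve A), T A R <->
    @jointly_epi C {A' : sobj a & submod (sv R A')} (fun p => u (projT1 p))
      (u A) (fun p => fmap u (sval (projT2 p))) }.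
End LC.

End Sites.

Section TensorSites.
Context (a b : slcat).

Local Notation O := (sobj a * sobj b)%type.
Definition tc_hom (P Q : O) : lmodType k :=
  tensor (hom (P.1 : a) Q.1) (hom (P.2 : b) Q.2).
Definition tc_id (P : O) : tc_hom P P := tens (idm (P.1 : a)) (idm (P.2 : b)).

(* (g (x) g') o (f (x) f') = (g o f) (x) (g' o f'), extended bilinearly. *)
Definition tc_comp_pure (P Q S : O) (g : hom (Q.1 : a) S.1)
    (g' : hom (Q.2 : b) S.2) : {linear tc_hom P Q -> tc_hom P S} :=
  tens_map (mklinear (comp_linr g)) (mklinear (comp_linr g')).
Definition tc_comp (P Q S : O) (y : tc_hom Q S) (x : tc_hom P Q) :
    tc_hom P S :=
  tens_lift (fun g g' => tc_comp_pure P g g' : {linear tc_hom P Q -> tc_hom P S})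
            y x.

Fact tc_comp_pureE (P Q S : O) (g : hom (Q.1 : a) S.1) (g' : hom (Q.2 : b) S.2)
    (f : hom (P.1 : a) Q.1) (f' : hom (P.2 : b) Q.2) :
  tc_comp_pure P g g' (tens f f') = tens (g \oc f) (g' \oc f').
Proof. exact: (tens_mapE (mklinear _) (mklinear _)). Qed.

Fact tc_comp_bilin (P Q S : O) :
  bilin (fun g g' => tc_comp_pure P g g' : {linear tc_hom P Q -> tc_hom P S}).
Proof.
split=> [g' c g h | g c g' h'];
  apply: linear_ext; apply: tens_lin_ext => f f';
  rewrite lin_linE !tc_comp_pureE comp_linl.
- exact: (tens_bilin _ _).1.
- exact: (tens_bilin _ _).2.
Qed.

Lemma tc_compE (P Q S : O) (g : hom (Q.1 : a) S.1) (g' : hom (Q.2 : b) S.2)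
    (f : hom (P.1 : a) Q.1) (f' : hom (P.2 : b) Q.2) :
  tc_comp (tens g g') (tens f f') = tens (g \oc f) (g' \oc f').
Proof. by rewrite /tc_comp tens_liftE ?tc_comp_pureE //; apply: tc_comp_bilin. Qed.

Fact tc_comp_linr (P Q S : O) (y : tc_hom Q S) : linear (@tc_comp P Q S y).
Proof. by move=> c x x'; rewrite /tc_comp linearP. Qed.

Fact tc_comp_linl (P Q S : O) (x : tc_hom P Q) :
  linear ((@tc_comp P Q S)^~ x).
Proof.
move=> c y y'; rewrite /tc_comp.
by rewrite (tens_lift_linear (@tc_comp_bilin P Q S)) lin_linE.
Qed.

Fact tc_compA (P Q S W : O) (z : tc_hom S W) (y : tc_hom Q S) (x : tc_hom P Q) :
  tc_comp z (tc_comp y x) = tc_comp (tc_comp z y) x.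
Proof.
pose r1 x := mklinear (@tc_comp_linr _ _ _ x : linear (@tc_comp P Q S x)).
pose l1 X Y Z x := mklinear (@tc_comp_linl X Y Z x).
pose r2 X Y Z x := mklinear (@tc_comp_linr X Y Z x).
apply: (@tens_lin_ext _ _ _ _
  (lin_comp (r2 _ _ _ z) (r2 _ _ _ y)) (r2 _ _ _ (tc_comp z y))) => f f' /=.
apply: (@tens_lin_ext _ _ _ _
  (lin_comp (r2 _ _ _ z) (l1 _ _ _ (tens f f')))
  (lin_comp (l1 _ _ _ (tens f f')) (r2 _ _ _ z))) => g g' /=.
apply: (@tens_lin_ext _ _ _ _
  (l1 _ _ _ (tc_comp (tens g g') (tens f f')))
  (lin_comp (l1 _ _ _ (tens f f')) (l1 _ _ _ (tens g g')))) => h h' /=.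
by rewrite !tc_compE !compA.
Qed.

Fact tc_comp1l (P Q : O) (x : tc_hom P Q) : tc_comp (tc_id Q) x = x.
Proof.
apply: (@tens_lin_ext _ _ _ _
  (mklinear (tc_comp_linr (tc_id Q))) (lin_id _)) => f f' /=.
by rewrite tc_compE !comp1l.
Qed.

Fact tc_comp1r (P Q : O) (x : tc_hom P Q) : tc_comp x (tc_id P) = x.
Proof.
apply: (@tens_lin_ext _ _ _ _
  (mklinear (@tc_comp_linl P P Q (tc_id P))) (lin_id _)) => f f' /=.
by rewrite tc_compE !comp1r.
Qed.

Definition tensor_cat : slcat := Slcat (@LcatOn O tc_hom tc_id tc_comp
  tc_comp_linr tc_comp_linl tc_compA tc_comp1l tc_comp1r).

Section TensorSieve.
Context (A : sobj a) (B : sobj b) (R : sieve A) (S : sieve B).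
Local Notation AB := ((A, B) : sobj tensor_cat).

Definition ts_map (P : O) :
    {linear tensor (submod (sv R P.1)) (submod (sv S P.2)) -> tc_hom P (A, B)} :=
  tens_map (submod_incl (sv R P.1)) (submod_incl (sv S P.2)).
Definition ts_mem (P : O) (x : tc_hom P (A, B)) : Prop :=
  exists t, ts_map P t = x.

Fact ts_mem0 P : ts_mem (0 : tc_hom P (A, B)).
Proof. by exists 0; rewrite linear0. Qed.
Fact ts_memP P c (x y : tc_hom P (A, B)) :
  ts_mem x -> ts_mem y -> ts_mem (c *: x + y).
Proof. by move=> [t <-] [t' <-]; exists (c *: t + t'); rewrite linearP. Qed.
Definition ts_sub P : submodule (tc_hom P (A, B)) :=
  Submodule (ts_mem0 P) (@ts_memP P).

Fact ts_memM (P Q : tensor_cat) (x : hom P AB) (y : hom Q P) :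
  ts_sub P x -> ts_sub Q (x \oc y).
Proof.
case=> t <- {x}; rewrite [t]tens_sum linear_sum [y]tens_sum.
set s := repr t; set r := repr y.
rewrite -[_ \oc _]/(mklinear (@tc_comp_linr Q P AB _) _) linear_sum.
apply: (smem_sum (S := ts_sub Q)) => p.
rewrite -[mklinear _ _]/(mklinear (@tc_comp_linl Q P AB _) _) linear_sum.
apply: (smem_sum (S := ts_sub Q)) => q.
exists (tens (sv_act R p.1 q.1) (sv_act S p.2 q.2)).
rewrite -[RHS]/(tc_comp (ts_map P (tens q.1 q.2)) (tens p.1 p.2)).
by rewrite /ts_map !tens_mapE tc_compE.
Qed.

Definition tensor_sieve : @sieve tensor_cat (A, B) :=
  @Sieve tensor_cat (A, B) ts_sub ts_memM.
End TensorSieve.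

Context (Ta : topology a) (Tb : topology b).

Definition contains_tensor_sieves (T : topology tensor_cat) : Prop :=
  (forall A B (R : sieve A), Ta A R -> T _ (tensor_sieve R (max_sieve B))) /\
  (forall A B (S : sieve B), Tb B S -> T _ (tensor_sieve (max_sieve A) S)).

Definition tt_cov (P : sobj tensor_cat) (W : sieve P) : Prop :=
  forall T : topology tensor_cat, contains_tensor_sieves T -> T P W.

Fact tt_max P : tt_cov (max_sieve P).
Proof. by move=> T _; apply: tcov_max. Qed.
Fact tt_pull P (W : sieve P) : tt_cov W ->
  forall (Q : tensor_cat) (f : hom Q (P : tensor_cat)),
    tt_cov (pullback_sieve f W).
Proof. by move=> cW Q f T hT; apply: tcov_pull; apply: cW. Qed.
Fact tt_glue P (W V : sieve P) : tt_cov W ->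
  (forall (Q : tensor_cat) (f : hom Q (P : tensor_cat)), sv W Q f ->
     tt_cov (pullback_sieve f V)) -> tt_cov V.
Proof.
by move=> cW H T hT; apply: (tcov_glue (cW T hT)) => Q f Wf; apply: H.
Qed.
Definition tensor_topology : topology tensor_cat :=
  Topology tt_max tt_pull tt_glue.

End TensorSites.

Record bifunctor (A B E : lcat) := Bifunctor {
  bobj :> A -> B -> E;
  bmap : forall (X X' : A) (Y Y' : B), hom X X' -> hom Y Y' ->
    hom (bobj X Y) (bobj X' Y');
  bmap1 : forall X Y, bmap (idm X) (idm Y) = idm (bobj X Y);
  bmapM : forall (X X' X'' : A) (Y Y' Y'' : B) (f' : hom X' X'')
      (f : hom X X') (g' : hom Y' Y'') (g : hom Y Y'),
    bmap (f' \oc f) (g' \oc g) = bmap f' g' \oc bmap f g;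
  bmap_linl : forall (X X' : A) (Y : B),
    linear (fun f : hom X X' => bmap f (idm Y));
  bmap_linr : forall (X : A) (Y Y' : B),
    linear (fun g : hom Y Y' => bmap (idm X) g) }.

Section Partial.
Context (A B E : lcat) (T : bifunctor A B E).
Fact partl_M (Y : B) (X X' X'' : A) (g : hom X' X'') (f : hom X X') :
  bmap T (g \oc f) (idm Y) = bmap T g (idm Y) \oc bmap T f (idm Y).
Proof. by rewrite -bmapM comp1l. Qed.
Fact partr_M (X : A) (Y Y' Y'' : B) (g : hom Y' Y'') (f : hom Y Y') :
  bmap T (idm X) (g \oc f) = bmap T (idm X) g \oc bmap T (idm X) f.
Proof. by rewrite -bmapM comp1l. Qed.
Definition partl (Y : B) : lfunctor A E :=
  @Lfunctor A E (fun X => T X Y) (fun X X' f => bmap T f (idm Y))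
    (fun X X' => @bmap_linl _ _ _ T X X' Y) (fun X => bmap1 T X Y) (@partl_M Y).
Definition partr (X : A) : lfunctor B E :=
  @Lfunctor B E (fun Y => T X Y) (fun Y Y' g => bmap T (idm X) g)
    (fun Y Y' => @bmap_linr _ _ _ T X Y Y') (fun Y => bmap1 T X Y) (@partr_M X).
End Partial.

Definition bicocontinuous (A B E : lcat) (T : bifunctor A B E) : Prop :=
  (forall Y, cocontinuous (partl T Y)) /\ (forall X, cocontinuous (partr T X)).

Record bnat (A B E : lcat) (S T : bifunctor A B E) := Bnat {
  bapp :> forall X Y, hom (S X Y) (T X Y);
  bnatP : forall (X X' : A) (Y Y' : B) (f : hom X X') (g : hom Y Y'),
    bapp X' Y' \oc bmap S f g = bmap T f g \oc bapp X Y }.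

Lemma bnat_ext A B E (S T : bifunctor A B E) (s t : bnat S T) :
  (forall X Y, s X Y = t X Y) -> s = t.
Proof.
case: s t => [s sP] [t tP] /= st.
have {}st : s = t.
  apply: functional_extensionality_dep => X.
  by apply: functional_extensionality_dep => Y; apply: st.
by subst t; rewrite (Prop_irrelevance sP tP).
Qed.

Section PostComposition.
Context (A B E E' : lcat) (G : lfunctor E E') (T : bifunctor A B E).
Fact bpost1 X Y : fmap G (bmap T (idm X) (idm Y)) = idm (G (T X Y)).
Proof. by rewrite bmap1 fmap1. Qed.
Fact bpostM (X X' X'' : A) (Y Y' Y'' : B) (f' : hom X' X'')
    (f : hom X X') (g' : hom Y' Y'') (g : hom Y Y') :
  fmap G (bmap T (f' \oc f) (g' \oc g)) =
  fmap G (bmap T f' g') \oc fmap G (bmap T f g).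
Proof. by rewrite bmapM fmapM. Qed.
Fact bpost_linl (X X' : A) (Y : B) :
  linear (fun f : hom X X' => fmap G (bmap T f (idm Y))).
Proof. by move=> c f g; rewrite bmap_linl fmap_lin. Qed.
Fact bpost_linr (X : A) (Y Y' : B) :
  linear (fun g : hom Y Y' => fmap G (bmap T (idm X) g)).
Proof. by move=> c f g; rewrite bmap_linr fmap_lin. Qed.
Definition bpost : bifunctor A B E' :=
  @Bifunctor A B E' (fun X Y => G (T X Y)) _
    bpost1 bpostM bpost_linl bpost_linr.
End PostComposition.

(* Natural transformations between functors with a large source need not form
   a small set; hence plain, not k-linear, categories here. *)
Record cat := Cat {
  cob :> Type;
  cmor : cob -> cob -> Type;
  cid : forall x, cmor x x;
  ccomp : forall x y z, cmor y z -> cmor x y -> cmor x z;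
  ccompA : forall x y z w (h : cmor z w) (g : cmor y z) (f : cmor x y),
    ccomp h (ccomp g f) = ccomp (ccomp h g) f;
  ccomp1l : forall x y (f : cmor x y), ccomp (cid y) f = f;
  ccomp1r : forall x y (f : cmor x y), ccomp f (cid x) = f }.

Definition ciso (X : cat) (x y : X) (f : cmor x y) : Prop :=
  exists g : cmor y x, ccomp g f = cid x /\ ccomp f g = cid y.

Record cfunctor (X Y : cat) := Cfunctor {
  cfob :> X -> Y;
  cfmap : forall x x' : X, cmor x x' -> cmor (cfob x) (cfob x');
  cfmap1 : forall x, cfmap (cid x) = cid (cfob x);
  cfmapM : forall x y z (g : cmor y z) (f : cmor x y),
    cfmap (ccomp g f) = ccomp (cfmap g) (cfmap f) }.

Definition cequivalence (X Y : cat) (F : cfunctor X Y) : Prop :=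
  exists (G : cfunctor Y X)
    (eta : forall x : X, cmor x (G (F x)))
    (eps : forall y : Y, cmor (F (G y)) y),
  [/\ forall x x' (f : cmor x x'),
        ccomp (eta x') f = ccomp (cfmap G (cfmap F f)) (eta x),
      forall y y' (g : cmor y y'),
        ccomp (eps y') (cfmap F (cfmap G g)) = ccomp g (eps y),
      forall x, ciso (eta x)
    & forall y, ciso (eps y)].

Section LnatComp.
Context (C D : lcat).
Fact lnat_id_nat (F : lfunctor C D) (X Y : C) (f : hom X Y) :
  idm (F Y) \oc fmap F f = fmap F f \oc idm (F X).
Proof. by rewrite comp1l comp1r. Qed.
Definition lnat_id (F : lfunctor C D) : lnat F F := Lnat (@lnat_id_nat F).
Fact lnat_comp_nat (F G H : lfunctor C D) (t : lnat G H) (s : lnat F G)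
    (X Y : C) (f : hom X Y) :
  (t Y \oc s Y) \oc fmap F f = fmap H f \oc (t X \oc s X).
Proof. by rewrite -compA nnat compA nnat compA. Qed.
Definition lnat_comp F G H (t : lnat G H) (s : lnat F G) : lnat F H :=
  Lnat (lnat_comp_nat t s).
End LnatComp.

Section BnatComp.
Context (A B E : lcat).
Fact bnat_id_nat (T : bifunctor A B E) (X X' : A) (Y Y' : B) (f : hom X X')
    (g : hom Y Y') :
  idm (T X' Y') \oc bmap T f g = bmap T f g \oc idm (T X Y).
Proof. by rewrite comp1l comp1r. Qed.
Definition bnat_id (T : bifunctor A B E) : bnat T T := Bnat (@bnat_id_nat T).
Fact bnat_comp_nat (R S T : bifunctor A B E) (t : bnat S T) (s : bnat R S)
    (X X' : A) (Y Y' : B) (f : hom X X') (g : hom Y Y') :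
  (t X' Y' \oc s X' Y') \oc bmap R f g = bmap T f g \oc (t X Y \oc s X Y).
Proof. by rewrite -compA bnatP compA bnatP compA. Qed.
Definition bnat_comp R S T (t : bnat S T) (s : bnat R S) : bnat R T :=
  Bnat (bnat_comp_nat t s).
End BnatComp.

Section CocontCat.
Context (P E : lcat).
Record cocont_functor := CocontFunctor {
  cc_fun :> lfunctor P E; cc_cocont : cocontinuous cc_fun }.
Fact cocont_A (F G H K : cocont_functor) (u : lnat H K) (t : lnat G H)
    (s : lnat F G) : lnat_comp u (lnat_comp t s) = lnat_comp (lnat_comp u t) s.
Proof. by apply: lnat_ext => X; apply: compA. Qed.
Fact cocont_1l (F G : cocont_functor) (s : lnat F G) :
  lnat_comp (lnat_id G) s = s.
Proof. by apply: lnat_ext => X; apply: comp1l. Qed.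
Fact cocont_1r (F G : cocont_functor) (s : lnat F G) :
  lnat_comp s (lnat_id F) = s.
Proof. by apply: lnat_ext => X; apply: comp1r. Qed.
Definition Cocont : cat := @Cat cocont_functor (fun F G => lnat F G)
  (fun F => lnat_id F) (fun F G H t s => lnat_comp t s)
  cocont_A cocont_1l cocont_1r.
End CocontCat.

Section BicocontCat.
Context (A B E : lcat).
Record bicocont_functor := BicocontFunctor {
  bc_fun :> bifunctor A B E; bc_cocont : bicocontinuous bc_fun }.
Fact bicocont_A (F G H K : bicocont_functor) (u : bnat H K) (t : bnat G H)
    (s : bnat F G) : bnat_comp u (bnat_comp t s) = bnat_comp (bnat_comp u t) s.
Proof. by apply: bnat_ext => X Y; apply: compA. Qed.
Fact bicocont_1l (F G : bicocont_functor) (s : bnat F G) :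
  bnat_comp (bnat_id G) s = s.
Proof. by apply: bnat_ext => X Y; apply: comp1l. Qed.
Fact bicocont_1r (F G : bicocont_functor) (s : bnat F G) :
  bnat_comp s (bnat_id F) = s.
Proof. by apply: bnat_ext => X Y; apply: comp1r. Qed.
Definition Bicocont : cat := @Cat bicocont_functor (fun F G => bnat F G)
  (fun F => bnat_id F) (fun F G H t s => bnat_comp t s)
  bicocont_A bicocont_1l bicocont_1r.
End BicocontCat.

Lemma cocontinuous_id (E : lcat) : cocontinuous (lfunctor_id E).
Proof.
move=> J D L HL L'.
pose L'' : cocone D := @Cocone J E D (apex L') (leg L') (@leg_nat J E _ L').
exact: HL L''.
Qed.

Lemma cocontinuous_comp (C D E : lcat) (G : lfunctor D E) (F : lfunctor C D) :
  cocontinuous G -> cocontinuous F -> cocontinuous (lfunctor_comp G F).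
Proof.
move=> cG cF J X L HL L'.
pose L'' : cocone (map_diagram G (map_diagram F X)) :=
  @Cocone J E (map_diagram G (map_diagram F X)) (apex L') (leg L')
    (@leg_nat J E _ L').
exact: (cG J _ _ (cF J _ _ HL) L'').
Qed.

Lemma bicocontinuous_post (A B E E' : lcat) (G : lfunctor E E')
    (T : bifunctor A B E) :
  cocontinuous G -> bicocontinuous T -> bicocontinuous (bpost G T).
Proof.
move=> cG [cl cr]; split=> [Y | X] J D L HL L'.
- pose L'' : cocone (map_diagram G (map_diagram (partl T Y) D)) :=
    @Cocone J E' (map_diagram G (map_diagram (partl T Y) D)) (apex L') (leg L')
      (@leg_nat J E' _ L').
  exact: (cG J _ _ (cl Y J _ _ HL) L'').
- pose L'' : cocone (map_diagram G (map_diagram (partr T X) D)) :=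
    @Cocone J E' (map_diagram G (map_diagram (partr T X) D)) (apex L') (leg L')
      (@leg_nat J E' _ L').
  exact: (cG J _ _ (cr X J _ _ HL) L'').
Qed.

Definition cocont_id (E : lcat) : cocont_functor E E :=
  CocontFunctor (@cocontinuous_id E).
Definition cocont_comp C D E (G : cocont_functor D E) (F : cocont_functor C D) :
  cocont_functor C E :=
  CocontFunctor (@cocontinuous_comp C D E G F (@cc_cocont _ _ G) (@cc_cocont _ _ F)).
Definition bicocont_post A B E E' (G : cocont_functor E E')
    (T : bicocont_functor A B E) : bicocont_functor A B E' :=
  BicocontFunctor
    (@bicocontinuous_post A B E E' G T (@cc_cocont _ _ G) (@bc_cocont _ _ _ T)).

Section Whiskering.
Context (C E E' : lcat).
Fact whisker_l_nat (G : lfunctor E E') (F F' : lfunctor C E) (s : lnat F F')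
    (X Y : C) (f : hom X Y) :
  fmap G (s Y) \oc fmap (lfunctor_comp G F) f =
  fmap (lfunctor_comp G F') f \oc fmap G (s X).
Proof. by rewrite /= -!fmapM nnat. Qed.
Definition whisker_l G F F' (s : lnat F F') :
  lnat (lfunctor_comp G F) (lfunctor_comp G F') :=
  @Lnat _ _ (lfunctor_comp G F) (lfunctor_comp G F') _ (whisker_l_nat G s).

Fact whisker_r_nat (G G' : lfunctor E E') (t : lnat G G') (F : lfunctor C E)
    (X Y : C) (f : hom X Y) :
  t (F Y) \oc fmap (lfunctor_comp G F) f =
  fmap (lfunctor_comp G' F) f \oc t (F X).
Proof. exact: (@nnat _ _ _ _ t _ _ (fmap F f)). Qed.
Definition whisker_r G G' (t : lnat G G') F :
  lnat (lfunctor_comp G F) (lfunctor_comp G' F) :=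
  @Lnat _ _ (lfunctor_comp G F) (lfunctor_comp G' F) _ (whisker_r_nat t F).
End Whiskering.

(* The canonical isomorphisms  1 F => F  and  (G' G) F => G' (G F), whose
   components are identities. *)
Section Canonical.
Context (C D E E' : lcat).
Fact lunit_nat (F : lfunctor C D) (X Y : C) (f : hom X Y) :
  idm (F Y) \oc fmap (lfunctor_comp (lfunctor_id D) F) f =
  fmap F f \oc idm (F X).
Proof. by rewrite comp1l comp1r. Qed.
Definition lunit (F : lfunctor C D) : lnat (lfunctor_comp (lfunctor_id D) F) F :=
  @Lnat _ _ (lfunctor_comp (lfunctor_id D) F) F _ (@lunit_nat F).
Fact lassoc_nat (H : lfunctor E E') (G : lfunctor D E) (F : lfunctor C D)
    (X Y : C) (f : hom X Y) :
  idm (H (G (F Y))) \oc fmap (lfunctor_comp (lfunctor_comp H G) F) f =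
  fmap (lfunctor_comp H (lfunctor_comp G F)) f \oc idm (H (G (F X))).
Proof. by rewrite comp1l comp1r. Qed.
Definition lassoc (H : lfunctor E E') (G : lfunctor D E) (F : lfunctor C D) :
  lnat (lfunctor_comp (lfunctor_comp H G) F)
       (lfunctor_comp H (lfunctor_comp G F)) :=
  @Lnat _ _ (lfunctor_comp (lfunctor_comp H G) F)
    (lfunctor_comp H (lfunctor_comp G F)) _ (@lassoc_nat H G F).
End Canonical.

(* A natural equivalence Cocont(P, E) = Cocont(A, B; E), E ranging over the
   cocomplete categories.  As E ranges over a 2-category, natural means
   pseudonatural: for cocontinuous G : E -> E' there is an isomorphism
   [rho_nat] G o Phi_E(H) = Phi_E'(G o H), natural in H and in G and compatible
   with identities and composition.  (Linearity of Phi_E is automatic: these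
   conditions identify it with composition with the bifunctor Phi_P(1).) *)
Record represents (A B P : lcat) := Represents {
  rho : forall E, cocomplete E -> cfunctor (Cocont P E) (Bicocont A B E);
  rho_equiv : forall E (cE : cocomplete E), cequivalence (rho cE);
  rho_nat : forall E E' (cE : cocomplete E) (cE' : cocomplete E')
      (G : cocont_functor E E') (H : cocont_functor P E),
    bnat (bicocont_post G (rho cE H)) (rho cE' (cocont_comp G H));
  rho_nat_iso : forall E E' (cE : cocomplete E) (cE' : cocomplete E')
      (G : cocont_functor E E') (H : cocont_functor P E) X Y,
    is_iso (rho_nat cE cE' G H X Y);
  rho_nat_H : forall E E' (cE : cocomplete E) (cE' : cocomplete E')
      (G : cocont_functor E E') (H H' : Cocont P E) (s : cmor H H') X Y,
    rho_nat cE cE' G H' X Y \oc fmap G ((cfmap (rho cE) s : bnat _ _) X Y) =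
    (cfmap (rho cE') (whisker_l G s
       : @cmor (Cocont P E') (cocont_comp G H) (cocont_comp G H'))
       : bnat _ _) X Y \oc rho_nat cE cE' G H X Y;
  rho_nat_G : forall E E' (cE : cocomplete E) (cE' : cocomplete E')
      (G G' : cocont_functor E E') (t : lnat G G') (H : cocont_functor P E) X Y,
    rho_nat cE cE' G' H X Y \oc t (rho cE H X Y) =
    (cfmap (rho cE') (whisker_r t H
       : @cmor (Cocont P E') (cocont_comp G H) (cocont_comp G' H))
       : bnat _ _) X Y \oc rho_nat cE cE' G H X Y;
  rho_nat_id : forall E (cE : cocomplete E) (H : cocont_functor P E) X Y,
    (cfmap (rho cE) (lunit H
       : @cmor (Cocont P E) (cocont_comp (cocont_id E) H) H)
       : bnat _ _) X Y \oc rho_nat cE cE (cocont_id E) H X Y =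
    idm (rho cE H X Y);
  rho_nat_comp : forall E E' E'' (cE : cocomplete E) (cE' : cocomplete E')
      (cE'' : cocomplete E'') (G' : cocont_functor E' E'')
      (G : cocont_functor E E') (H : cocont_functor P E) X Y,
    (cfmap (rho cE'') (lassoc G' G H
       : @cmor (Cocont P E'') (cocont_comp (cocont_comp G' G) H)
                              (cocont_comp G' (cocont_comp G H)))
       : bnat _ _) X Y \oc rho_nat cE cE'' (cocont_comp G' G) H X Y =
    rho_nat cE' cE'' G' (cocont_comp G H) X Y \oc
      fmap G' (rho_nat cE cE' G H X Y) }.

Definition is_LP_tensor (A B P : lcat) : Prop :=
  locally_presentable P /\ inhabited (represents A B P).

End LinearCategories.

(* Main.v *)
From HB Require Import structures.
From mathcomp Require Import all_boot all_algebra.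
From mathcomp Require Import boolp.
From Stdlib Require List.
Require Import Defs.

Set Implicit Arguments.
Unset Strict Implicit.
Unset Printing Implicit Defensive.

(** Why the theorem holds.  Let [U : C x D -> P] be the bifunctor that
    corresponds to the identity of [P].  Naturality of the representation says
    that every bicocontinuous functor on [C x D] is, up to isomorphism, [U]
    followed by a cocontinuous functor on [P] ([universal_factor]), and that a
    cocontinuous endofunctor of [P] that fixes [U] is isomorphic to the identity
    ([universal_id]).  Two cocontinuous functors are then compared, in opposite
    directions, between [P] and the category [Sh] of sheaves on the tensor
    product of the sites.

    From [P] to [Sh]: the sheafification [boxt X Y] of the presheaf
    [C (u -, X) (x) D (v -, Y)] is bicocontinuous in [X] and [Y], so it is [U]
    followed by some [H].  From [Sh] to [P]: [G F] is the colimit of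
    [U (u -, v -)] weighted by [F]; it is left adjoint to the nerve
    [p |-> P (U (u -, v -), p)].  The existence of [H] requires [Sh] to be
    cocomplete ([Sh_cocomplete]), and [G] is cocontinuous because these nerves
    are sheaves ([restrict_nerve_is_sheaf]).

    Two density statements make [G] and [H] inverse to each other up to
    isomorphism.  An object [X] of [C] is the colimit of [u] weighted by
    [C (u -, X)] ([nerve_wcolim]), and cocontinuous functors preserve weighted
    colimits ([wcolim_preserved]); used in both variables this gives [G (boxt X Y) = U X Y]
    ([realization_boxt]), whence [G H] is the identity.  A sheaf [F] is the
    colimit of the [boxt (u A) (v B)] weighted by [F] ([boxt_dense]), whence
    [H G] is the identity ([realization_section]).

    What is specific to Grothendieck categories is in the study of one LC
    morphism [u].  Locally, a map from [u A] lifts along epimorphisms, and a map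
    from [u A] to a coproduct is a finite sum of maps to the summands.  The
    latter is where exactness of filtered colimits is used
    ([finite_sums_jointly_epi]).  It follows that, for a sheaf [F], the maps from
    [C (u -, X)] to [F] turn colimits in [X] into limits ([nerve_colimit]), and
    that each [C (u -, X)] is a sheaf ([nerve_is_sheaf]).

    What is specific to the tensor product is that the sheaves for the tensor
    topology are the presheaves that are sheaves in each variable
    ([tensor_is_sheaf], [slice_l_is_sheaf], [slice_r_is_sheaf]).  One direction
    has to deal with torsion: [R (x) b (-, B)] is in general not a submodule of
    [a (-, A) (x) b (-, B)] ([separated_bilinear]). *)

Import GRing.Theory.
Local Open Scope ring_scope.
Local Open Scope quotient_scope.
Local Notation "g \oc f" := (comp g f) (at level 40, left associativity).

(** * Additive calculus in k-linear categories *)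

Section LinearCalculus.
Context (k : comPzRingType) (C : lcat k).

Lemma comp0r (X Y Z : C) (g : hom Y Z) : g \oc (0 : hom X Y) = 0.
Proof. exact: (linear0 (mklinear (comp_linr g))). Qed.
Lemma comp0l (X Y Z : C) (f : hom X Y) : (0 : hom Y Z) \oc f = 0.
Proof. exact: (linear0 (mklinear (comp_linl f))). Qed.
Lemma compDr (X Y Z : C) (g : hom Y Z) (f f' : hom X Y) :
  g \oc (f + f') = g \oc f + g \oc f'.
Proof. exact: (linearD (mklinear (comp_linr g))). Qed.
Lemma compDl (X Y Z : C) (g g' : hom Y Z) (f : hom X Y) :
  (g + g') \oc f = g \oc f + g' \oc f.
Proof. exact: (linearD (mklinear (comp_linl f))). Qed.
Lemma compNr (X Y Z : C) (g : hom Y Z) (f : hom X Y) : g \oc (- f) = - (g \oc f).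
Proof. exact: (linearN (mklinear (comp_linr g))). Qed.
Lemma compNl (X Y Z : C) (g : hom Y Z) (f : hom X Y) : (- g) \oc f = - (g \oc f).
Proof. exact: (linearN (mklinear (comp_linl f))). Qed.
Lemma compBr (X Y Z : C) (g : hom Y Z) (f f' : hom X Y) :
  g \oc (f - f') = g \oc f - g \oc f'.
Proof. by rewrite compDr compNr. Qed.
Lemma compBl (X Y Z : C) (g g' : hom Y Z) (f : hom X Y) :
  (g - g') \oc f = g \oc f - g' \oc f.
Proof. by rewrite compDl compNl. Qed.
Lemma compZr (X Y Z : C) (g : hom Y Z) c (f : hom X Y) : g \oc (c *: f) = c *: (g \oc f).
Proof. exact: (linearZ_LR (mklinear (comp_linr g))). Qed.
Lemma comp_sumr (X Y Z : C) (g : hom Y Z) I (r : seq I) (F : I -> hom X Y) :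
  g \oc (\sum_(i <- r) F i) = \sum_(i <- r) g \oc F i.
Proof. exact: (linear_sum (mklinear (comp_linr g))). Qed.
Lemma comp_suml (X Y Z : C) I (r : seq I) (G : I -> hom Y Z) (f : hom X Y) :
  (\sum_(i <- r) G i) \oc f = \sum_(i <- r) G i \oc f.
Proof. exact: (linear_sum (mklinear (comp_linl f))). Qed.

Lemma epi0P (X Y : C) (q : hom X Y) :
  (forall Z (g : hom Y Z), g \oc q = 0 -> g = 0) -> epi q.
Proof.
move=> H Z g h gh; apply/eqP; rewrite -subr_eq0; apply/eqP/H.
by rewrite compBl gh subrr.
Qed.
Lemma mono0P (X Y : C) (q : hom X Y) :
  (forall Z (g : hom Z X), q \oc g = 0 -> g = 0) -> mono q.
Proof.
move=> H Z g h gh; apply/eqP; rewrite -subr_eq0; apply/eqP/H.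
by rewrite compBr gh subrr.
Qed.
End LinearCalculus.

Section FunctorLinear.
Context (k : comPzRingType) (C D : lcat k) (F : lfunctor C D).
Lemma fmap0 (X Y : C) : fmap F (0 : hom X Y) = 0.
Proof. exact: (linear0 (mklinear (@fmap_lin _ _ _ F X Y))). Qed.
Lemma fmapB (X Y : C) (f g : hom X Y) : fmap F (f - g) = fmap F f - fmap F g.
Proof. exact: (linearB (mklinear (@fmap_lin _ _ _ F X Y))). Qed.
Lemma fmap_sum (X Y : C) I (r : seq I) (G : I -> hom X Y) :
  fmap F (\sum_(i <- r) G i) = \sum_(i <- r) fmap F (G i).
Proof. exact: (linear_sum (mklinear (@fmap_lin _ _ _ F X Y))). Qed.
End FunctorLinear.

(** * Coproducts, quotients by families of relations, weighted colimits *)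

Section Coproducts.
Context (k : comPzRingType).

Definition is_coproduct (C : lcat k) (I : small) (X : I -> C) (P : C)
    (i_ : forall i, hom (X i) P) : Prop :=
  forall Z (f : forall i, hom (X i) Z), exists! h : hom P Z, forall i, h \oc i_ i = f i.

Lemma coproduct_ext (C : lcat k) (I : small) (X : I -> C) P (i_ : forall i, hom (X i) P) :
  is_coproduct i_ -> forall Z (g h : hom P Z),
  (forall i, g \oc i_ i = h \oc i_ i) -> g = h.
Proof.
move=> cp Z g h gh; have [u [_ uq]] := cp Z (fun i => h \oc i_ i).
by rewrite -(uq g) // (uq h).
Qed.

Definition discrete (I : small) : icat :=
  @Icat I (fun i j => i = j) (fun i => erefl) (fun i j l g f => etrans f g)
    (fun _ _ _ _ _ _ _ => Prop_irrelevance _ _)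
    (fun _ _ _ => Prop_irrelevance _ _) (fun _ _ _ => Prop_irrelevance _ _).

Section DiscreteDiagram.
Context (C : lcat k) (I : small) (X : I -> C).
Definition disc_map (i j : I) (e : i = j) : hom (X i) (X j) :=
  match e in _ = j return hom (X i) (X j) with erefl => idm (X i) end.
Fact disc_mapM (i j l : I) (g : j = l) (f : i = j) :
  disc_map (etrans f g) = disc_map g \oc disc_map f.
Proof. by case: _ / g; case: _ / f; rewrite /= comp1l. Qed.
Definition disc_diagram : diagram (discrete I) C :=
  @Diagram k (discrete I) C X disc_map (fun i => erefl) disc_mapM.
Fact disc_cocone_nat P (i_ : forall i, hom (X i) P) i j (e : i = j) :
  i_ j \oc disc_map e = i_ i.
Proof. by case: _ / e; rewrite comp1r. Qed.
Definition disc_cocone P (i_ : forall i, hom (X i) P) : cocone disc_diagram :=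
  @Cocone k (discrete I) C disc_diagram P i_ (disc_cocone_nat i_).
Lemma coproductP P (i_ : forall i, hom (X i) P) :
  is_coproduct i_ <-> is_colimit (disc_cocone i_).
Proof.
split=> H; first by move=> [Z f fP]; apply: H.
by move=> Z f; apply: (H (disc_cocone f)).
Qed.
End DiscreteDiagram.

Lemma coproduct_exists (C : lcat k) : cocomplete C ->
  forall (I : small) (X : I -> C), exists P (i_ : forall i, hom (X i) P), is_coproduct i_.
Proof.
move=> cC I X; have [[P f fP] H] := cC _ (disc_diagram X).
exists P, f; apply/coproductP; move=> L'; exact: H L'.
Qed.

Lemma coproduct_preserved (C E : lcat k) (S : lfunctor C E) : cocontinuous S ->
  forall (I : small) (X : I -> C) P (i_ : forall i, hom (X i) P),
  is_coproduct i_ -> is_coproduct (fun i => fmap S (i_ i)).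
Proof.
move=> cS I X P i_ /coproductP /cS H Z f.
have nat i j (e : i = j) : f j \oc fmap S (disc_map X e) = f i.
  by case: _ / e => /=; rewrite fmap1 comp1r.
exact: (H (@Cocone k (discrete I) E (map_diagram S (disc_diagram X)) Z f nat)).
Qed.

(** The quotient of [Y] by a family of maps into it is the conical colimit over
    this star: one arrow to the centre for each relation, and one to be sent
    to zero. *)
Definition star_mor (L : small) (x y : option L) : small :=
  match x, y with
  | None, None => unit | Some l, Some l' => l = l'
  | Some _, None => bool | None, Some _ => Empty_set end.
Definition star_id (L : small) (x : option L) : star_mor x x :=
  if x is Some l return star_mor x x then erefl l else tt.
Definition star_comp (L : small) (x y z : option L) :
    star_mor y z -> star_mor x y -> star_mor x z :=
  match x, y, z return star_mor y z -> star_mor x y -> star_mor x z with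
  | Some _, Some _, Some _ => fun g f => etrans f g
  | Some _, Some _, None => fun g _ => g
  | Some _, None, None => fun _ f => f
  | None, None, None => fun _ _ => tt
  | None, None, Some _ => fun g => match g with end
  | Some _, None, Some _ => fun g => match g with end
  | None, Some _, _ => fun _ f => match f with end
  end.
Definition star (L : small) : icat.
Proof.
refine (@Icat (option L) (@star_mor L) (@star_id L) (@star_comp L) _ _ _).
- by move=> [i|] [j|] [l|] [m|] //= *; apply: Prop_irrelevance.
- by move=> [i|] [j|] f //=; case: f.
- by move=> [i|] [j|] f //=; case: f.
Defined.

Definition is_quotient (C : lcat k) (L : small) (Z : L -> C) (Y X : C)
    (r : forall l, hom (Z l) Y) (p : hom Y X) : Prop :=
  (forall l, p \oc r l = 0) /\
  forall W (g : hom Y W), (forall l, g \oc r l = 0) -> exists! h, h \oc p = g.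

Section StarDiagram.
Context (C : lcat k) (L : small) (Z : L -> C) (Y : C) (r : forall l, hom (Z l) Y).
Definition star_ob (x : option L) : C := if x is Some l then Z l else Y.
Definition star_map (x y : option L) : star_mor x y -> hom (star_ob x) (star_ob y) :=
  match x, y return star_mor x y -> hom (star_ob x) (star_ob y) with
  | None, None => fun _ => idm Y
  | Some l, Some l' => fun e => disc_map Z e
  | Some l, None => fun b => if b then r l else 0
  | None, Some _ => fun e => match e with end end.
Fact star_map1 (x : iob (star L)) : star_map (iid x) = idm (star_ob x).
Proof. by case: x. Qed.
Fact star_mapM (i j l : iob (star L)) (g : imor j l) (f : imor i j) :
  star_map (icomp g f) = star_map g \oc star_map f.
Proof.
case: i j l f g => [i|] [j|] [l|] //= f g; rewrite ?comp1l ?comp1r //.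
- by case: _ / g; case: _ / f; rewrite comp1l.
- by case: _ / f => /=; rewrite comp1r.
Qed.
Definition star_diagram : diagram (star L) C :=
  @Diagram k (star L) C star_ob star_map star_map1 star_mapM.
End StarDiagram.

Lemma quotient_exists (C : lcat k) : cocomplete C ->
  forall (L : small) (Z : L -> C) (Y : C) (r : forall l, hom (Z l) Y),
  exists X (p : hom Y X), is_quotient r p.
Proof.
move=> cC L Z Y r; have [M HM] := cC _ (star_diagram r).
have rel l : leg M None \oc r l = 0.
  have e1 := leg_nat M (true : @imor (star L) (Some l) None).
  have /= e0 := leg_nat M (false : @imor (star L) (Some l) None).
  by rewrite -[LHS]/(leg M None \oc star_map r (true : @star_mor L (Some l) None))
       [LHS]e1 -e0 comp0r.
exists (apex M), (leg M None); split=> // W g gr.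
pose f (x : option L) : hom (star_ob Z Y x) W :=
  if x is Some l return hom (star_ob Z Y x) W then 0 else g.
have nat i j (e : @imor (star L) i j) : f j \oc star_map r e = f i.
  case: i j e => [i|] [j|] //= e; last by rewrite comp1r.
  + by rewrite comp0l.
  + by case: e; rewrite ?gr ?comp0r.
have [h [hP hq]] := HM (@Cocone k (star L) C (star_diagram r) W f nat).
exists h; split; first exact: (hP None).
move=> h' h'p; apply: hq => -[l|] //=.
by rewrite -(leg_nat M (false : @imor (star L) (Some l) None)) /= !comp0r.
Qed.

Lemma quotient_preserved (C E : lcat k) (S : lfunctor C E) : cocontinuous S ->
  forall (L : small) (Z : L -> C) (Y X : C) (r : forall l, hom (Z l) Y) (p : hom Y X),
  is_quotient r p -> is_quotient (fun l => fmap S (r l)) (fmap S p).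
Proof.
move=> cS L Z Y X r p [pr pu]; split=> [l | W g gr].
  by rewrite -fmapM pr fmap0.
pose f0 (x : option L) : hom (star_ob Z Y x) X :=
  if x is Some l return hom (star_ob Z Y x) X then 0 else p.
have nat0 i j (e : @imor (star L) i j) : f0 j \oc star_map r e = f0 i.
  case: i j e => [i|] [j|] //= e; last by rewrite comp1r.
  + by rewrite comp0l.
  + by case: e; rewrite ?pr ?comp0r.
pose M := @Cocone k (star L) C (star_diagram r) X f0 nat0.
have HM : is_colimit M.
  move=> [W' f fn] /=.
  have [l|h [hp hq]] := pu W' (f None).
    rewrite -[LHS]/(f None \oc star_map r (true : @star_mor L (Some l) None)).
    rewrite (fn (Some l) None true).
    by have /= <- := fn (Some l) None false; rewrite comp0r.
  exists h; split; last by move=> h' /(_ None); apply: hq.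
  move=> [l|] //=; rewrite comp0r.
  by have /= <- := fn (Some l) None false; rewrite comp0r.
pose f (x : option L) : hom (S (star_ob Z Y x)) W :=
  if x is Some l return hom (S (star_ob Z Y x)) W then 0 else g.
have nat i j (e : @imor (star L) i j) : f j \oc fmap S (star_map r e) = f i.
  case: i j e => [i|] [j|] //= e; last by rewrite fmap1 comp1r.
  + by rewrite comp0l.
  + by case: e; rewrite ?gr ?fmap0 ?comp0r.
have [h [hP hq]] := cS _ _ _ HM
  (@Cocone k (star L) E (map_diagram S (star_diagram r)) W f nat).
exists h; split; first exact: (hP None).
by move=> h' h'p; apply: hq => -[l|] //=; rewrite fmap0 comp0r.
Qed.
End Coproducts.

Section Weighted.
Context (k : comPzRingType).

Section Nerve.
Context (s : slcat k) (C : lcat k) (V : lfunctor (lcat_of_slcat s) C) (X : C).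
Definition nerve_map (A A' : opcat s) (f : hom A A') :
  {linear hom (V A) X -> hom (V A') X} := mklinear (comp_linl (fmap V (f : @hom _ s A' A))).
Fact nerve_lin A A' : linear (@nerve_map A A').
Proof. by move=> c f g; apply: linear_ext => h /=; rewrite fmap_lin comp_linr. Qed.
Fact nerve1 A : nerve_map (idm A) = lin_id (hom (V A) X).
Proof. by apply: linear_ext => h /=; rewrite fmap1 comp1r. Qed.
Fact nerveM (A A' A'' : opcat s) (g : hom A' A'') (f : hom A A') :
  nerve_map (g \oc f) = lin_comp (nerve_map g) (nerve_map f).
Proof. by apply: linear_ext => h /=; rewrite fmapM compA. Qed.
Definition nerve : presheaf s :=
  @Lfunctor _ (opcat s) (Modk k) (fun A => hom (V A) X) nerve_map nerve_lin nerve1 nerveM.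
Lemma nerve_resE (A A' : sobj s) (f : hom (A' : s) A) (x : pval nerve A) :
  pres nerve f x = x \oc fmap V f.
Proof. by []. Qed.
End Nerve.

Section NerveMap.
Context (s : slcat k) (C : lcat k) (V : lfunctor (lcat_of_slcat s) C) (X Y : C) (h : hom X Y).
Fact nerve_post_nat (A A' : s) (f : hom A' A) (x : pval (nerve V X) A) :
  mklinear (comp_linr h) (pres (nerve V X) f x) =
  pres (nerve V Y) f (mklinear (comp_linr h) x).
Proof. by rewrite /= compA. Qed.
Definition nerve_post : pshom (nerve V X) (nerve V Y) :=
  @Pshom _ _ (nerve V X) (nerve V Y) (fun A => mklinear (comp_linr h)) nerve_post_nat.
End NerveMap.

Section NerveFunctor.
Context (s : slcat k) (C E : lcat k) (V : lfunctor (lcat_of_slcat s) C)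
  (S : lfunctor C E) (X : C).
Fact nerve_fun_nat (A A' : s) (f : hom A' A) (x : pval (nerve V X) A) :
  mklinear (@fmap_lin _ _ _ S (V A') X) (pres (nerve V X) f x) =
  pres (nerve (lfunctor_comp S V) (S X)) f (mklinear (@fmap_lin _ _ _ S (V A) X) x).
Proof. by rewrite /= fmapM. Qed.
Definition nerve_fun : pshom (nerve V X) (nerve (lfunctor_comp S V) (S X)) :=
  @Pshom _ _ (nerve V X) (nerve (lfunctor_comp S V) (S X))
   (fun A => mklinear (@fmap_lin _ _ _ S (V A) X)) nerve_fun_nat.
End NerveFunctor.

(** [X] is the colimit of [V] weighted by [M].  Conical colimits alone do not see
    the addition of Hom-modules; recovering an object of [C], or a sheaf, from
    objects of a site requires this linear form. *)
Definition is_wcolim (s : slcat k) (C : lcat k) (V : lfunctor (lcat_of_slcat s) C)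
    (M : presheaf s) (X : C) (c : pshom M (nerve V X)) : Prop :=
  forall Z (d : pshom M (nerve V Z)),
  exists! h : hom X Z, forall (A : sobj s) (m : pval M A), h \oc papp c A m = papp d A m.

Lemma wcolim_ext (s : slcat k) (C : lcat k) (V : lfunctor (lcat_of_slcat s) C)
    (M : presheaf s) (X : C) (c : pshom M (nerve V X)) : is_wcolim c ->
  forall Z (g h : hom X Z),
  (forall (A : sobj s) (m : pval M A), g \oc papp c A m = h \oc papp c A m) -> g = h.
Proof.
move=> wc Z g h gh; have [u [_ uq]] := wc Z (ps_comp (nerve_post V h) c).
by rewrite -(uq g gh) -(uq h).
Qed.

Section WcolimPresentation.
Context (s : slcat k) (M : presheaf s).
(** Generators of a weighted colimit, and the relations that make them depend
    linearly and naturally on the element of [M]. *)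
Definition wgen : small := {A : sobj s & pval M A}.
Definition wrel : small :=
  ({A : sobj s & k * pval M A * pval M A} +
   {A : sobj s & {A' : sobj s & (@hom _ s A' A * pval M A)%type}})%type.
Definition wrel_ob (l : wrel) : sobj s :=
  match l with inl (existT A _) => A | inr (existT A (existT A' _)) => A' end.

Section Rel.
Context (C : lcat k) (V : lfunctor (lcat_of_slcat s) C) (P : C)
  (i_ : forall g : wgen, hom (V (projT1 g)) P).
Definition wgi (A : sobj s) (m : pval M A) : hom (V A) P := i_ (existT _ A m).
Definition wrel_map (l : wrel) : hom (V (wrel_ob l)) P :=
  match l return hom (V (wrel_ob l)) P with
  | inl (existT A p) => wgi (p.1.1 *: p.1.2 + p.2) - (p.1.1 *: wgi p.1.2 + wgi p.2)
  | inr (existT A (existT A' p)) => wgi (pres M p.1 p.2) - wgi p.2 \oc fmap V p.1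
  end.
End Rel.

Lemma wrel_killed (C E : lcat k) (V : lfunctor (lcat_of_slcat s) C) (S : lfunctor C E) (P : C)
    (i_ : forall g : wgen, hom (V (projT1 g)) P) Z (h : hom (S P) Z) :
  (forall l, h \oc fmap S (wrel_map i_ l) = 0) <->
  exists d : pshom M (nerve (lfunctor_comp S V) Z),
    forall A m, h \oc fmap S (wgi i_ m) = papp d A m.
Proof.
split=> [H | [d dP]].
  have lin A : linear (fun m : pval M A => h \oc fmap S (wgi i_ m)).
    move=> c m m'; have /= /eqP := H (inl (existT _ A (c, m, m'))).
    by rewrite fmapB compBr subr_eq0 fmap_lin comp_linr => /eqP.
  have nat (A A' : s) (f : hom A' A) (m : pval M A) :
      mklinear (lin A') (pres M f m) =
      pres (nerve (lfunctor_comp S V) Z) f (mklinear (lin A) m).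
    have /= /eqP := H (inr (existT _ A (existT _ A' (f, m)))).
    by rewrite fmapB compBr subr_eq0 fmapM compA => /eqP.
  by exists (@Pshom _ _ M (nerve (lfunctor_comp S V) Z) (fun A => mklinear (lin A)) nat).
move=> [[A [[c m] m']]|[A [A' [f m]]]] /=; apply/eqP; rewrite fmapB compBr subr_eq0; apply/eqP.
- by rewrite fmap_lin comp_linr !dP linearP.
- by rewrite fmapM compA !dP pnat.
Qed.
End WcolimPresentation.

(** The presentation involves coproducts and quotients only, and every
    cocontinuous [S], the identity included, preserves these. *)
Lemma wcolim_presented (s : slcat k) (C : lcat k) (V : lfunctor (lcat_of_slcat s) C)
    (M : presheaf s) : cocomplete C ->
  exists (X : C) (c : pshom M (nerve V X)),
  forall (E : lcat k) (S : lfunctor C E), cocontinuous S ->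
    is_wcolim (ps_comp (nerve_fun V S X) c).
Proof.
move=> cC.
have [P [i_ iP]] := coproduct_exists cC (fun g : wgen M => V (projT1 g)).
have [X [p pP]] := quotient_exists cC (wrel_map i_).
have [c0 c0P] := (@wrel_killed s M C C V (lfunctor_id C) P i_ X p).1 pP.1.
have nat (A A' : s) (f : hom A' A) (m : pval M A) :
    papp c0 A' (pres M f m) = pres (nerve V X) f (papp c0 A m) by rewrite pnat.
exists X, (@Pshom _ _ M (nerve V X) (fun A => papp c0 A) nat).
move=> E S cS Z d.
have iSP := coproduct_preserved cS iP.
have pSP := quotient_preserved cS pP.
have [h [hP hq]] := iSP _ (fun g : wgen M => papp d (projT1 g) (projT2 g)).
have [g|h' [h'p h'q]] := pSP.2 _ h.
  move: g; apply/wrel_killed; exists d => A m; exact: (hP (existT _ A m)).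
exists h'; split=> [A m /= | h'' h''P].
  by rewrite -c0P fmapM compA h'p; apply: (hP (existT _ A m)).
apply: h'q; apply: (coproduct_ext iSP) => -[A m] /=.
by rewrite [RHS](hP (existT _ A m)) /= -compA -fmapM -h''P /= -c0P.
Qed.

Lemma wcolim_exists (s : slcat k) (C : lcat k) (V : lfunctor (lcat_of_slcat s) C)
    (M : presheaf s) : cocomplete C ->
  exists (X : C) (c : pshom M (nerve V X)), is_wcolim c.
Proof.
move=> cC; have [X [c cP]] := wcolim_presented V M cC; exists X, c => Z d.
have nat (A A' : s) (f : hom A' A) (m : pval M A) :
    papp d A' (pres M f m) = pres (nerve (lfunctor_comp (lfunctor_id C) V) Z) f (papp d A m).
  by rewrite pnat.
exact: (cP C (lfunctor_id C) (@cocontinuous_id _ C) Z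
  (@Pshom _ _ M (nerve (lfunctor_comp (lfunctor_id C) V) Z) (fun A => papp d A) nat)).
Qed.

(** Two colimits with the same weight are isomorphic, so it is enough that the
    one built from coproducts and quotients is preserved. *)
Lemma wcolim_preserved (s : slcat k) (C E : lcat k) (V : lfunctor (lcat_of_slcat s) C)
    (M : presheaf s) (X : C) (c : pshom M (nerve V X)) (S : lfunctor C E) :
  cocomplete C -> cocontinuous S -> is_wcolim c ->
  is_wcolim (ps_comp (nerve_fun V S X) c).
Proof.
move=> cC cS wc; have [X' [c' cP']] := wcolim_presented V M cC.
have wS := cP' E S cS.
have [f [fP _]] := wc X' c'.
have id'P : is_wcolim (ps_comp (nerve_fun V (lfunctor_id C) X') c').
  exact: cP' (@cocontinuous_id _ C).
have nat (A A' : s) (h : hom A' A) (m : pval M A) :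
    papp c A' (pres M h m) = pres (nerve (lfunctor_comp (lfunctor_id C) V) X) h (papp c A m).
  by rewrite pnat.
have [g [gP _]] := id'P X
  (@Pshom _ _ M (nerve (lfunctor_comp (lfunctor_id C) V) X) (fun A => papp c A) nat).
have gf : g \oc f = idm X.
  apply: (wcolim_ext wc) => A m; rewrite -compA fP comp1l; exact: gP.
move=> Z d; have [h [hP hq]] := wS Z d.
exists (h \oc fmap S f); split=> [A m /= | h' h'P].
  by rewrite -compA -fmapM fP; apply: hP.
have -> : h = h' \oc fmap S g.
  by apply: hq => A m; rewrite -h'P /= -compA -fmapM gP.
by rewrite -compA -fmapM gf fmap1 comp1r.
Qed.
End Weighted.

(** * Local properties and gluing on a linear site *)

Lemma submodule_ext (k : comPzRingType) (V : lmodType k) (S S' : submodule V) :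
  (forall x, S x <-> S' x) -> S = S'.
Proof.
case: S S' => [S S0 SP] [S' S0' SP'] /= H.
have {}H : S = S' by apply: funext => x; apply: propext.
by subst S'; congr Submodule; apply: Prop_irrelevance.
Qed.

Section Presheaves.
Context (k : comPzRingType) (a : slcat k).

Lemma sieve_ext (A : sobj a) (R S : sieve A) :
  (forall (A' : a) (f : hom A' (A : a)), sv R A' f <-> sv S A' f) -> R = S.
Proof.
case: R S => [R RM] [S SM] /= H.
have {}H : R = S by apply: functional_extensionality_dep => A'; apply: submodule_ext.
by subst S; congr Sieve; apply: Prop_irrelevance.
Qed.

Section Restriction.
Context (F : presheaf a).
Lemma presM (A A' A'' : a) (f : hom A' A) (g : hom A'' A') (x : pval F A) :
  pres F (f \oc g) x = pres F g (pres F f x).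
Proof.
exact: (congr1 (fun h : {linear pval F A -> pval F A''} => h x)
  (@fmapM k (opcat a) (Modk k) F A A' A'' g f)).
Qed.
Lemma pres1 (A : a) (x : pval F A) : pres F (idm A) x = x.
Proof.
exact: (congr1 (fun h : {linear pval F A -> pval F A} => h x)
  (@fmap1 k (opcat a) (Modk k) F A)).
Qed.
Lemma pres_lin (A A' : a) c (f g : hom A' A) (x : pval F A) :
  pres F (c *: f + g) x = c *: pres F f x + pres F g x.
Proof.
exact: (congr1 (fun h : {linear pval F A -> pval F A'} => h x)
  (@fmap_lin k (opcat a) (Modk k) F A A' c f g)).
Qed.
Lemma pres0 (A A' : a) (x : pval F A) : pres F (0 : hom A' A) x = 0.
Proof.
exact: (linear0 (mklinear (fun c f g => @pres_lin A A' c f g x))).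
Qed.
Lemma pres_suml (A A' : a) I (r : seq I) (f : I -> hom A' A) (x : pval F A) :
  pres F (\sum_(i <- r) f i) x = \sum_(i <- r) pres F (f i) x.
Proof.
exact: (linear_sum (mklinear (fun c f g => @pres_lin A A' c f g x))).
Qed.
End Restriction.

Section Cap.
Context (A : sobj a) (R S : sieve A).
Fact cap0 (A' : a) : sv R A' 0 /\ sv S A' 0. Proof. by split; apply: smem0. Qed.
Fact capP (A' : a) c (f g : hom A' (A : a)) : sv R A' f /\ sv S A' f ->
  sv R A' g /\ sv S A' g -> sv R A' (c *: f + g) /\ sv S A' (c *: f + g).
Proof. by move=> [? ?] [? ?]; split; apply: smemP. Qed.
Definition sieve_cap : sieve A :=
  @Sieve k a A (fun A' => @Submodule k (hom (A' : a) A)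
     (fun f => sv R A' f /\ sv S A' f) (cap0 A') (@capP A'))
   (fun _ _ _ _ H => conj (svM _ H.1) (svM _ H.2)).
End Cap.

Record subpresheaf (M : presheaf a) := Subpresheaf {
  sp :> forall A : sobj a, submodule (pval M A);
  spM : forall (A A' : a) (f : hom A' A) (x : pval M A), sp A x -> sp A' (pres M f x) }.

Section Transporter.
Context (M : presheaf a) (N : subpresheaf M) (A : sobj a) (x : pval M A).
Fact tr0 (A' : a) : N A' (pres M (0 : hom A' (A : a)) x).
Proof. by rewrite pres0; apply: smem0. Qed.
Fact trP (A' : a) c (f g : hom A' (A : a)) : N A' (pres M f x) ->
  N A' (pres M g x) -> N A' (pres M (c *: f + g) x).
Proof. by rewrite pres_lin; apply: smemP. Qed.
Fact trM (A' A'' : a) (f : hom A' (A : a)) (g : hom A'' A') :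
  N A' (pres M f x) -> N A'' (pres M (f \oc g) x).
Proof. by rewrite presM; apply: spM. Qed.
Definition transporter : sieve A :=
  @Sieve k a A (fun A' => @Submodule k (hom (A' : a) A) (fun f => N A' (pres M f x))
    (tr0 A') (@trP A')) trM.
End Transporter.

Section ZeroSub.
Context (M : presheaf a).
Fact zero_sub0 (A : sobj a) : (0 : pval M A) = 0. Proof. by []. Qed.
Fact zero_subP (A : sobj a) c (x y : pval M A) : x = 0 -> y = 0 -> c *: x + y = 0.
Proof. by move=> -> ->; rewrite scaler0 addr0. Qed.
Fact zero_subM (A A' : a) (f : hom A' A) (x : pval M A) : x = 0 -> pres M f x = 0.
Proof. by move=> ->; rewrite linear0. Qed.
Definition zero_sub : subpresheaf M :=
  @Subpresheaf M (fun A => @Submodule k (pval M A) (fun x => x = 0)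
    (zero_sub0 A) (@zero_subP A)) zero_subM.
End ZeroSub.

Section Image.
Context (M M' : presheaf a) (e : pshom M M').
Fact image0 (A : sobj a) : exists x, papp e A x = 0.
Proof. by exists 0; rewrite linear0. Qed.
Fact imageP (A : sobj a) c (y z : pval M' A) :
  (exists x, papp e A x = y) -> (exists x, papp e A x = z) ->
  exists x, papp e A x = c *: y + z.
Proof. by move=> [x <-] [x' <-]; exists (c *: x + x'); rewrite linearP. Qed.
Fact imageM (A A' : a) (f : hom A' A) (y : pval M' A) :
  (exists x, papp e A x = y) -> exists x, papp e A' x = pres M' f y.
Proof. by move=> [x <-]; exists (pres M f x); rewrite pnat. Qed.
Definition image_sub : subpresheaf M' :=
  @Subpresheaf M' (fun A => @Submodule k (pval M' A) (fun y => exists x, papp e A x = y)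
    (image0 A) (@imageP A)) imageM.
End Image.

Context (T : topology a).

Lemma tcov_up (A : sobj a) (R S : sieve A) : T A R ->
  (forall (A' : a) (f : hom A' (A : a)), sv R A' f -> sv S A' f) -> T A S.
Proof.
move=> TR RS; apply: (tcov_glue TR) => A' f Rf.
have -> : pullback_sieve f S = max_sieve A'; last exact: tcov_max.
by apply: sieve_ext => X g; split=> // _; apply: svM; apply: RS.
Qed.

Lemma tcov_cap (A : sobj a) (R S : sieve A) : T A R -> T A S -> T A (sieve_cap R S).
Proof.
move=> TR TS; apply: (tcov_glue TR) => A' f Rf.
apply: (tcov_up (tcov_pull TS f)) => X g Sg; split=> //; exact: svM.
Qed.

(** Transitivity of coverings, with the second covering allowed to be smaller than
    the pullback of [S]. *)
Lemma tcov_local (A : sobj a) (R S : sieve A) : T A R ->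
  (forall (A' : a) (f : hom A' (A : a)), sv R A' f -> exists2 R' : sieve A', T A' R' &
     forall (A'' : a) (g : hom A'' A'), sv R' A'' g -> sv S A'' (f \oc g)) -> T A S.
Proof.
move=> TR H; apply: (tcov_glue TR) => A' f /H[R' TR' R'S].
exact: tcov_up TR' _.
Qed.

Definition locally (M : presheaf a) (N : subpresheaf M) (A : sobj a) (x : pval M A) : Prop :=
  T A (transporter N x).

Lemma locally_of (M : presheaf a) (N : subpresheaf M) (A : sobj a) (x : pval M A) :
  N A x -> locally N x.
Proof.
by move=> Nx; apply: (tcov_up (tcov_max _ A)) => A' f _; apply: spM.
Qed.

Lemma locally_trans (M : presheaf a) (N N' : subpresheaf M) :
  (forall (A : sobj a) (x : pval M A), N A x -> locally N' x) ->
  forall (A : sobj a) (x : pval M A), locally N x -> locally N' x.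
Proof.
move=> NN' A x Nx; apply: (tcov_local Nx) => A' f /NN' N'f.
by exists (transporter N' (pres M f x)) => // A'' g /=; rewrite presM.
Qed.

Lemma locally_cover (M : presheaf a) (N : subpresheaf M) (A : sobj a) (x : pval M A)
    (R : sieve A) : T A R ->
  (forall (A' : a) (f : hom A' (A : a)), sv R A' f -> locally N (pres M f x)) ->
  locally N x.
Proof.
move=> TR H; apply: (tcov_local TR) => A' f /H Nf.
by exists (transporter N (pres M f x)) => // A'' g /=; rewrite presM.
Qed.

Lemma locally_res (M : presheaf a) (N : subpresheaf M) (A A' : a) (f : hom A' A)
   (x : pval M A) : locally N x -> locally N (pres M f x).
Proof.
move=> Nx; apply: (tcov_up (tcov_pull Nx f)) => A'' g /=; by rewrite presM.
Qed.

Lemma locally_lin (M : presheaf a) (N : subpresheaf M) (A : a) c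
   (x y : pval M A) : locally N x -> locally N y -> locally N (c *: x + y).
Proof.
move=> Nx Ny; apply: (tcov_up (tcov_cap Nx Ny)) => A'' g [] /= gx gy.
by rewrite linearP; apply: smemP.
Qed.

Definition torsion (M : presheaf a) (A : sobj a) (x : pval M A) : Prop :=
  locally (zero_sub M) x.

Definition separated (F : presheaf a) : Prop :=
  forall (A : sobj a) (x : pval F A), torsion x -> x = 0.

Lemma separated_eq (F : presheaf a) : separated F ->
  forall (A : sobj a) (R : sieve A) (x y : pval F A), T A R ->
  (forall (A' : a) (f : hom A' (A : a)), sv R A' f -> pres F f x = pres F f y) -> x = y.
Proof.
move=> sF A R x y TR H; apply/eqP; rewrite -subr_eq0; apply/eqP/sF.
by apply: (tcov_up TR) => A' f /H /= e; rewrite linearB /= e subrr.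
Qed.

Section Gluing.
Context (F : presheaf a) (shF : is_sheaf T F).

Lemma sheaf_separated : separated F.
Proof.
move=> A x Tx; have [y [_ yu]] := shF Tx (0 : pshom (sieve_presheaf _) F).
rewrite -(yu x); last by move=> A' [f /= ->].
by rewrite (yu 0) // => A' f /=; rewrite linear0.
Qed.

Lemma sheaf_sep (A : sobj a) (R : sieve A) (x y : pval F A) : T A R ->
  (forall (A' : a) (f : hom A' (A : a)), sv R A' f -> pres F f x = pres F f y) -> x = y.
Proof. exact: (separated_eq sheaf_separated). Qed.

(** Matching families are given as relations, so that values need not be chosen
    beforehand.  A linear relation is single-valued as soon as it is so at 0. *)
Lemma sheaf_glue (A : sobj a) (R : sieve A)
    (s : forall A' : a, hom A' (A : a) -> pval F A' -> Prop) : T A R ->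
  (forall (A' : a) (f : hom A' (A : a)), sv R A' f -> exists z, s A' f z) ->
  (forall (A' : a) z, s A' 0 z -> z = 0) ->
  (forall (A' : a) c (f f' : hom A' (A : a)) z z',
     s A' f z -> s A' f' z' -> s A' (c *: f + f') (c *: z + z')) ->
  (forall (A' A'' : a) (f : hom A' (A : a)) (g : hom A'' A') z,
     s A' f z -> s A'' (f \oc g) (pres F g z)) ->
  exists x : pval F A, forall (A' : a) (f : hom A' (A : a)) z,
    sv R A' f -> s A' f z -> pres F f x = z.
Proof.
move=> TR tot s0 slin sres.
have fun_s (A' : a) (f : hom A' (A : a)) z z' : s A' f z -> s A' f z' -> z = z'.
  move=> sz sz'; have := slin A' (-1) _ _ _ _ sz' sz.
  rewrite !scaleN1r addNr => /s0 /eqP; by rewrite addrC subr_eq0 => /eqP.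
pose t (A' : a) (f : submod (sv R A')) : pval F A' :=
  projT1 (boolp.cid (tot _ _ (svalP f))).
have tP (A' : a) (f : submod (sv R A')) : s A' (sval f) (t A' f).
  exact: (projT2 (boolp.cid (tot _ _ (svalP f)))).
have tlin A' : linear (t A').
  by move=> c f g; apply: (fun_s _ _ _ _ (tP _ _)); apply: slin.
have tnat (A' A'' : a) (g : hom A'' A') (f : pval (sieve_presheaf R) A') :
    mklinear (tlin A'') (pres (sieve_presheaf R) g f) = pres F g (mklinear (tlin A') f).
  by apply: (fun_s _ _ _ _ (tP _ _)); apply: sres.
have [x [xP _]] := shF TR (@Pshom _ _ (sieve_presheaf R) F (fun A' => mklinear (tlin A')) tnat).
exists x => A' f z Rf sz; rewrite -(xP A' (Submod Rf)).
exact: (fun_s _ _ _ _ (tP A' (Submod Rf)) sz).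
Qed.

Lemma pshom_local_eq (M : presheaf a) (N : subpresheaf M) (f g : pshom M F) :
  (forall (A : sobj a) (x : pval M A), locally N x) ->
  (forall (A : sobj a) (x : pval M A), N A x -> papp f A x = papp g A x) -> f = g.
Proof.
move=> tot H; apply: pshom_ext => A x; apply: (sheaf_sep (tot A x)) => A' h /= Nh.
by rewrite -!pnat H.
Qed.

(** All the maps into sheaves below come from this: where the relation is defined
    it gives values, these glue because it is single-valued, and the closure
    conditions make the result linear and natural.  With a relation, the part
    of [M] on which a value is prescribed need not be described as a presheaf. *)
Lemma extend_relation (M : presheaf a)
    (rel : forall A : sobj a, pval M A -> pval F A -> Prop) :
  (forall A c x x' z z', rel A x z -> rel A x' z' -> rel A (c *: x + x') (c *: z + z')) ->
  (forall (A A' : a) (f : hom A' A) x z, rel A x z -> rel A' (pres M f x) (pres F f z)) ->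
  (forall A z, rel A 0 z -> z = 0) ->
  (forall (A : sobj a) (x : pval M A), exists2 R : sieve A, T A R &
     forall (A' : a) (f : hom A' (A : a)), sv R A' f -> exists z, rel A' (pres M f x) z) ->
  exists p : pshom M F, forall A x z, rel A x z -> papp p A x = z.
Proof.
move=> rlin rres r0 rtot.
have fun_r A x z z' : rel A x z -> rel A x z' -> z = z'.
  move=> rz rz'; have := rlin A (-1) _ _ _ _ rz' rz.
  rewrite !scaleN1r addNr => /r0 /eqP; by rewrite addrC subr_eq0 => /eqP.
have ex A (x : pval M A) : exists y : pval F A, forall (A' : a) (f : hom A' (A : a)) z,
    rel A' (pres M f x) z -> pres F f y = z.
  have [R TR Rx] := rtot A x.
  have [||||y yP] := @sheaf_glue A R (fun A' f z => rel A' (pres M f x) z) TR.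
  - exact: Rx.
  - by move=> A' z; rewrite pres0; apply: r0.
  - by move=> A' c f f' z z'; rewrite pres_lin; apply: rlin.
  - by move=> A' A'' f g z; rewrite presM; apply: rres.
  exists y => A' f z rz; apply: (sheaf_sep (tcov_pull TR f)) => A'' g Rfg.
  rewrite -presM; apply: yP => //; by rewrite presM; apply: rres.
pose p A (x : pval M A) : pval F A := projT1 (boolp.cid (ex A x)).
have pP A x (A' : a) (f : hom A' (A : a)) z : rel A' (pres M f x) z -> pres F f (p A x) = z.
  exact: (projT2 (boolp.cid (ex A x))).
have plin A : linear (p A).
  move=> c x x'; have [R TR Rx] := rtot A x; have [R' TR' Rx'] := rtot A x'.
  apply: (sheaf_sep (tcov_cap TR TR')) => A' f [/Rx[z rz] /Rx'[z' rz']].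
  rewrite linearP /= (pP _ _ _ _ _ rz) (pP _ _ _ _ _ rz'); apply: pP.
  by rewrite linearP; apply: rlin.
have pnat_ (A A' : a) (f : hom A' A) (x : pval M A) :
    mklinear (plin A') (pres M f x) = pres F f (mklinear (plin A) x).
  have [R TR Rx] := rtot A' (pres M f x).
  apply: (sheaf_sep TR) => A'' g /Rx[z rz] /=.
  by rewrite -presM (pP _ _ _ _ _ rz); apply/esym/pP; rewrite presM.
exists (@Pshom _ _ M F (fun A => mklinear (plin A)) pnat_) => A x z rz /=.
by rewrite -[p A x]pres1; apply: pP; rewrite pres1.
Qed.
End Gluing.
End Presheaves.

(** * Quotients and colimits of modules *)

Section QuotientModule.
Context (k : comPzRingType) (V : lmodType k) (S : submodule V).

Definition qmod_eq (x y : V) : bool := `[< S (x - y) >].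
Fact qmod_eq_refl : reflexive qmod_eq.
Proof. by move=> x; apply/asboolP; rewrite subrr; apply: smem0. Qed.
Fact qmod_eq_sym : symmetric qmod_eq.
Proof. by move=> x y; apply/asboolP/asboolP => /smemN; rewrite opprB. Qed.
Fact qmod_eq_trans : transitive qmod_eq.
Proof.
move=> y x z /asboolP xy /asboolP yz; apply/asboolP.
by have := smemD xy yz; rewrite addrA subrK.
Qed.
Canonical qmod_equiv := EquivRel qmod_eq qmod_eq_refl qmod_eq_sym qmod_eq_trans.
Definition qmod := {eq_quot qmod_equiv}.
HB.instance Definition _ := Choice.on qmod.

Lemma qmod_piP (x y : V) : \pi_qmod x = \pi_qmod y <-> S (x - y).
Proof.
split; first by move/eqP; rewrite -[_ == _]/(_ == _ :> {eq_quot _}) eqmodE => /asboolP.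
by move=> H; apply/eqP; rewrite -[_ == _]/(_ == _ :> {eq_quot _}) eqmodE; apply/asboolP.
Qed.
Lemma qmod_repr (x : V) : S (repr (\pi_qmod x) - x).
Proof. by apply/qmod_piP; rewrite reprK. Qed.

Definition qmod_add (x y : qmod) : qmod := \pi_qmod (repr x + repr y).
Definition qmod_opp (x : qmod) : qmod := \pi_qmod (- repr x).
Definition qmod_scale c (x : qmod) : qmod := \pi_qmod (c *: repr x).
Definition qmod_zero : qmod := \pi_qmod 0.

Lemma qmod_addE x y : qmod_add (\pi_qmod x) (\pi_qmod y) = \pi_qmod (x + y).
Proof.
by apply/qmod_piP; rewrite opprD addrACA; apply: smemD; apply: qmod_repr.
Qed.
Lemma qmod_oppE x : qmod_opp (\pi_qmod x) = \pi_qmod (- x).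
Proof. by apply/qmod_piP; rewrite -opprD; apply: smemN; apply: qmod_repr. Qed.
Lemma qmod_scaleE c x : qmod_scale c (\pi_qmod x) = \pi_qmod (c *: x).
Proof. by apply/qmod_piP; rewrite -scalerBr; apply: smemZ; apply: qmod_repr. Qed.

Lemma qmod_ind (P : qmod -> Prop) : (forall x, P (\pi_qmod x)) -> forall x, P x.
Proof. by move=> H x; rewrite -[x]reprK. Qed.

Fact qmod_addA : associative qmod_add.
Proof.
by elim/qmod_ind=> x; elim/qmod_ind=> y; elim/qmod_ind=> z; rewrite !qmod_addE addrA.
Qed.
Fact qmod_addC : commutative qmod_add.
Proof. by elim/qmod_ind=> x; elim/qmod_ind=> y; rewrite !qmod_addE addrC. Qed.
Fact qmod_add0 : left_id qmod_zero qmod_add.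
Proof. by elim/qmod_ind=> x; rewrite qmod_addE add0r. Qed.
Fact qmod_addN : left_inverse qmod_zero qmod_opp qmod_add.
Proof. by elim/qmod_ind=> x; rewrite qmod_oppE qmod_addE addNr. Qed.
HB.instance Definition _ :=
  GRing.isZmodule.Build qmod qmod_addA qmod_addC qmod_add0 qmod_addN.
Fact qmod_scaleA c d x : qmod_scale c (qmod_scale d x) = qmod_scale (c * d) x.
Proof. by elim/qmod_ind: x => x; rewrite !qmod_scaleE scalerA. Qed.
Fact qmod_scale1 : left_id 1 qmod_scale.
Proof. by elim/qmod_ind=> x; rewrite qmod_scaleE scale1r. Qed.
Fact qmod_scaleDr : right_distributive qmod_scale +%R.
Proof.
move=> c; elim/qmod_ind=> x; elim/qmod_ind=> y.
rewrite -[LHS]/(qmod_scale c (qmod_add _ _)) -[RHS]/(qmod_add _ _).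
by rewrite (qmod_addE x y) !qmod_scaleE qmod_addE scalerDr.
Qed.
Fact qmod_scaleDl x : {morph qmod_scale^~ x : c d / c + d}.
Proof.
move=> c d; rewrite -[RHS]/(qmod_add _ _); elim/qmod_ind: x => x.
by rewrite !qmod_scaleE qmod_addE scalerDl.
Qed.
HB.instance Definition _ := GRing.Zmodule_isLmodule.Build k qmod
  qmod_scaleA qmod_scale1 qmod_scaleDr qmod_scaleDl.

Fact qmod_pi_linear : linear (\pi_qmod : V -> qmod).
Proof.
move=> c x y; rewrite -[RHS]/(qmod_add (qmod_scale _ _) _).
by rewrite qmod_scaleE qmod_addE.
Qed.
Definition qmod_pi : {linear V -> qmod} := mklinear qmod_pi_linear.
Lemma qmod_pi0P (x : V) : qmod_pi x = 0 <-> S x.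
Proof. by rewrite -[0]/(\pi_qmod 0) qmod_piP subr0. Qed.
Lemma qmod_surj (z : qmod) : exists x, qmod_pi x = z.
Proof. by exists (repr z); apply: reprK. Qed.

Section Lift.
Context (W : lmodType k) (f : {linear V -> W}) (fS : forall x, S x -> f x = 0).
Fact qmod_lift_pi x : f (repr (\pi_qmod x)) = f x.
Proof. by apply/eqP; rewrite -subr_eq0 -linearB fS //; apply: qmod_repr. Qed.
Fact qmod_lift_linear : linear (fun z : qmod => f (repr z)).
Proof.
move=> c; elim/qmod_ind=> x; elim/qmod_ind=> y.
by rewrite -qmod_pi_linear !qmod_lift_pi linearP.
Qed.
Definition qmod_lift : {linear qmod -> W} := mklinear qmod_lift_linear.
Lemma qmod_liftE x : qmod_lift (qmod_pi x) = f x.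
Proof. exact: qmod_lift_pi. Qed.
End Lift.
End QuotientModule.

(** The colimit of a diagram of modules with edges [m e].  Formal sums are
    identified when every cocone takes the same value on them; this gives the
    universal property without a description of the relations. *)
Section ModuleColimit.
Context (k : comPzRingType) (I : Type) (V : I -> lmodType k)
  (E : Type) (src tgt : E -> I) (m : forall e, {linear V (src e) -> V (tgt e)}).
Definition mc_term := {i : I & V i}.
HB.instance Definition _ := gen_eqMixin mc_term.
HB.instance Definition _ := gen_choiceMixin mc_term.
Local Notation fsum := (seq mc_term).

Definition mc_cocone (W : lmodType k) (f : forall i, {linear V i -> W}) : Prop :=
  forall e v, f (tgt e) (m e v) = f (src e) v.
Definition mc_eval (W : lmodType k) (f : forall i, {linear V i -> W}) (s : fsum) : W :=
  \sum_(p <- s) f (projT1 p) (projT2 p).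
Definition mc_eq (s t : fsum) : bool :=
  `[< forall (W : lmodType k) (f : forall i, {linear V i -> W}), mc_cocone f -> mc_eval f s = mc_eval f t >].
Fact mc_eq_refl : reflexive mc_eq. Proof. by move=> s; apply/asboolP. Qed.
Fact mc_eq_sym : symmetric mc_eq.
Proof. by move=> s t; apply/asboolP/asboolP => H W f cf; rewrite H. Qed.
Fact mc_eq_trans : transitive mc_eq.
Proof.
by move=> t s u /asboolP st /asboolP tu; apply/asboolP => W f cf; rewrite st // tu.
Qed.
Canonical mc_equiv := EquivRel mc_eq mc_eq_refl mc_eq_sym mc_eq_trans.
Definition mcolim := {eq_quot mc_equiv}.
HB.instance Definition _ := Choice.on mcolim.

Lemma mc_piP s t : \pi_mcolim s = \pi_mcolim t <->
  forall (W : lmodType k) (f : forall i, {linear V i -> W}), mc_cocone f -> mc_eval f s = mc_eval f t.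
Proof.
split; first by move/eqP; rewrite -[_ == _]/(_ == _ :> {eq_quot _}) eqmodE => /asboolP.
by move=> H; apply/eqP; rewrite -[_ == _]/(_ == _ :> {eq_quot _}) eqmodE; apply/asboolP.
Qed.
Lemma mc_repr s (W : lmodType k) (f : forall i, {linear V i -> W}) : mc_cocone f ->
  mc_eval f (repr (\pi_mcolim s)) = mc_eval f s.
Proof. by move=> cf; have /mc_piP -> := reprK (\pi_mcolim s). Qed.
Lemma mc_ext_cocone (x y : mcolim) : (forall (W : lmodType k) (f : forall i, {linear V i -> W}),
  mc_cocone f -> mc_eval f (repr x) = mc_eval f (repr y)) -> x = y.
Proof. by rewrite -{2}[x]reprK -{2}[y]reprK => H; apply/mc_piP. Qed.

Definition mc_add (x y : mcolim) : mcolim := \pi_mcolim (repr x ++ repr y).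
Definition mc_scale (c : k) (x : mcolim) : mcolim :=
  \pi_mcolim [seq existT V (projT1 p) (c *: projT2 p) : mc_term | p <- repr x].
Definition mc_zero : mcolim := \pi_mcolim [::].

Section Eval.
Context (W : lmodType k) (f : forall i, {linear V i -> W}) (cf : mc_cocone f).
Lemma mc_eval_add x y :
  mc_eval f (repr (mc_add x y)) = mc_eval f (repr x) + mc_eval f (repr y).
Proof. by rewrite mc_repr // /mc_eval big_cat. Qed.
Lemma mc_eval_scale c x : mc_eval f (repr (mc_scale c x)) = c *: mc_eval f (repr x).
Proof.
rewrite mc_repr // /mc_eval big_map scaler_sumr.
by apply: eq_bigr => p _ /=; rewrite linearZ_LR.
Qed.
Lemma mc_eval_zero : mc_eval f (repr mc_zero) = 0.
Proof. by rewrite mc_repr // /mc_eval big_nil. Qed.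
End Eval.

Fact mc_addA : associative mc_add.
Proof. by move=> x y z; apply: mc_ext_cocone => W f cf; rewrite !mc_eval_add // addrA. Qed.
Fact mc_addC : commutative mc_add.
Proof. by move=> x y; apply: mc_ext_cocone => W f cf; rewrite !mc_eval_add // addrC. Qed.
Fact mc_add0 : left_id mc_zero mc_add.
Proof.
by move=> x; apply: mc_ext_cocone => W f cf; rewrite mc_eval_add // mc_eval_zero // add0r.
Qed.
Fact mc_addN : left_inverse mc_zero (mc_scale (-1)) mc_add.
Proof.
move=> x; apply: mc_ext_cocone => W f cf.
by rewrite mc_eval_add // mc_eval_scale // mc_eval_zero // scaleN1r addNr.
Qed.
HB.instance Definition _ :=
  GRing.isZmodule.Build mcolim mc_addA mc_addC mc_add0 mc_addN.
Fact mc_scaleA c d x : mc_scale c (mc_scale d x) = mc_scale (c * d) x.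
Proof. by apply: mc_ext_cocone => W f cf; rewrite !mc_eval_scale // scalerA. Qed.
Fact mc_scale1 : left_id 1 mc_scale.
Proof. by move=> x; apply: mc_ext_cocone => W f cf; rewrite mc_eval_scale // scale1r. Qed.
Fact mc_scaleDr : right_distributive mc_scale +%R.
Proof.
move=> c x y; apply: mc_ext_cocone => W f cf.
by rewrite mc_eval_scale // !mc_eval_add // !mc_eval_scale // scalerDr.
Qed.
Fact mc_scaleDl x : {morph mc_scale^~ x : c d / c + d}.
Proof.
move=> c d; apply: mc_ext_cocone => W f cf.
by rewrite mc_eval_scale // mc_eval_add // !mc_eval_scale // scalerDl.
Qed.
HB.instance Definition _ := GRing.Zmodule_isLmodule.Build k mcolim
  mc_scaleA mc_scale1 mc_scaleDr mc_scaleDl.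

Definition mc_term_in i (v : V i) : mcolim := \pi_mcolim [:: existT V i v : mc_term].
Fact mc_in_linear i : linear (@mc_term_in i).
Proof.
move=> c v w; apply: mc_ext_cocone => W f cf.
rewrite mc_eval_add // mc_eval_scale // !mc_repr // /mc_eval !big_seq1 /=.
by rewrite linearP.
Qed.
Definition mc_in i : {linear V i -> mcolim} := mklinear (@mc_in_linear i).
Lemma mc_in_cocone : mc_cocone mc_in.
Proof.
move=> e v; apply: mc_ext_cocone => W f cf.
by rewrite !mc_repr // /mc_eval !big_seq1 /=.
Qed.

Section Lift.
Context (W : lmodType k) (f : forall i, {linear V i -> W}) (cf : mc_cocone f).
Fact mc_lift_linear : linear (fun x : mcolim => mc_eval f (repr x)).
Proof. by move=> c x y; rewrite mc_eval_add // mc_eval_scale. Qed.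
Definition mc_lift : {linear mcolim -> W} := mklinear mc_lift_linear.
Lemma mc_liftE i v : mc_lift (mc_in i v) = f i v.
Proof. by rewrite /= mc_repr // /mc_eval big_seq1. Qed.
End Lift.

Lemma mc_sum (x : mcolim) : x = \sum_(p <- repr x) mc_in (projT1 p) (projT2 p).
Proof.
rewrite -{1}[x]reprK; elim: (repr x) => [|p s IH]; first by rewrite big_nil.
rewrite big_cons -IH; apply: mc_ext_cocone => W f cf.
by rewrite mc_eval_add // !mc_repr // /mc_eval big_cons big_seq1.
Qed.
Lemma mc_ext (W : lmodType k) (f g : {linear mcolim -> W}) :
  (forall i v, f (mc_in i v) = g (mc_in i v)) -> f = g.
Proof.
move=> fg; apply: linear_ext => x; rewrite [x]mc_sum !linear_sum.
by apply: eq_bigr => p _; apply: fg.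
Qed.
End ModuleColimit.

(** * Sheafification *)

Section Sheafification.
Context (k : comPzRingType) (a : slcat k) (T : topology a).

Section Closure.
Context (M : presheaf a) (N : subpresheaf M).
Fact closure0 (A : sobj a) : locally T N (0 : pval M A).
Proof. by apply: locally_of; apply: smem0. Qed.
Definition closure : subpresheaf M :=
  @Subpresheaf k a M (fun A => @Submodule k (pval M A) (fun x => locally T N x)
    (closure0 A) (fun c x y => @locally_lin k a T M N A c x y)) (@locally_res k a T M N).
End Closure.

Context (F : presheaf a).
Let tors := closure (zero_sub F).

(** Sheafification in one step.  An element over [A] is represented by a function
    [s] that sends each [f : A' -> A] to an element of [F A'], with conditions
    only on the [f] in some covering [R].  Arbitrary values outside [R] make the
    operations pointwise; and as the conditions are equalities up to locally
    vanishing terms, [F] need not be made separated first. *)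
Definition germ (A : sobj a) : small := forall A' : sobj a, hom (A' : a) (A : a) -> pval F A'.
Lemma germ_ext A (s t : germ A) : (forall A' f, s A' f = t A' f) -> s = t.
Proof.
move=> st; apply: functional_extensionality_dep => A'; exact: funext.
Qed.
Section GermModule.
Context (A : sobj a).
HB.instance Definition _ := gen_eqMixin (germ A).
HB.instance Definition _ := gen_choiceMixin (germ A).
Let gadd (s t : germ A) : germ A := fun A' f => s A' f + t A' f.
Let gopp (s : germ A) : germ A := fun A' f => - s A' f.
Let gzero : germ A := fun A' f => 0.
Let gscale c (s : germ A) : germ A := fun A' f => c *: s A' f.
Fact gaddA : associative gadd.
Proof. by move=> r s t; apply: germ_ext => A' f; apply: addrA. Qed.
Fact gaddC : commutative gadd.
Proof. by move=> s t; apply: germ_ext => A' f; apply: addrC. Qed.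
Fact gadd0 : left_id gzero gadd.
Proof. by move=> s; apply: germ_ext => A' f; apply: add0r. Qed.
Fact gaddN : left_inverse gzero gopp gadd.
Proof. by move=> s; apply: germ_ext => A' f; apply: addNr. Qed.
HB.instance Definition _ := GRing.isZmodule.Build (germ A) gaddA gaddC gadd0 gaddN.
Fact gscaleA c d s : gscale c (gscale d s) = gscale (c * d) s.
Proof. by apply: germ_ext => A' f; apply: scalerA. Qed.
Fact gscale1 : left_id 1 gscale.
Proof. by move=> s; apply: germ_ext => A' f; apply: scale1r. Qed.
Fact gscaleDr : right_distributive gscale +%R.
Proof. by move=> c s t; apply: germ_ext => A' f; apply: scalerDr. Qed.
Fact gscaleDl s : {morph gscale^~ s : c d / c + d}.
Proof. by move=> c d; apply: germ_ext => A' f; apply: scalerDl. Qed.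
HB.instance Definition _ := GRing.Zmodule_isLmodule.Build k (germ A)
  gscaleA gscale1 gscaleDr gscaleDl.
Lemma germE c (s t : germ A) A' f : (c *: s + t) A' f = c *: s A' f + t A' f.
Proof. by []. Qed.
Lemma germB (s t : germ A) A' f : (s - t) A' f = s A' f - t A' f.
Proof. by []. Qed.
End GermModule.

Definition good_on (A : sobj a) (R : sieve A) (s : germ A) : Prop :=
  (forall (A' : a) c (f f' : hom A' (A : a)), sv R A' f -> sv R A' f' ->
     tors A' (s A' (c *: f + f') - (c *: s A' f + s A' f'))) /\
  (forall (A' A'' : a) (f : hom A' (A : a)) (g : hom A'' A'), sv R A' f ->
     tors A'' (s A'' (f \oc g) - pres F g (s A' f))).
Definition good (A : sobj a) (s : germ A) : Prop := exists2 R : sieve A, T A R & good_on R s.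
Definition null (A : sobj a) (s : germ A) : Prop := exists2 R : sieve A, T A R &
  forall (A' : a) (f : hom A' (A : a)), sv R A' f -> tors A' (s A' f).

Fact good0 (A : sobj a) : good (0 : germ A).
Proof.
exists (max_sieve A); first exact: tcov_max.
have z (A' : a) (f : hom A' (A : a)) : (0 : germ A) A' f = 0 by [].
by split=> *; rewrite !z ?linear0 ?scaler0 ?addr0 ?oppr0 ?addr0; apply: smem0.
Qed.
Fact goodP (A : sobj a) c (s t : germ A) : good s -> good t -> good (c *: s + t).
Proof.
move=> [R TR [Rl Rn]] [R' TR' [Rl' Rn']]; exists (sieve_cap R R'); first exact: tcov_cap.
split=> [A' d f f' [Rf Rf'] [Rg Rg'] | A' A'' f g [Rf Rf']]; rewrite !germE.
- have := smemP c (Rl _ d _ _ Rf Rg) (Rl' _ d _ _ Rf' Rg'); congr (tors A' _).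
  rewrite !scalerBr !scalerDr !scalerA [c * d]mulrC !opprD !addrA.
  by rewrite !(addrAC _ _ (t A' _)) !(addrAC _ _ (- (c *: _))) !(addrAC _ _ (- (_ * _ *: _))).
- have := smemP c (Rn _ _ _ g Rf) (Rn' _ _ _ g Rf'); congr (tors A'' _).
  by rewrite linearP scalerBr addrACA opprD.
Qed.
Definition good_sub (A : sobj a) : submodule (germ A) := Submodule (good0 A) (@goodP A).

Fact null0 (A : sobj a) : null (sval (0 : submod (good_sub A))).
Proof.
by exists (max_sieve A) => [|A' f _]; [apply: tcov_max | apply: smem0].
Qed.
Fact nullP (A : sobj a) c (s t : submod (good_sub A)) :
  null (sval s) -> null (sval t) -> null (sval (c *: s + t)).
Proof.
move=> [R TR RH] [R' TR' RH']; exists (sieve_cap R R'); first exact: tcov_cap.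
by move=> A' f [/RH sf /RH' tf]; apply: smemP.
Qed.
Definition null_sub (A : sobj a) : submodule (submod (good_sub A)) :=
  @Submodule k (submod (good_sub A)) (fun s => null (sval s)) (null0 A) (@nullP A).

Definition shf_val (A : sobj a) : lmodType k := qmod (null_sub A).

Section GermRestriction.
Context (A A' : a) (h : hom A' A).
Definition germ_res (s : germ A) : germ A' := fun A'' f => s A'' (h \oc f).
Lemma good_on_res (R : sieve A) (s : germ A) : good_on R s ->
  good_on (pullback_sieve h R) (germ_res s).
Proof.
move=> [Rl Rn]; split=> [A'' c f f' Rf Rf' | A'' X f g Rf].
  by rewrite /germ_res comp_linr; apply: Rl.
by rewrite /germ_res compA; apply: Rn.
Qed.
Fact good_res (s : germ A) : good s -> good (germ_res s).
Proof.
move=> [R TR Rs]; exists (pullback_sieve h R); first exact: tcov_pull.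
exact: good_on_res.
Qed.
Definition gres (s : submod (good_sub A)) : submod (good_sub A') :=
  Submod (good_res (svalP s) : good_sub A' _).
Fact gres_linear : linear gres.
Proof. by move=> c s t; apply: submod_ext. Qed.
Fact gres_null (s : submod (good_sub A)) : null_sub A s ->
  lin_comp (qmod_pi (null_sub A')) (mklinear gres_linear) s = 0.
Proof.
move=> [R TR Rs]; apply/qmod_pi0P; exists (pullback_sieve h R); first exact: tcov_pull.
by move=> A'' f Rf; apply: Rs.
Qed.
Definition shf_res : {linear shf_val A -> shf_val A'} := qmod_lift gres_null.
Lemma shf_resE s : shf_res (qmod_pi (null_sub A) s) = qmod_pi (null_sub A') (gres s).
Proof. exact: (qmod_liftE gres_null). Qed.
End GermRestriction.

Fact shf_lin (A A' : opcat a) : linear (fun f : hom A A' => @shf_res A A' f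
   : @hom _ (Modk k) (shf_val A) (shf_val A')).
Proof.
move=> c f g; apply: linear_ext => z; have [s <-] := qmod_surj z.
rewrite lin_linE !shf_resE -linearP; apply/eqP; rewrite -subr_eq0 -linearB; apply/eqP.
apply/qmod_pi0P; have [R TR [Rl _]] := svalP s.
exists (sieve_cap (pullback_sieve f R) (pullback_sieve g R)).
  by apply: tcov_cap; apply: tcov_pull.
move=> A'' h [fh gh]; rewrite /= /germ_res germB germE.
rewrite -[comp (_ + _) h]/(@comp _ a _ _ _ (c *: f + g) h) (@comp_linl _ a).
exact: Rl.
Qed.
Fact shf_1 (A : opcat a) : shf_res (idm A) = lin_id (shf_val A).
Proof.
apply: linear_ext => z; have [s <-] := qmod_surj z.
rewrite shf_resE /=; congr (\pi_ _ _).
by apply: submod_ext; apply: germ_ext => A' f; rewrite /= /germ_res (@comp1l _ a).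
Qed.
Fact shf_M (A A' A'' : opcat a) (g : hom A' A'') (f : hom A A') :
  @shf_res A A'' (g \oc f) = lin_comp (@shf_res A' A'' g) (@shf_res A A' f).
Proof.
apply: linear_ext => z; have [s <-] := qmod_surj z.
transitivity (@shf_res A' A'' g (@shf_res A A' f (qmod_pi (null_sub A) s))) => //.
rewrite !shf_resE; congr (qmod_pi (null_sub A'') _).
apply: submod_ext; apply: germ_ext => X h; rewrite /= /germ_res.
by rewrite -[comp g f]/(@comp _ a _ _ _ f g) (@compA _ a).
Qed.
Definition sheafify : presheaf a :=
  @Lfunctor k (opcat a) (Modk k) shf_val (@shf_res) shf_lin shf_1 shf_M.

Definition shf_class (A : sobj a) (s : submod (good_sub A)) : pval sheafify A :=
  qmod_pi (null_sub A) s.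
Lemma shf_class_surj (A : sobj a) (z : pval sheafify A) : exists s, shf_class s = z.
Proof. exact: qmod_surj. Qed.
Lemma shf_class_res (A A' : a) (h : hom A' A) s :
  pres sheafify h (shf_class s) = shf_class (gres h s).
Proof. exact: shf_resE. Qed.

Definition shf_const (A : sobj a) (x : pval F A) : germ A := fun A' f => pres F f x.
Fact shf_const_good (A : sobj a) (x : pval F A) : good_sub A (shf_const x).
Proof.
exists (max_sieve A); first exact: tcov_max.
split=> [A' c f g _ _ | A' A'' f g _]; rewrite /shf_const.
- by rewrite pres_lin subrr; apply: smem0.
- by rewrite presM subrr; apply: smem0.
Qed.
Definition shf_unit_fun (A : sobj a) (x : pval F A) : pval sheafify A :=
  shf_class (Submod (shf_const_good x)).
Fact shf_unit_linear (A : sobj a) : linear (@shf_unit_fun A).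
Proof.
move=> c x y; rewrite /shf_unit_fun /shf_class -[RHS]linearP.
congr (qmod_pi (null_sub A) _); apply: submod_ext; apply: germ_ext => A' f.
by rewrite /= germE /shf_const linearP.
Qed.
Fact shf_unit_nat (A A' : a) (f : hom A' A) (x : pval F A) :
  mklinear (@shf_unit_linear A') (pres F f x) =
  pres sheafify f (mklinear (@shf_unit_linear A) x).
Proof.
rewrite /= /shf_unit_fun [RHS]shf_class_res; congr (shf_class _).
by apply: submod_ext; apply: germ_ext => A'' g; rewrite /= /germ_res /shf_const presM.
Qed.
Definition shf_unit : pshom F sheafify :=
  @Pshom _ _ F sheafify (fun A => mklinear (@shf_unit_linear A)) shf_unit_nat.

Lemma shf_unit0 (A : sobj a) (x : pval F A) : papp shf_unit A x = 0 <-> torsion T x.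
Proof.
split=> [/qmod_pi0P [R TR Rx] | Tx].
  by apply: (locally_cover TR) => A' f /Rx.
apply/qmod_pi0P; exists (max_sieve A); first exact: tcov_max.
by move=> A' f _; apply: locally_res.
Qed.

(** The conditions on [s] say precisely that, along [f] in [R], its class is the
    image of the value of [s] at [f]. *)
Lemma shf_class_local (A : sobj a) (R : sieve A) (s : submod (good_sub A)) :
  good_on R (sval s) -> forall (A' : a) (f : hom A' (A : a)), sv R A' f ->
  pres sheafify f (shf_class s) = papp shf_unit A' (sval s A' f).
Proof.
move=> [Rl Rn] A' f Rf; rewrite [LHS]shf_class_res; apply/qmod_piP.
exists (max_sieve A'); first exact: tcov_max.
by move=> A'' g _; apply: Rn.
Qed.

Lemma shf_unit_locally_surj (A : sobj a) (z : pval sheafify A) :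
  locally T (image_sub shf_unit) z.
Proof.
have [s <-] := shf_class_surj z; have [R TR Rs] := svalP s.
apply: (tcov_up TR) => A' f Rf; exists (sval s A' f).
by rewrite (shf_class_local Rs).
Qed.

Lemma sheafify_separated : separated T sheafify.
Proof.
move=> A z Tz; have [s sz] := shf_class_surj z; rewrite -sz.
have [R TR Rs] := svalP s; apply/qmod_pi0P.
exists (sieve_cap R (transporter (zero_sub sheafify) z)); first exact: tcov_cap.
move=> A' f [Rf zf]; apply/shf_unit0; rewrite -(shf_class_local Rs) // sz.
exact: zf.
Qed.

(** A matching family is locally in the image of [F]; preimages, chosen where
    there are some, form the germ that glues it. *)
Lemma sheafify_is_sheaf : is_sheaf T sheafify.
Proof.
move=> A R TR p.
have sepR := separated_eq sheafify_separated.
pose q (A' : sobj a) (f : hom (A' : a) (A : a)) (x : pval F A') : Prop :=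
  exists Rf : sv R A' f, papp p A' (Submod Rf) = papp shf_unit A' x.
have qlin (A' : a) c (f f' : hom A' (A : a)) x x' : q A' f x -> q A' f' x' ->
    q A' (c *: f + f') (c *: x + x').
  move=> [Rf e] [Rf' e']; exists (smemP c Rf Rf').
  by rewrite [RHS]linearP -e -e' -linearP; congr (papp p A' _); apply: submod_ext.
have qres (A' A'' : a) (f : hom A' (A : a)) (g : hom A'' A') x : q A' f x ->
    q A'' (f \oc g) (pres F g x).
  move=> [Rf e]; exists (svM g Rf).
  by rewrite pnat -e -pnat; congr (papp p A'' _); apply: submod_ext.
have q0 (A' : a) : q A' (0 : hom A' (A : a)) 0.
  by exists (smem0 _); rewrite [RHS]linear0 -[RHS](linear0 (papp p A'));
     congr (papp p A' _); apply: submod_ext.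
pose V : sieve A := @Sieve k a A (fun A' => @Submodule k (hom (A' : a) (A : a))
   (fun f => exists x, q A' f x) (ex_intro _ 0 (q0 A'))
   (fun c f f' H H' => let: ex_intro x qx := H in let: ex_intro x' qx' := H' in
      ex_intro _ _ (qlin A' c f f' x x' qx qx')))
   (fun A' A'' f g H => let: ex_intro x qx := H in ex_intro _ _ (qres A' A'' f g x qx)).
have TV : T A V.
  apply: (tcov_local TR) => A' f Rf.
  exists (transporter (image_sub shf_unit) (papp p A' (Submod Rf))).
    exact: shf_unit_locally_surj.
  move=> A'' g [x xE]; exists x; exists (svM g Rf).
  by rewrite xE -pnat; congr (papp p A'' _); apply: submod_ext.
pose t : germ A := fun A' f =>
  if pselect (exists x, q A' f x) is left H then projT1 (boolp.cid H) else 0.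
have tP (A' : a) (f : hom A' (A : a)) : sv V A' f -> q A' f (t A' f).
  by rewrite /t; case: pselect => // H _; apply: (projT2 (boolp.cid H)).
have qfun (A' : a) (f : hom A' (A : a)) x x' : q A' f x -> q A' f x' ->
    tors A' (x - x').
  move=> [Rf e] [Rf' e']; apply/shf_unit0.
  by rewrite [LHS]linearB -e -e' (Prop_irrelevance Rf Rf') subrr.
have tgood : good_on V t.
  split=> [A' c f f' Vf Vf' | A' A'' f g Vf].
  - by apply: (qfun _ _ _ _ (tP _ _ _)); [apply: smemP | apply: (qlin); apply: (tP)].
  - by apply: (qfun _ _ _ _ (tP _ _ _)); [apply: svM | apply: (qres); apply: (tP)].
have tg : good_sub A t by exists V.
exists (shf_class (Submod tg)); split.
  move=> A' f; apply: (sepR _ _ _ _ (tcov_pull TV (sval f))) => A'' g Vfg.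
  rewrite -presM (shf_class_local (s := Submod tg) tgood Vfg).
  have [Rfg <-] := tP _ _ Vfg.
  by rewrite -pnat; congr (papp p A'' _); apply: submod_ext.
move=> y yP; apply: (sepR _ _ _ _ TV) => A' f Vf.
rewrite (shf_class_local (s := Submod tg) tgood Vf).
by have [Rf <-] := tP _ _ Vf; rewrite (yP A' (Submod Rf)).
Qed.

Lemma sheafify_univ (G : presheaf a) (f : pshom F G) : is_sheaf T G ->
  exists g : pshom sheafify G, ps_comp g shf_unit = f.
Proof.
move=> shG.
have [||||g gP] := @extend_relation k a T G shG sheafify
  (fun A y z => exists2 x, papp shf_unit A x = y & papp f A x = z).
- move=> A c _ _ _ _ [x <- <-] [x' <- <-]; exists (c *: x + x'); by rewrite linearP.
- by move=> A A' h _ _ [x <- <-]; exists (pres F h x); rewrite pnat.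
- move=> A _ [x /shf_unit0 Tx <-]; apply: (sheaf_separated shG).
  apply: (tcov_up Tx) => A' h /= xh; by rewrite -pnat xh linear0.
- move=> A y; exists (transporter (image_sub shf_unit) y).
    exact: shf_unit_locally_surj.
  by move=> A' h [x xE]; exists (papp f A' x); exists x.
by exists g; apply: pshom_ext => A x /=; apply: gP; exists x.
Qed.

Lemma sheafify_ext (G : presheaf a) (f g : pshom sheafify G) : is_sheaf T G ->
  ps_comp f shf_unit = ps_comp g shf_unit -> f = g.
Proof.
move=> shG fg; apply: (pshom_local_eq shG shf_unit_locally_surj) => A _ [x <-].
exact: (congr1 (fun h : pshom F G => papp h A x) fg).
Qed.

(** These properties determine the sheafification up to isomorphism. *)
Lemma sheafification_exists : exists (G : presheaf a) (e : pshom F G),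
  [/\ is_sheaf T G, forall A x, papp e A x = 0 <-> torsion T x &
      forall A y, locally T (image_sub e) (A := A) y].
Proof.
exists sheafify, shf_unit; split;
  [exact: sheafify_is_sheaf | exact: shf_unit0 | exact: shf_unit_locally_surj].
Qed.
End Sheafification.

(** * Colimits of sheaves *)

Section SheafColimits.
Context (k : comPzRingType) (a : slcat k) (T : topology a).

Definition shom (F G : Sh T) (f : hom F G) : pshom (proj1_sig F) (proj1_sig G) := f.
Definition is_sh (F : Sh T) : is_sheaf T (proj1_sig F) := proj2_sig F.

Context (J : icat) (D : diagram J (Sh T)).
Local Notation DP j := (proj1_sig (D j)).
Let vv (A : sobj a) (j : iob J) : lmodType k := pval (DP j) A.
Let es (e : arrows J) : iob J := (projT1 e).1.
Let et (e : arrows J) : iob J := (projT1 e).2.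
Let dm (A : sobj a) (e : arrows J) : {linear vv A (es e) -> vv A (et e)} :=
  papp (shom (dmap D (projT2 e))) A.
Let cv (A : sobj a) : lmodType k := @mcolim k _ (vv A) _ es et (dm A).
Let cin (A : sobj a) j : {linear pval (DP j) A -> cv A} :=
  @mc_in k _ (vv A) _ es et (dm A) j.

Fact pcol_cocone (A A' : a) (f : hom A' A) :
  @mc_cocone k _ (vv A) _ es et (dm A) _ (fun j => lin_comp (cin A' j) (pres (DP j) f)).
Proof.
move=> e v.
have h := @mc_in_cocone k _ (vv A') _ es et (dm A') e (pres (DP (projT1 e).1) f v).
exact: etrans (congr1 (cin A' (et e)) (esym (pnat (shom (dmap D (projT2 e))) f v))) h.
Qed.
Definition pcol_res (A A' : a) (f : hom A' A) : {linear cv A -> cv A'} :=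
  mc_lift (pcol_cocone f).
Lemma pcol_resE (A A' : a) (f : hom A' A) j v :
  pcol_res f (cin A j v) = cin A' j (pres (DP j) f v).
Proof. exact: (mc_liftE (pcol_cocone f)). Qed.
Fact pcol_lin (A A' : opcat a) : linear (fun f : hom A A' => @pcol_res A A' f
   : @hom _ (Modk k) (cv A) (cv A')).
Proof.
move=> c f g; apply: mc_ext => j v.
rewrite lin_linE !pcol_resE -linearP; congr (cin A' j _).
exact: (@pres_lin k a (DP j) A A' c f g v).
Qed.
Fact pcol_1 (A : opcat a) : pcol_res (idm A) = lin_id (cv A).
Proof. by apply: mc_ext => j v; rewrite pcol_resE /= (@pres1 k a). Qed.
Fact pcol_M (A A' A'' : opcat a) (g : hom A' A'') (f : hom A A') :
  @pcol_res A A'' (g \oc f) = lin_comp (@pcol_res A' A'' g) (@pcol_res A A' f).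
Proof.
apply: mc_ext => j v; rewrite pcol_resE.
transitivity (@pcol_res A' A'' g (@pcol_res A A' f (cin A j v))) => //.
rewrite !pcol_resE; congr (cin A'' j _).
exact: (@presM k a (DP j) A A' A'' f g v).
Qed.
Definition pcol : presheaf a :=
  @Lfunctor k (opcat a) (Modk k) cv (@pcol_res) pcol_lin pcol_1 pcol_M.
Fact pcol_leg_nat j (A A' : a) (f : hom A' A) (x : pval (DP j) A) :
  cin A' j (pres (DP j) f x) = pres pcol f (cin A j x).
Proof. by rewrite [RHS]pcol_resE. Qed.
Definition pcol_leg j : pshom (DP j) pcol := @Pshom _ _ (DP j) pcol (fun A => cin A j) (@pcol_leg_nat j).

Lemma pcol_desc (G : presheaf a) (f : forall j, pshom (DP j) G) :
  (forall i j (e : @imor J i j) A x, papp (f j) A (papp (shom (dmap D e)) A x) = papp (f i) A x) ->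
  exists g : pshom pcol G, forall j, ps_comp g (pcol_leg j) = f j.
Proof.
move=> fP.
have co (A : sobj a) : @mc_cocone k _ (vv A) _ es et (dm A) _ (fun j => papp (f j) A) by move=> e v; apply: fP.
have nat (A A' : a) (h : hom A' A) (x : pval pcol A) :
    mc_lift (co A') (pres pcol h x) = pres G h (mc_lift (co A) x).
  pose l := lin_comp (mc_lift (co A')) (pcol_res h).
  pose r := lin_comp (pres G h) (mc_lift (co A)).
  suff lr : l = r by exact: (congr1 (fun u : {linear cv A -> _} => u x) lr).
  apply: mc_ext => j v; rewrite /l /r.
  transitivity (mc_lift (co A') (pcol_res h (cin A j v))) => //.
  transitivity (pres G h (mc_lift (co A) (cin A j v))) => //.
  by rewrite pcol_resE !(mc_liftE (co _)) pnat.
exists (@Pshom _ _ pcol G (fun A => mc_lift (co A)) nat) => j.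
by apply: pshom_ext => A x; apply: (mc_liftE (co A)).
Qed.

Definition sh_colim : Sh T := exist _ (sheafify T pcol) (@sheafify_is_sheaf k a T pcol).
Definition sh_leg j : hom (D j) sh_colim := ps_comp (shf_unit T pcol) (pcol_leg j).
Fact sh_leg_nat i j (e : @imor J i j) : sh_leg j \oc dmap D e = sh_leg i.
Proof.
apply: pshom_ext => A x; rewrite /=; congr (papp (shf_unit T pcol) A _).
exact: (@mc_in_cocone k _ (vv A) _ es et (dm A) (existT (fun p => imor p.1 p.2) (i, j) e)).
Qed.
Lemma sh_colimP : is_colimit (@Cocone k J (Sh T) D sh_colim sh_leg sh_leg_nat).
Proof.
move=> [[G shG] f fP]; rewrite /=.
have [i j e A x|g gP] := @pcol_desc G f.
  exact: (congr1 (fun u : pshom _ G => papp u A x) (fP i j e)).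
have [h hP] := sheafify_univ g shG.
exists h; split=> [j | h' h'P].
  rewrite -gP -hP; exact: pshom_ext.
apply: (sheafify_ext shG); rewrite hP.
apply: pshom_ext => A x.
suff e : papp g A = papp (ps_comp h' (shf_unit T pcol)) A by rewrite e.
apply: mc_ext => j v.
have e1 := congr1 (fun u : pshom _ G => papp u A v) (gP j).
have e2 := congr1 (fun u : pshom _ G => papp u A v) (h'P j).
exact: etrans e1 (esym e2).
Qed.
End SheafColimits.

Lemma Sh_cocomplete (k : comPzRingType) (a : slcat k) (T : topology a) : cocomplete (Sh T).
Proof. by move=> J D; eexists; apply: sh_colimP. Qed.

(** * Abelian categories and filtered colimits *)

Section AbelianFacts.
Context (k : comPzRingType) (C : lcat k) (abC : abelian C).

Lemma kernel_mono (X Y Z : C) (i : hom X Y) (f : hom Y Z) : is_kernel i f -> mono i.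
Proof.
move=> [fi iu] W g h gh; have [|u [_ uq]] := iu W (i \oc h).
  by rewrite compA fi comp0l.
by rewrite -(uq g gh) (uq h).
Qed.

Lemma cokernel_epi (X Y Z : C) (p : hom Y Z) (f : hom X Y) : is_cokernel p f -> epi p.
Proof.
move=> [pf pu] W g h gh; have [|u [_ uq]] := pu W (h \oc p).
  by rewrite -compA pf comp0r.
by rewrite -(uq g gh) (uq h).
Qed.

Lemma epi_cokernel (X Y K : C) (p : hom X Y) (i : hom K X) :
  epi p -> is_kernel i p -> is_cokernel p i.
Proof.
move=> ep [pi0 iu]; split=> // W g gi.
have [Z [f [pf pu]]] := ab_epi abC ep.
have [n [nf _]] := iu _ _ pf.
apply: pu; by rewrite -nf compA gi comp0l.
Qed.

Lemma mono_kernel (X Y Q : C) (m : hom X Y) (b : hom Y Q) :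
  mono m -> is_cokernel b m -> is_kernel m b.
Proof.
move=> mm [bm bu]; split=> // W g bg.
have [Z [f [fm mu]]] := ab_mono abC mm.
have [n [nb _]] := bu _ _ fm.
by apply: mu; rewrite -nb -compA bg comp0r.
Qed.

(** The image of [f] embeds into its target: were [m] to kill [h], the
    cokernel of [h] would be a smaller quotient through which [f] factors. *)
Lemma coimage_mono (K X E Y : C) (f : hom X Y) (i : hom K X) (e : hom X E) (m : hom E Y) :
  is_kernel i f -> is_cokernel e i -> m \oc e = f -> mono m.
Proof.
move=> [fi iu] ce mef; apply: mono0P => H h mh.
have ee := cokernel_epi ce; have [ei eu] := ce.
have [R [r cr]] := ab_cokernels abC h; have er := cokernel_epi cr.
have [m' [m'r _]] := cr.2 _ _ mh.
have ere : epi (r \oc e).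
  by move=> W g g'; rewrite !compA => /ee/er.
have [K' [k' [rek ku]]] := ab_epi abC ere.
have [|l [il _]] := iu _ k'; first by rewrite -mef -m'r -!compA (compA r) rek comp0r.
have [|n [nre _]] := ku _ e; first by rewrite -il compA ei comp0l.
have nr : n \oc r = idm E by apply: ee; rewrite comp1l -compA.
by rewrite -[h]comp1l -nr -compA cr.1 comp0r.
Qed.

(** By the dual argument: the kernel of a map that kills [e] would be a smaller
    subobject through which [r] factors. *)
Lemma image_epi (X Y Q K : C) (r : hom X Y) (q : hom Y Q) (i : hom K Y) (e : hom X K) :
  is_cokernel q r -> is_kernel i q -> i \oc e = r -> epi e.
Proof.
move=> [qr qu] ki ier; apply: epi0P => W g ge.
have mi := kernel_mono ki; have [qi iu] := ki.
have [K' [j kj]] := ab_kernels abC g; have mj := kernel_mono kj.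
have [e' [je _]] := kj.2 _ _ ge.
have mij : mono (i \oc j) by move=> Z x y; rewrite -!compA => /mi/mj.
have [Z [f [fij fu]]] := ab_mono abC mij.
have [|f' [f'q _]] := qu _ f; first by rewrite -ier -je (compA i) compA fij comp0l.
have [|n [ijn _]] := fu _ i; first by rewrite -f'q -compA qi comp0r.
have jn : j \oc n = idm K by apply: mi; rewrite comp1r compA.
by rewrite -[g]comp1r -jn compA kj.1 comp0l.
Qed.

(** Stability of epimorphisms under pullback, expressed by test maps.  The pullback
    is the kernel of [c p1 - q p2] on the biproduct; that map is an epimorphism,
    hence the cokernel of its kernel, and what vanishes on the pullback factors
    through it. *)
Lemma epi_pullback (T X Y : C) (c : hom T X) (q : hom Y X) : epi q ->
  forall Z (g : hom T Z),
  (forall W (t : hom W T) (y : hom W Y), c \oc t = q \oc y -> g \oc t = 0) -> g = 0.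
Proof.
move=> eq Z g H.
have [S [i1 [i2 [p1 [p2 [p11 p22 p12 p21 pid]]]]]] := ab_biproducts abC T Y.
pose f := c \oc p1 - q \oc p2.
have f1 : f \oc i1 = c by rewrite compBl -!compA p11 p21 comp1r comp0r subr0.
have f2 : f \oc i2 = - q by rewrite compBl -!compA p12 p22 comp1r comp0r sub0r.
have ef : epi f.
  apply: epi0P => W h hf.
  have : h \oc q = 0 \oc q.
    by rewrite comp0l -[q]opprK -f2 compNr compA hf comp0l oppr0.
  exact: eq.
have [K [i ki]] := ab_kernels abC f.
have [fi fu] := epi_cokernel ef ki.
have gi : (g \oc p1) \oc i = 0.
  rewrite -compA; apply: (H _ _ (p2 \oc i)).
  apply/eqP; rewrite -subr_eq0; apply/eqP.
  by rewrite !compA -compBl.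
have [n [nf _]] := fu _ _ gi.
have n0 : n = 0.
  apply: eq; rewrite comp0l -[q]opprK -f2 compNr compA nf -compA p12 comp0r.
  by rewrite oppr0.
by rewrite -[g]comp1r -p11 compA -nf n0 !comp0l.
Qed.
End AbelianFacts.

Section FilteredSubsets.

Lemma finite_of_no_injection (X : Type) : card_lt X nat ->
  exists s : seq X, forall x, List.In x s.
Proof.
move=> nX; apply: contrapT => H; apply: nX.
have f (s : seq X) : exists x, ~ List.In x s.
  by apply: contrapT => H'; apply: H; exists s => x; apply: contrapT => xs; apply: H'; exists x.
pose g (s : seq X) : X := projT1 (boolp.cid (f s)).
have gP s : ~ List.In (g s) s by exact: (projT2 (boolp.cid (f s))).
pose l n := iter n (fun s => g s :: s) [::].
exists (fun n => g (l n)).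
have lt m n : (m < n)%N -> List.In (g (l m)) (l n).
  elim: n => // n IH; rewrite ltnS leq_eqVlt => /orP[/eqP -> |/IH]; first by left.
  by right.
move=> m n e; case: (ltngtP m n) => // /lt mn.
- by case: (gP (l n)); rewrite -e.
- by case: (gP (l m)); rewrite e.
Qed.

(** Lists ordered by inclusion of their supports stand for the finite subsets. *)
Definition subfamilies (I : small) : icat.
Proof.
refine (@Icat (seq I) (fun s t => forall x, List.In x s -> List.In x t)
  (fun s x H => H) (fun r s t g f x H => g x (f x H)) _ _ _) => //.
Defined.

Lemma subfamilies_filtered (I : small) : filtered (subfamilies I).
Proof.
move=> K D fK.
have [s sP] : exists s : seq (iob K), forall x, List.In x s.
  apply: finite_of_no_injection => -[f fi]; apply: fK.
  exists (fun n => existT (fun p : iob K * iob K => imor p.1 p.2) (f n, f n) (iid (f n))).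
  by move=> m n /(congr1 (fun e => (projT1 e).1)) /fi.
pose t := List.flat_map (fun x => D x : seq I) s.
have tP i : @imor (subfamilies I) (D i) t.
  by move=> x Dx; apply/List.in_flat_map; exists i.
by exists t, tP => i i' f; exact: (@Prop_irrelevance (forall x, List.In x (D i : seq I) -> List.In x t)).
Qed.
End FilteredSubsets.

(** Factorizations through epimorphisms are unique, so quotients of [Y] form a
    diagram as soon as each factors through the next. *)
Section QuotientDiagram.
Context (k : comPzRingType) (C : lcat k) (J : icat) (Y : C) (Q : iob J -> C)
  (q : forall j, hom Y (Q j)) (eq : forall j, epi (q j))
  (fac : forall i j, imor i j -> exists h, h \oc q i = q j).
Let qmap i j (f : @imor J i j) : hom (Q i) (Q j) := projT1 (boolp.cid (fac f)).
Fact qmapE i j (f : @imor J i j) : qmap f \oc q i = q j.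
Proof. exact: (projT2 (boolp.cid (fac f))). Qed.
Fact qmap1 i : qmap (iid i) = idm (Q i).
Proof. by apply: eq; rewrite qmapE comp1l. Qed.
Fact qmapM (i j l : iob J) (g : imor j l) (f : imor i j) :
  qmap (icomp g f) = qmap g \oc qmap f.
Proof. by apply: eq; rewrite -compA !qmapE. Qed.
Definition quotient_diagram : diagram J C := @Diagram k J C Q qmap qmap1 qmapM.
Lemma quotient_diagramE i j (f : imor i j) : dmap quotient_diagram f \oc q i = q j.
Proof. exact: qmapE. Qed.
End QuotientDiagram.

Section FiniteSums.
Context (k : comPzRingType) (C : lcat k) (grC : grothendieck C).
Context (I : small) (X : I -> C) (P : C) (i_ : forall i, hom (X i) P) (iP : is_coproduct i_).

Definition finite_sum (T : C) (c : hom T P) : Prop :=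
  exists s : seq {i : I & hom T (X i)}, c = \sum_(p <- s) i_ (projT1 p) \oc projT2 p.

Lemma coproduct_proj : exists p_ : forall i, hom P (X i),
  (forall i, p_ i \oc i_ i = idm (X i)) /\ (forall i j, i <> j -> p_ j \oc i_ i = 0).
Proof.
pose d j i : hom (X i) (X j) :=
  if pselect (i = j) is left e then disc_map X e else 0.
have H j : exists p : hom P (X j), forall i, p \oc i_ i = d j i.
  by have [p [pP _]] := iP (d j); exists p.
exists (fun j => projT1 (boolp.cid (H j))); split=> [i | i j ij].
- rewrite (projT2 (boolp.cid (H i)) i) /d; case: pselect => // e.
  by rewrite (Prop_irrelevance e erefl).
- by rewrite (projT2 (boolp.cid (H j)) i) /d; case: pselect.
Qed.

(** [e s] is the projector onto the summands listed in [s]. *)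
Lemma support_projector : exists e : seq I -> hom P P,
  [/\ forall s T (c : hom T P), finite_sum (e s \oc c),
      forall s i, List.In i s -> e s \oc i_ i = i_ i &
      forall s t, (forall i, List.In i s -> List.In i t) -> e t \oc e s = e s].
Proof.
have [p_ [pii pij]] := coproduct_proj.
(* A summand is added to the list by adding its projector and subtracting the
   part of it that is already covered, which is all of it if it is repeated. *)
pose fix e (s : seq I) : hom P P :=
  if s is i :: s' then e s' + (i_ i \oc p_ i) - (e s' \oc i_ i) \oc p_ i else 0.
have e_in s i : List.In i s -> e s \oc i_ i = i_ i.
  elim: s => //= j s IH H; rewrite compBl compDl.
  have [e0|ne] := pselect (i = j).
    by rewrite -e0 -!compA !pii !comp1r addrC addrA [- _ + _]addrC subrr add0r.
  case: H => [/esym //|/IH ->]; by rewrite -!compA pij // !comp0r subr0 addr0.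
have fin s T (c : hom T P) : finite_sum (e s \oc c).
  elim: s c => [|i s IH] c /=; first by exists [::]; rewrite comp0l big_nil.
  have -> : (e s + i_ i \oc p_ i - (e s \oc i_ i) \oc p_ i) \oc c =
    e s \oc (c - i_ i \oc (p_ i \oc c)) + i_ i \oc (p_ i \oc c).
    by rewrite compBl compDl compBr !compA addrAC.
  have [l ->] := IH (c - i_ i \oc (p_ i \oc c)).
  exists (existT _ i (p_ i \oc c) :: l); by rewrite big_cons addrC.
have fix_ s t : (forall i, List.In i s -> List.In i t) -> e t \oc e s = e s.
  elim: s => [|i s IH] st /=; first by rewrite comp0r.
  have it : e t \oc i_ i = i_ i by apply: e_in; apply: st; left.
  rewrite compBr compDr !compA it IH //.
  by move=> j js; apply: st; right.
by exists e.
Qed.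

(** Here exactness of filtered colimits enters.  Let [K s] be the part of [T] that
    [c] maps into the summands listed in [s].  The quotients of [T] by the [K s]
    embed into the quotients of [P] by those summands.  The colimit of the latter
    is zero, hence so is that of the former, and the [K s] exhaust [T]. *)
Lemma finite_sums_jointly_epi (T : C) (c : hom T P) Z (g : hom T Z) :
  (forall W (t : hom W T), finite_sum (c \oc t) -> g \oc t = 0) -> g = 0.
Proof.
move=> H; have [e [fin e_in efix]] := support_projector.
have abC := gr_abelian grC.
have coker (U V : C) (f : hom U V) : {Q : C & {p : hom V Q | is_cokernel p f}}.
  by have /boolp.cid[Q /boolp.cid[p pP]] := ab_cokernels abC f; exists Q, p.
have ker (U V : C) (f : hom U V) : {Q : C & {p : hom Q U | is_kernel p f}}.
  by have /boolp.cid[Q /boolp.cid[p pP]] := ab_kernels abC f; exists Q, p.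
pose J := subfamilies I.
pose Q (s : iob J) : C := projT1 (coker _ _ (e s)).
pose q (s : iob J) : hom P (Q s) := proj1_sig (projT2 (coker _ _ (e s))).
have qP s : is_cokernel (q s) (e s) := proj2_sig (projT2 (coker _ _ (e s))).
pose K (s : iob J) : C := projT1 (ker _ _ (q s \oc c)).
pose i (s : iob J) : hom (K s) T := proj1_sig (projT2 (ker _ _ (q s \oc c))).
have kP s : is_kernel (i s) (q s \oc c) := proj2_sig (projT2 (ker _ _ (q s \oc c))).
pose E (s : iob J) : C := projT1 (coker _ _ (i s)).
pose r (s : iob J) : hom T (E s) := proj1_sig (projT2 (coker _ _ (i s))).
have rP s : is_cokernel (r s) (i s) := proj2_sig (projT2 (coker _ _ (i s))).
have mex s : exists m : hom (E s) (Q s), m \oc r s = q s \oc c.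
  by have [|m [mP _]] := (rP s).2 _ (q s \oc c); [exact: (kP s).1 | exists m].
pose m s := projT1 (boolp.cid (mex s)).
have mP s : m s \oc r s = q s \oc c := projT2 (boolp.cid (mex s)).
have mm s : mono (m s) := coimage_mono abC (kP s) (rP s) (mP s).
pose B (s : iob J) : C := projT1 (coker _ _ (m s)).
pose b (s : iob J) : hom (Q s) (B s) := proj1_sig (projT2 (coker _ _ (m s))).
have bP s : is_cokernel (b s) (m s) := proj2_sig (projT2 (coker _ _ (m s))).
have eq s : epi (q s) := cokernel_epi (qP s).
have er s : epi (r s) := cokernel_epi (rP s).
have eb s : epi (b s \oc q s).
  by move=> W x y; rewrite !compA => /eq/(cokernel_epi (bP s)).
have facq s t (f : @imor J s t) : exists h, h \oc q s = q t.
  have [|h [hP _]] := (qP s).2 _ (q t); last by exists h.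
  by rewrite -(efix s t f) compA (qP t).1 comp0l.
have facr s t (f : @imor J s t) : exists h, h \oc r s = r t.
  have [h hP] := facq s t f.
  have [|l [lP _]] := (kP t).2 _ (i s).
    by rewrite -hP -!compA (compA (q s)) (kP s).1 comp0r.
  have [|h' [h'P _]] := (rP s).2 _ (r t); last by exists h'.
  by rewrite -lP compA (rP t).1 comp0l.
have facb s t (f : @imor J s t) : exists h, h \oc (b s \oc q s) = b t \oc q t.
  have [h hP] := facq s t f; have [h' h'P] := facr s t f.
  have mh : h \oc m s = m t \oc h'.
    by apply: er; rewrite -!compA mP h'P mP compA hP.
  have [|l [lP _]] := (bP s).2 _ (b t \oc h).
    by rewrite -compA mh compA (bP t).1 comp0l.
  by exists l; rewrite compA lP -compA hP.
pose D1 := quotient_diagram er facr; pose D2 := quotient_diagram eq facq.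
pose D3 := quotient_diagram eb facb.
have n1 s t (f : @imor J s t) : m t \oc dmap D1 f = dmap D2 f \oc m s.
  apply: (er s); rewrite -!compA mP (quotient_diagramE er facr f) mP.
  by rewrite compA (quotient_diagramE eq facq f).
have n2 s t (f : @imor J s t) : b t \oc dmap D2 f = dmap D3 f \oc b s.
  apply: (eq s); rewrite -!compA (quotient_diagramE eq facq f).
  by rewrite (quotient_diagramE eb facb f).
have [L1 cL1] := gr_cocomplete grC D1.
have [L2 cL2] := gr_cocomplete grC D2.
have [L3 cL3] := gr_cocomplete grC D3.
(* Every summand of [P] is killed at some later stage. *)
have leg2 s : leg L2 s = 0.
  apply: (eq s); rewrite comp0l; apply: (coproduct_ext iP) => j; rewrite comp0l.
  have st : @imor J s (j :: s) by move=> x xs; right.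
  rewrite -(leg_nat L2 st) -(compA _ _ (q s)) (quotient_diagramE eq facq st).
  rewrite -(e_in (j :: s) j) ?compA; last by left.
  by rewrite -(compA _ (q _)) (qP _).1 comp0r comp0l.
have nf s t (f : @imor J s t) : (leg L2 t \oc m t) \oc dmap D1 f = leg L2 s \oc m s.
  by rewrite !leg2 !comp0l.
have ng s t (f : @imor J s t) : (leg L3 t \oc b t) \oc dmap D2 f = leg L3 s \oc b s.
  by rewrite -compA n2 compA leg_nat.
have [f [fP fq]] := cL1 (@Cocone k J C D1 (apex L2) _ nf).
have [g' [gP gq]] := cL2 (@Cocone k J C D2 (apex L3) _ ng).
have sx s : short_exact (m s) (b s).
  by split; [exact: (mono_kernel abC (mm s) (bP s)) | exact: bP].
have [[_ kf] _] :=
  @gr_exact _ _ grC J D1 D2 D3 m b (@subfamilies_filtered I) n1 n2 sx _ _ _ f g' cL1 cL2 cL3 fP gP.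
have f0 : f = 0.
  by apply: fq => s /=; rewrite leg2 !comp0l.
have id0 : idm (apex L1) = 0.
  have [|h [_ hq]] := kf (apex L1) 0; first by rewrite comp0r.
  have e1 : h = idm _ by apply: hq; rewrite f0 comp0l.
  by rewrite -e1; apply: hq; rewrite f0 comp0l.
have gfac s : exists h, h \oc r s = g.
  have [|h [hP _]] := (rP s).2 _ g; last by exists h.
  apply: H; have [|n [nP _]] := (qP s).2 _ (idm P - e s).
    by rewrite compBl comp1l efix // subrr.
  have -> : c \oc i s = e s \oc (c \oc i s).
    apply/eqP; rewrite -subr_eq0 -{1}[c \oc i s]comp1l -compBl -nP -compA.
    by rewrite (compA (q s)) (kP s).1 comp0r.
  exact: fin.
pose gs s := projT1 (boolp.cid (gfac s)).
have gsP s : gs s \oc r s = g := projT2 (boolp.cid (gfac s)).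
have ngs s t (x : @imor J s t) : gs t \oc dmap D1 x = gs s.
  by apply: (er s); rewrite -compA (quotient_diagramE er facr x) !gsP.
have [h [hP _]] := cL1 (@Cocone k J C D1 Z gs ngs).
have /= h0 := hP [::].
by rewrite -(gsP [::]) -h0 -[leg _ _]comp1l id0 comp0l comp0r comp0l.
Qed.
End FiniteSums.

(** * LC morphisms *)

Section LCFacts.
Context (k : comPzRingType) (a : slcat k) (T : topology a) (C : lcat k)
  (u : lfunctor (lcat_of_slcat a) C) (hu : LC_morphism T u) (grC : grothendieck C).
Let abC := gr_abelian grC.
Local Notation y_ X := (nerve u X).

Lemma lc_cover_epi (A : sobj a) (R : sieve A) : T A R -> forall Z (g h : hom (u A) Z),
  (forall (A' : a) (f : hom A' (A : a)), sv R A' f -> g \oc fmap u f = h \oc fmap u f) ->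
  g = h.
Proof.
move=> /(lc_top hu) je Z g h gh; apply: je => -[A' f] /=; exact: gh (svalP f).
Qed.

Lemma nerve_separated (X : C) : separated T (y_ X).
Proof.
move=> A c Tc; apply: (lc_cover_epi Tc) => A' f /= cf; by rewrite cf comp0l.
Qed.

Section UKill.
Context (A : a) (Z : C) (g : hom (u A) Z).
Fact ukill0 (A' : sobj a) : g \oc fmap u (0 : hom (A' : a) A) = 0.
Proof. by rewrite fmap0 comp0r. Qed.
Fact ukillP (A' : sobj a) c (f f' : hom (A' : a) A) : g \oc fmap u f = 0 ->
  g \oc fmap u f' = 0 -> g \oc fmap u (c *: f + f') = 0.
Proof. by move=> e e'; rewrite fmap_lin comp_linr e e' scaler0 addr0. Qed.
Fact ukillM (A' A'' : a) (f : hom A' A) (h : hom A'' A') : g \oc fmap u f = 0 ->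
  g \oc fmap u (f \oc h) = 0.
Proof. by move=> e; rewrite fmapM compA e comp0l. Qed.
Definition ukill : @sieve k a A := @Sieve k a A (fun A' =>
  @Submodule k (hom (A' : a) A) (fun f => g \oc fmap u f = 0) (ukill0 A') (@ukillP A')) ukillM.
End UKill.

Lemma lc_family_epi (I : small) (A : a) (X : I -> a) (x : forall i, hom (X i) A) :
  covering T x -> forall Z (g : hom (u A) Z),
  (forall i, g \oc fmap u (x i) = 0) -> g = 0.
Proof.
move=> [R [[Rx Rmin] TR]] Z g gx; apply: (lc_cover_epi TR) => A' f Rf.
rewrite comp0l; exact: (Rmin (ukill g) gx A' f Rf).
Qed.

(** Generation and (F) replace arbitrary objects of [C] over [u A] by objects of the
    site over [A]. *)
Lemma locally_of_epi (X : C) (N : subpresheaf (y_ X)) (A : a) (c : hom (u A) X) :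
  (forall Z (g : hom (u A) Z), (forall Y (t : hom Y (u A)),
      (forall (B : a) (b : hom (u B) Y), N B (c \oc (t \oc b))) -> g \oc t = 0) -> g = 0) ->
  locally T N (c : pval (y_ X) A).
Proof.
move=> H; apply/(lc_top hu) => Z g h gh; apply/eqP; rewrite -subr_eq0; apply/eqP/H.
move=> Y t Nt; have [I [B [b jb]]] := lc_G hu Y.
apply: jb => i; rewrite comp0l.
have [J [D [x [f [cx xf]]]]] := lc_F hu (t \oc b i).
apply: (lc_family_epi cx) => j; rewrite -!compA (compA t) xf.
have Nf : sv (transporter N (c : pval (y_ X) A)) (D j) (f j).
  have := spM (x j) (Nt _ (b i)).
  by rewrite nerve_resE -[c \oc _ \oc _]compA xf.
have /= e := gh (existT _ (D j) (Submod Nf)).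
by rewrite compBl e subrr.
Qed.

Lemma lift_epi_locally (X Y : C) (q : hom Y X) (A : a) (c : hom (u A) X) : epi q ->
  locally T (image_sub (nerve_post u q)) (c : pval (y_ X) A).
Proof.
move=> eq; apply: locally_of_epi => Z g H; apply: (epi_pullback abC (c := c) eq) => W t y ct.
apply: H => B b; exists (y \oc b : pval (y_ Y) B); by rewrite /= !compA ct.
Qed.

Section FiniteSub.
Context (I : small) (X : I -> C) (P : C) (i_ : forall i, hom (X i) P).
Fact fin_sub0 (A : sobj a) : finite_sum i_ (0 : pval (y_ P) A).
Proof. by exists [::]; rewrite big_nil. Qed.
Fact fin_subP (A : sobj a) c (x y : pval (y_ P) A) : finite_sum i_ x -> finite_sum i_ y ->
  finite_sum i_ (c *: x + y).
Proof.
move=> [s ->] [t ->]; exists ([seq existT (fun i => hom (u A) (X i) : Type) (projT1 p) (c *: projT2 p) | p <- s] ++ t).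
rewrite big_cat big_map scaler_sumr; congr (_ + _); apply: eq_bigr => p _ /=.
by rewrite compZr.
Qed.
Fact fin_subM (A A' : a) (f : hom A' A) (x : pval (y_ P) A) : finite_sum i_ x ->
  finite_sum i_ (pres (y_ P) f x : hom (u A') P).
Proof.
move=> [s ->]; exists [seq existT (fun i => hom (u A') (X i) : Type) (projT1 p) (projT2 p \oc fmap u f) | p <- s].
rewrite nerve_resE comp_suml big_map; apply: eq_bigr => p _ /=; by rewrite compA.
Qed.
Definition finite_sub : subpresheaf (y_ P) :=
  @Subpresheaf k a (y_ P) (fun A => @Submodule k (pval (y_ P) A) (fun c => finite_sum i_ c)
     (fin_sub0 A) (@fin_subP A)) fin_subM.
Lemma finite_locally : is_coproduct i_ -> forall (A : a) (c : hom (u A) P),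
  locally T finite_sub (c : pval (y_ P) A).
Proof.
move=> iP A c; apply: locally_of_epi => Z g H.
apply: (finite_sums_jointly_epi grC iP (c := c)) => W t [s sE].
apply: H => B b; exists [seq existT (fun i => hom (u B) (X i) : Type) (projT1 p) (projT2 p \oc b) | p <- s].
rewrite compA sE comp_suml big_map; apply: eq_bigr => p _ /=; by rewrite compA.
Qed.
End FiniteSub.

Lemma tcov_of_covering (I : small) (A : sobj a) (X : I -> a)
    (x : forall i, hom (X i) (A : a)) (S : sieve A) :
  covering T x -> (forall i, sv S (X i) (x i)) -> T A S.
Proof. by move=> [R [[_ Rmin] TR]] Sx; apply: (tcov_up TR); apply: Rmin. Qed.

Section Full.
Context (A : a).
Fact uim0 (A' : sobj a) : exists f : hom (A' : a) A, (0 : pval (y_ (u A)) A') = fmap u f.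
Proof. by exists 0; rewrite fmap0. Qed.
Fact uimP (A' : sobj a) c (x y : pval (y_ (u A)) A') :
  (exists f : hom (A' : a) A, x = fmap u f) -> (exists f : hom (A' : a) A, y = fmap u f) ->
  exists f : hom (A' : a) A, c *: x + y = fmap u f.
Proof. by move=> [f ->] [g ->]; exists (c *: f + g); rewrite fmap_lin. Qed.
Fact uimM (A' A'' : a) (h : hom A'' A') (x : pval (y_ (u A)) A') :
  (exists f : hom A' A, x = fmap u f) -> exists f : hom A'' A, pres (y_ (u A)) h x = fmap u f.
Proof. by move=> [f ->]; exists (f \oc h); rewrite nerve_resE fmapM. Qed.
Definition uim_sub : subpresheaf (y_ (u A)) :=
  @Subpresheaf k a (y_ (u A)) (fun A' => @Submodule k (pval (y_ (u A)) A')
   (fun x => exists f : hom (A' : a) A, x = fmap u f) (uim0 A') (@uimP A')) uimM.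
Lemma full_locally (A' : a) (c : hom (u A') (u A)) : locally T uim_sub (c : pval (y_ (u A)) A').
Proof.
have [I [X [x [f [cx xf]]]]] := lc_F hu c.
by apply: (tcov_of_covering cx) => i; exists (f i); rewrite -xf.
Qed.
Lemma faithful_locally (A' : a) (f : hom A' A) : fmap u f = 0 ->
  @torsion k a T (nerve (lfunctor_id _) A) A' f.
Proof.
by move=> /(lc_FF hu)[I [X [x [cx xf]]]]; apply: (tcov_of_covering cx).
Qed.
End Full.

(** By (F) and (FF), the map to [C (u -, u A)] from the presheaf represented by [A]
    is locally bijective, so sheaves do not distinguish the two. *)
Lemma nerve_rep (F : presheaf a) : is_sheaf T F -> forall (A : a) (x : pval F A),
  exists p : pshom (y_ (u A)) F, papp p A (idm (u A)) = x.
Proof.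
move=> shF A x.
have [||||p pP] := @extend_relation k a T F shF (y_ (u A))
  (fun A' c z => exists2 f : hom (A' : a) A, c = fmap u f & z = pres F f x).
- move=> A' c _ _ _ _ [f -> ->] [g -> ->]; exists (c *: f + g).
  + by rewrite fmap_lin.
  + by rewrite pres_lin.
- move=> A' A'' h _ _ [f -> ->]; exists (f \oc h).
  + by rewrite nerve_resE fmapM.
  + by rewrite presM.
- move=> A' z [f /esym/faithful_locally Tf ->]; apply: (sheaf_separated shF).
  apply: (tcov_up Tf) => A'' h /= fh.
  by rewrite -presM fh pres0.
- move=> A' c; exists (transporter (uim_sub A) c); first exact: full_locally.
  by move=> A'' h [f fE]; exists (pres F f x); exists f.
exists p; apply: pP; exists (idm A); first by rewrite fmap1.
by rewrite pres1.
Qed.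

Lemma nerve_rep_ext (F : presheaf a) : is_sheaf T F -> forall (A : a)
  (p q : pshom (y_ (u A)) F), papp p A (idm (u A)) = papp q A (idm (u A)) -> p = q.
Proof.
move=> shF A p q pq; apply: (@pshom_local_eq k a T F shF _ (uim_sub A) p q (@full_locally A)) => A' c [f ->].
have e : fmap u f = pres (y_ (u A)) f (idm (u A)) by rewrite nerve_resE comp1l.
by rewrite e !pnat pq.
Qed.

(** ** Sheaves see colimits in [C] *)

Section Coproducts.
Context (F : presheaf a) (shF : is_sheaf T F).
Context (I : small) (X : I -> C) (P : C) (i_ : forall i, hom (X i) P) (iP : is_coproduct i_).

Lemma nerve_coproduct_ext (p q : pshom (y_ P) F) :
  (forall i, ps_comp p (nerve_post u (i_ i)) = ps_comp q (nerve_post u (i_ i))) -> p = q.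
Proof.
move=> pq; apply: (@pshom_local_eq k a T F shF _ (finite_sub i_) p q (finite_locally iP)) => A c [s ->].
rewrite [LHS]linear_sum [RHS]linear_sum; apply: eq_bigr => -[i d] _ /=.
exact: (congr1 (fun h : pshom (y_ (X i)) F => papp h A d) (pq i)).
Qed.

Lemma nerve_coproduct (p_ : forall i, pshom (y_ (X i)) F) :
  exists p : pshom (y_ P) F, forall i, ps_comp p (nerve_post u (i_ i)) = p_ i.
Proof.
pose ev (A : sobj a) (s : seq {i : I & hom (u A) (X i)}) : pval F A :=
  \sum_(p <- s) papp (p_ (projT1 p)) A (projT2 p).
pose sm (A : sobj a) (s : seq {i : I & hom (u A) (X i)}) : hom (u A) P :=
  \sum_(p <- s) i_ (projT1 p) \oc projT2 p.
have [pr [pii pij]] := coproduct_proj iP.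
(* The sum of the values only depends on the sum of the arguments: it is read
   off the components of the latter, over any list [r] of indices containing
   those that occur. *)
have evE A (r : seq {classic I}) s : uniq r ->
    all (fun p : {i : I & hom (u A) (X i)} => (projT1 p : {classic I}) \in r) s ->
    ev A s = \sum_(i <- r) papp (p_ i) A (pr i \oc sm A s).
  move=> ur; elim: s => [_|[i d] s IH /= /andP[ir /IH e]].
    by rewrite /ev /sm !big_nil big1 // => i _; rewrite comp0r linear0.
  rewrite /ev /sm !big_cons -/(ev A s) -/(sm A s) e /=.
  under [RHS]eq_bigr => j _ do rewrite compDr linearD.
  rewrite big_split /=; congr (_ + _).
  rewrite (bigD1_seq (i : {classic I})) //= compA pii comp1l.
  rewrite big1 ?addr0 // => j /eqP ji; rewrite compA pij ?comp0l ?linear0 //.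
  by move=> ij; apply: ji.
have ev0 A s : sm A s = 0 -> ev A s = 0.
  pose f (p : {i : I & hom (u A) (X i)}) : {classic I} := projT1 p.
  have sub : all [in undup [seq f p | p <- s]] [seq f p | p <- s].
    by apply/allP => x; rewrite mem_undup.
  rewrite all_map in sub.
  move=> s0; rewrite (evE A _ s (undup_uniq [seq f p | p <- s]) sub).
  by rewrite s0 big1 // => i _; rewrite comp0r linear0.
have [||||p pP] := @extend_relation k a T F shF (y_ P)
  (fun A c z => exists2 s, c = sm A s & z = ev A s).
- move=> A c _ _ _ _ [s -> ->] [t -> ->].
  exists ([seq existT (fun i => hom (u A) (X i) : Type) (projT1 p) (c *: projT2 p) | p <- s] ++ t).
  + rewrite /sm big_cat big_map scaler_sumr; congr (_ + _); apply: eq_bigr => p _ /=.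
    by rewrite compZr.
  + rewrite /ev big_cat big_map scaler_sumr; congr (_ + _); apply: eq_bigr => p _ /=.
    by rewrite linearZ_LR.
- move=> A A' f _ _ [s -> ->].
  exists [seq existT (fun i => hom (u A') (X i) : Type) (projT1 p) (projT2 p \oc fmap u f) | p <- s].
  + rewrite nerve_resE comp_suml /sm big_map; apply: eq_bigr => p _ /=; by rewrite compA.
  + rewrite /ev linear_sum big_map; apply: eq_bigr => p _.
    exact: esym (pnat (p_ (projT1 p)) f (projT2 p)).
- by move=> A z [s /esym/ev0 e ->].
- move=> A c; exists (transporter (finite_sub i_) c); first exact: finite_locally.
  by move=> A' f [s sE]; exists (ev A' s); exists s.
exists p => i; apply: pshom_ext => A d /=; apply: pP.
by exists [:: existT _ i d]; rewrite ?/sm ?/ev big_seq1.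
Qed.
End Coproducts.

Section Cokernels.
Context (F : presheaf a) (shF : is_sheaf T F).

Lemma nerve_epi_ext (Y X : C) (q : hom Y X) (f g : pshom (y_ X) F) : epi q ->
  ps_comp f (nerve_post u q) = ps_comp g (nerve_post u q) -> f = g.
Proof.
move=> eq fg; apply: (@pshom_local_eq k a T F shF _ (image_sub (nerve_post u q)) f g
  (fun A c => lift_epi_locally (c : hom (u A) X) eq)) => A _ [d <-].
exact: (congr1 (fun h : pshom (y_ Y) F => papp h A d) fg).
Qed.

(** A map killed by [q] factors through the kernel of [q], onto which [r] is epi,
    so locally it lifts along [r]. *)
Lemma nerve_cokernel (Z Y X : C) (r : hom Z Y) (q : hom Y X) (f : pshom (y_ Y) F) :
  is_cokernel q r -> ps_comp f (nerve_post u r) = 0 ->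
  exists g : pshom (y_ X) F, ps_comp g (nerve_post u q) = f.
Proof.
move=> cq fr; have eq := cokernel_epi cq.
have [K [i ki]] := ab_kernels abC q.
have [e [ie _]] := ki.2 _ _ cq.1.
have ee := image_epi abC cq ki ie.
have fi A (d : hom (u A) K) : papp f A (i \oc d) = 0.
  have h : ps_comp f (nerve_post u i) = 0.
    apply: (nerve_epi_ext ee); apply: pshom_ext => B x /=.
    rewrite compA ie; exact: (congr1 (fun h : pshom (y_ Z) F => papp h B x) fr).
  exact: (congr1 (fun h : pshom (y_ K) F => papp h A d) h).
have [||||g gP] := @extend_relation k a T F shF (y_ X)
  (fun A c z => exists2 d : hom (u A) Y, c = q \oc d & z = papp f A d).
- move=> A c _ _ _ _ [d -> ->] [d' -> ->]; exists (c *: d + d').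
  + by rewrite comp_linr.
  + by rewrite linearP.
- move=> A A' h _ _ [d -> ->]; exists (d \oc fmap u h).
  + by rewrite nerve_resE compA.
  + exact: esym (pnat f h d).
- move=> A z [d /esym qd ->]; have [d' [<- _]] := ki.2 _ _ qd; exact: fi.
- move=> A c; exists (transporter (image_sub (nerve_post u q)) c).
    exact: lift_epi_locally.
  by move=> A' h [d dE]; exists (papp f A' d); exists d.
by exists g; apply: pshom_ext => A d /=; apply: gP; exists d.
Qed.
End Cokernels.

Section Colimits.
Context (F : presheaf a) (shF : is_sheaf T F).
Context (J : icat) (D : diagram J C) (L : cocone D) (cL : is_colimit L).

(** A colimit is the cokernel of a map between coproducts. *)
Lemma nerve_colimit (p_ : forall j, pshom (y_ (D j)) F) :
  (forall i j (e : @imor J i j), ps_comp (p_ j) (nerve_post u (dmap D e)) = p_ i) ->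
  exists p : pshom (y_ (apex L)) F,
    (forall j, ps_comp p (nerve_post u (leg L j)) = p_ j) /\
    (forall q : pshom (y_ (apex L)) F,
       (forall j, ps_comp q (nerve_post u (leg L j)) = p_ j) -> p = q).
Proof.
move=> pP; have cC := gr_cocomplete grC.
have [P [i_ iP]] := coproduct_exists cC (fun j => D j).
have [S [s_ sP]] := coproduct_exists cC (fun e : arrows J => D (projT1 e).1).
have [q [qP _]] := iP _ (leg L).
have [r [rP _]] := sP P (fun e => i_ (projT1 e).1 - i_ (projT1 e).2 \oc dmap D (projT2 e)).
have cq : is_cokernel q r.
  split.
    apply: (coproduct_ext sP) => e; rewrite -compA rP compBr compA !qP comp0l.
    by rewrite leg_nat subrr.
  move=> W g gr.
  have ng i j (e : @imor J i j) : (g \oc i_ j) \oc dmap D e = g \oc i_ i.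
    have := congr1 (fun h => h \oc s_ (existT (fun p => imor p.1 p.2) (i, j) e)) gr.
    rewrite -compA rP comp0l compBr compA /= => /eqP.
    by rewrite subr_eq0 => /eqP ->.
  have [h [hP hu']] := cL (@Cocone k J C D W _ ng).
  exists h; split.
    by apply: (coproduct_ext iP) => j; rewrite -compA qP hP.
  by move=> h' h'q; apply: hu' => j; rewrite -qP compA h'q.
have [f fP] := nerve_coproduct shF iP p_.
have fr : ps_comp f (nerve_post u r) = 0.
  apply: (nerve_coproduct_ext shF sP) => -[[i j] e]; apply: pshom_ext => A d /=.
  rewrite (compA r) (rP (existT (fun p => imor p.1 p.2) (i, j) e)) /= compBl linearB /=.
  have e1 := congr1 (fun h : pshom (y_ (D i)) F => papp h A d) (fP i).
  have e2 := congr1 (fun h : pshom (y_ (D j)) F => papp h A (dmap D e \oc d)) (fP j).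
  have e3 := congr1 (fun h : pshom (y_ (D i)) F => papp h A d) (pP i j e).
  by move: e1 e2 e3 => /= e1 e2 e3; rewrite -compA e1 e2 e3 subrr.
have [p pf] := nerve_cokernel shF cq fr.
exists p; split=> [j | p' p'P].
  rewrite -fP -pf; apply: pshom_ext => A d /=; by rewrite compA qP.
apply: (nerve_epi_ext shF (cokernel_epi cq)); rewrite pf.
apply: (nerve_coproduct_ext shF iP) => j; rewrite fP -(p'P j).
by apply: pshom_ext => A d /=; rewrite compA qP.
Qed.
End Colimits.

(** ** The nerve is dense *)

(** A matching family on [R] is a map out of the
    coproduct of the [u A'] over [R]; it descends along the epimorphism onto
    [u A] because locally, by (F) and (FF), every relation between the [u f]
    comes from a relation in [R]. *)
Lemma nerve_is_sheaf (Z : C) : is_sheaf T (y_ Z).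
Proof.
move=> A R TR s.
pose I : small := {A' : sobj a & submod (sv R A')}.
pose X (p : I) : C := u (projT1 p).
pose s_ (p : I) : hom (X p) Z := papp s (projT1 p) (projT2 p).
have [P [i_ iP]] := coproduct_exists (gr_cocomplete grC) X.
have [q [qP _]] := iP _ (fun p : I => fmap u (sval (projT2 p)) : hom (X p) (u (A : a))).
have eq : epi q.
  move=> W g h gh; apply: (lc_cover_epi TR) => A' f Rf.
  by have /= e := qP (existT _ A' (Submod Rf)); rewrite -e !compA gh.
have [h [hP _]] := iP _ s_.
pose gen B (l : seq {p : I & @hom _ a B (projT1 p)}) : hom (u B) P :=
  \sum_(x <- l) i_ (projT1 x) \oc fmap u (projT2 x).
have gen0 B : exists l, (0 : pval (y_ P) B) = gen B l.
  by exists [::]; rewrite /gen big_nil.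
have genP B c (x y : pval (y_ P) B) : (exists l, x = gen B l) -> (exists l, y = gen B l) ->
    exists l, c *: x + y = gen B l.
  move=> [l ->] [l' ->].
  exists ([seq existT (fun p : I => @hom _ a B (projT1 p) : Type) (projT1 x) (c *: projT2 x) | x <- l] ++ l').
  rewrite /gen big_cat big_map scaler_sumr; congr (_ + _); apply: eq_bigr => p _ /=.
  have -> : c *: projT2 p = c *: projT2 p + 0 by rewrite addr0.
  by rewrite fmap_lin fmap0 addr0 compZr.
have genM (B B' : a) (f : hom B' B) (x : pval (y_ P) B) : (exists l, x = gen B l) ->
    exists l, pres (y_ P) f x = gen B' l.
  move=> [l ->].
  exists [seq existT (fun p : I => @hom _ a B' (projT1 p) : Type) (projT1 x) (projT2 x \oc f) | x <- l].
  rewrite nerve_resE /gen comp_suml big_map; apply: eq_bigr => p _ /=.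
  by rewrite fmapM compA.
pose N : subpresheaf (y_ P) := @Subpresheaf k a (y_ P) (fun B => @Submodule k (pval (y_ P) B)
  (fun c => exists l, c = gen B l) (gen0 B) (genP B)) genM.
have locN (B : a) (c : hom (u B) P) : locally T N (c : pval (y_ P) B).
  apply: (locally_trans _ (finite_locally iP c)) => {c}B c [l ->].
  elim: l => [|[p d] l IH]; first by rewrite big_nil; apply: (smem0 (closure T N B)).
  rewrite big_cons; apply: (smemD (S := closure T N B)) => //.
  apply: (tcov_up (full_locally d)) => B' f [g gE].
  exists [:: existT (fun p : I => @hom _ a B' (projT1 p) : Type) p g].
  by rewrite /gen big_seq1 nerve_resE /= -gE nerve_resE compA.
have hker B (c : hom (u B) P) : q \oc c = 0 -> h \oc c = 0.
  move=> qc; apply: (@nerve_separated Z B (h \oc c)); apply: (locally_cover (locN B c)).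
  move=> B' f [l lE].
  pose y (x : {p : I & @hom _ a B' (projT1 p)}) : submod (sv R B') :=
    sv_act R (projT2 x) (projT2 (projT1 x)).
  have qy : fmap u (sval (\sum_(x <- l) y x)) = q \oc gen B' l.
    rewrite -[sval _]/(submod_incl (sv R B') _) linear_sum fmap_sum /gen comp_sumr.
    by apply: eq_bigr => x _; rewrite /= fmapM compA qP.
  have sy : papp s B' (\sum_(x <- l) y x) = h \oc gen B' l.
    rewrite linear_sum /gen comp_sumr; apply: eq_bigr => x _.
    rewrite compA hP; exact: (pnat s (projT2 x) (projT2 (projT1 x))).
  have y0 : fmap u (sval (\sum_(x <- l) y x)) = 0.
    by rewrite qy -lE nerve_resE compA qc comp0l.
  apply: (tcov_up (faithful_locally y0)) => B'' g /= yg.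
  rewrite -(compA h) -[c \oc fmap u f]/(pres (y_ P) f c) lE -sy.
  rewrite -[LHS]/(pres (y_ Z) g (papp s B' (\sum_(x <- l) y x))) -pnat.
  rewrite -[RHS](linear0 (papp s B'')); congr (papp s B'' _).
  by apply: submod_ext; rewrite -[RHS]yg.
have [K [i ki]] := ab_kernels abC q.
have hi : h \oc i = 0.
  have [J [B [b jb]]] := lc_G hu K; apply: jb => j; rewrite comp0l -compA.
  by apply: hker; rewrite compA ki.1 comp0l.
have [x [xP xq]] := (epi_cokernel abC eq ki).2 _ _ hi.
exists x; split=> [A' f | x' x'P].
  have e1 := hP (existT _ A' f); have e2 := qP (existT _ A' f).
  by rewrite nerve_resE -[fmap u _]e2 compA xP -[LHS]e1.
apply: xq; apply: (coproduct_ext iP) => -[A' f]; rewrite -compA qP hP.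
by rewrite -[RHS]/(papp s A' f) (x'P A' f).
Qed.

Section SieveCocone.
Context (A : sobj a) (R : sieve A).
Fact sieve_cocone_lin (A' : sobj a) :
  linear (fun f : pval (sieve_presheaf R) A' => fmap u (sval f) : pval (y_ (u (A : a))) A').
Proof. by move=> c f g; rewrite -[sval _]/(c *: sval f + sval g) fmap_lin. Qed.
Fact sieve_cocone_nat (A' A'' : a) (h : hom A'' A') (f : pval (sieve_presheaf R) A') :
  mklinear (@sieve_cocone_lin A'') (pres (sieve_presheaf R) h f) =
  pres (y_ (u (A : a))) h (mklinear (@sieve_cocone_lin A') f).
Proof. by rewrite nerve_resE /= -fmapM. Qed.
Definition sieve_cocone : pshom (sieve_presheaf R) (y_ (u (A : a))) :=
  @Pshom _ _ (sieve_presheaf R) (y_ (u (A : a))) (fun A' => mklinear (@sieve_cocone_lin A'))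
    sieve_cocone_nat.
End SieveCocone.

(** The sheaf property of all nerves at once, in a form that cocontinuous functors
    preserve. *)
Lemma sieve_wcolim (A : sobj a) (R : sieve A) : T A R -> is_wcolim (sieve_cocone R).
Proof.
move=> TR Z d; have [x [xP xq]] := nerve_is_sheaf TR d.
exists x; split=> [A' f | x' x'P]; first by rewrite [RHS]xP nerve_resE.
by apply: xq => A' f; rewrite -x'P nerve_resE.
Qed.

(** Full faithfulness of the nerve: [X] is a quotient of a coproduct of objects
    [u A] by relations that are tested on objects [u B], and a map between nerves
    is compatible with both. *)
Lemma nerve_wcolim (X : C) : is_wcolim (ps_id (y_ X)).
Proof.
move=> Z d; have cC := gr_cocomplete grC.
have [I [A [c jc]]] := lc_G hu X.
have [P [i_ iP]] := coproduct_exists cC (fun i => u (A i)).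
have [q [qP _]] := iP _ c.
have eq : epi q by move=> W g h gh; apply: jc => i; rewrite -qP !compA gh.
have [K [i ki]] := ab_kernels abC q.
have [h [hP _]] := iP _ (fun i => papp d (A i) (c i)).
have dq : ps_comp d (nerve_post u q) = nerve_post u h.
  apply: (nerve_coproduct_ext (@nerve_is_sheaf Z) iP) => j.
  apply: (nerve_rep_ext (@nerve_is_sheaf Z)).
  by rewrite /= !comp1r qP hP.
have hi : h \oc i = 0.
  have [J [B [b jb]]] := lc_G hu K; apply: jb => j; rewrite comp0l -compA.
  have := congr1 (fun f : pshom (y_ P) (y_ Z) => papp f (B j) (i \oc b j)) dq.
  by move=> /= <-; rewrite compA ki.1 comp0l linear0.
have [x [xP xq]] := (epi_cokernel abC eq ki).2 _ _ hi.
exists x; split=> [B m | x' x'P].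
  suff -> : d = nerve_post u x by [].
  apply: (nerve_epi_ext (@nerve_is_sheaf Z) eq); rewrite dq.
  by apply: pshom_ext => A' e /=; rewrite compA xP.
apply: xq; apply: (coproduct_ext iP) => j; rewrite -compA qP hP.
exact: x'P.
Qed.
End LCFacts.

(** * Sheaves on a tensor product of sites *)

Section TensorCategory.
Context (k : comPzRingType) (a b : slcat k).
Local Notation ab := (tensor_cat a b).

Definition tpure (P Q : ab) (f : hom (P.1 : a) Q.1) (g : hom (P.2 : b) Q.2) : hom P Q :=
  tens f g.
Lemma tpure1 (P : ab) : tpure (idm (P.1 : a)) (idm (P.2 : b)) = idm P.
Proof. by []. Qed.
Lemma tpureM (P Q S : ab) (g : hom (Q.1 : a) S.1) (g' : hom (Q.2 : b) S.2)
    (f : hom (P.1 : a) Q.1) (f' : hom (P.2 : b) Q.2) :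
  tpure g g' \oc tpure f f' = tpure (g \oc f) (g' \oc f') :> hom P S.
Proof. exact: tc_compE. Qed.
Lemma tpure_linl (P Q : ab) (g : hom (P.2 : b) Q.2) :
  linear (fun f : hom (P.1 : a) Q.1 => tpure f g : hom P Q).
Proof. exact: (tens_bilin _ _).1. Qed.
Lemma tpure_linr (P Q : ab) (f : hom (P.1 : a) Q.1) :
  linear (fun g : hom (P.2 : b) Q.2 => tpure f g : hom P Q).
Proof. exact: (tens_bilin _ _).2. Qed.
Lemma tpure_sum (P Q : ab) (z : hom P Q) :
  exists s : seq (hom (P.1 : a) Q.1 * hom (P.2 : b) Q.2),
    z = \sum_(p <- s) tpure p.1 p.2.
Proof. by exists (repr (z : tensor _ _)); apply: tens_sum. Qed.

(** Elementary tensors span the Hom-modules, so functoriality needs to be checked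
    on them only. *)
Section TensorFunctor.
Context (E : lcat k) (o : sobj a * sobj b -> E)
  (m : forall P Q : sobj a * sobj b, hom (P.1 : a) Q.1 -> hom (P.2 : b) Q.2 -> hom (o P) (o Q)).
Hypothesis m_bilin : forall P Q, bilin (@m P Q).
Hypothesis m1 : forall P, m (idm (P.1 : a)) (idm (P.2 : b)) = idm (o P).
Hypothesis mM : forall P Q S (g : hom (Q.1 : a) S.1) (g' : hom (Q.2 : b) S.2)
  (f : hom (P.1 : a) Q.1) (f' : hom (P.2 : b) Q.2),
  m (g \oc f) (g' \oc f') = m g g' \oc m f f'.
Let mp (P Q : ab) : {linear hom P Q -> hom (o P) (o Q)} :=
  mklinear (tens_lift_linear (m_bilin P Q)).
Lemma tfunE (P Q : ab) (f : hom (P.1 : a) Q.1) (g : hom (P.2 : b) Q.2) :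
  mp P Q (tpure f g) = m f g.
Proof. exact: (tens_liftE _ _ (m_bilin P Q)). Qed.
Fact tfun1 (P : ab) : mp P P (idm P) = idm (o P).
Proof. by rewrite -tpure1 tfunE m1. Qed.
Fact tfunM (P Q S : ab) (y : hom Q S) (x : hom P Q) :
  mp P S (y \oc x) = mp Q S y \oc mp P Q x.
Proof.
have [s ->] := tpure_sum y; have [t ->] := tpure_sum x.
rewrite comp_suml !linear_sum comp_suml; apply: eq_bigr => p _.
rewrite comp_sumr !linear_sum comp_sumr; apply: eq_bigr => q _.
by rewrite tpureM !tfunE mM.
Qed.
Definition tensor_functor : lfunctor (lcat_of_slcat ab) E :=
  @Lfunctor k (lcat_of_slcat ab) E o (fun P Q x => mp P Q x)
    (fun P Q => @linearP k _ _ _ (mp P Q)) tfun1 tfunM.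
Lemma tensor_functorE (P Q : ab) (f : hom (P.1 : a) Q.1) (g : hom (P.2 : b) Q.2) :
  fmap tensor_functor (tpure f g : hom P Q) = m f g.
Proof. exact: tfunE. Qed.
End TensorFunctor.

Section OpFunctor.
Context (s : slcat k) (E : lcat k) (F : lfunctor (lcat_of_slcat s) (opcat E)).
Definition op_functor : lfunctor (opcat s) E :=
  @Lfunctor k (opcat s) E F (fun X Y f => @fmap k s (opcat E) F Y X f)
    (fun X Y => @fmap_lin k s (opcat E) F Y X) (fun X => @fmap1 k s (opcat E) F X)
    (fun X Y Z g f => @fmapM k s (opcat E) F Z Y X f g).
End OpFunctor.

(** The external tensor product of presheaves, seen as a functor to the opposite of
    the category of modules. *)
Section ExternalTensor.
Context (M : presheaf a) (N : presheaf b).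
Let o (P : sobj a * sobj b) : opcat (Modk k) := tensor (pval M P.1) (pval N P.2).
Let m (P Q : sobj a * sobj b) (f : hom (P.1 : a) Q.1) (g : hom (P.2 : b) Q.2) :
  @hom k (opcat (Modk k)) (o P) (o Q) := tens_map (pres M f) (pres N g).
Fact ext_bilin (P Q : sobj a * sobj b) : bilin (@m P Q).
Proof.
split=> [g c f f' | f c g g']; apply: linear_ext; apply: tens_lin_ext => x y;
  rewrite lin_linE !tens_mapE pres_lin.
- exact: (tens_bilin _ _).1.
- exact: (tens_bilin _ _).2.
Qed.
Fact ext_1 (P : sobj a * sobj b) : m (idm (P.1 : a)) (idm (P.2 : b)) = idm (o P).
Proof.
apply: linear_ext; apply: (@tens_lin_ext _ _ _ _ _ (lin_id _)) => x y.
by rewrite tens_mapE !pres1.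
Qed.
Fact ext_M P Q S (g : hom (Q.1 : a) S.1) (g' : hom (Q.2 : b) S.2)
  (f : hom (P.1 : a) Q.1) (f' : hom (P.2 : b) Q.2) :
  m (g \oc f) (g' \oc f') = m g g' \oc m f f'.
Proof.
apply: linear_ext; apply: (@tens_lin_ext _ _ _ _ _ (lin_comp (m f f') (m g g'))) => x y.
transitivity (m f f' (m g g' (tens x y))) => //.
by rewrite /m !tens_mapE !presM.
Qed.
Definition ext_tensor : presheaf ab := op_functor (tensor_functor ext_bilin ext_1 ext_M).
Definition ext_tens (P : sobj ab) (x : pval M P.1) (y : pval N P.2) : pval ext_tensor P := tens x y.
Lemma ext_tens_res (P Q : ab) (f : hom (P.1 : a) Q.1) (g : hom (P.2 : b) Q.2)
    (x : pval M Q.1) (y : pval N Q.2) :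
  pres ext_tensor (tpure f g : hom P Q) (ext_tens x y) = ext_tens (pres M f x) (pres N g y).
Proof.
transitivity (m f g (tens x y)); last exact: tens_mapE.
exact: (congr1 (fun h : {linear _ -> _} => h (tens x y)) (tfunE ext_bilin f g)).
Qed.
End ExternalTensor.

Section Slices.
Context (F : presheaf ab).
Section Left.
Context (B : sobj b).
Let res (A A' : a) (f : hom A' A) : {linear pval F (A, B) -> pval F (A', B)} :=
  pres F (tpure (P := (A', B)) (Q := (A, B)) f (idm (B : b))).
Fact slice_l_lin (A A' : opcat a) : linear (fun f : hom A A' => @res A A' f
   : @hom _ (Modk k) (pval F (A, B)) (pval F (A', B))).
Proof.
move=> c f g; apply: linear_ext => x; rewrite /res lin_linE -pres_lin.
by congr (pres F _ x); apply: (@tpure_linl (A', B) (A, B)).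
Qed.
Fact slice_l_1 (A : opcat a) : @res A A (idm A) = lin_id (pval F (A, B)).
Proof. apply: linear_ext => x; exact: (pres1 (F := F) (A := (A, B)) x). Qed.
Fact slice_l_M (A A' A'' : opcat a) (g : hom A' A'') (f : hom A A') :
  @res A A'' (g \oc f) = lin_comp (@res A' A'' g) (@res A A' f).
Proof.
apply: linear_ext => x; rewrite /res /= -presM tpureM; congr (pres F _ x).
by rewrite comp1l.
Qed.
Definition slice_l : presheaf a :=
  @Lfunctor k (opcat a) (Modk k) (fun A => pval F (A, B)) res slice_l_lin slice_l_1 slice_l_M.
Lemma slice_l_resE (A A' : a) (f : hom A' A) (x : pval F (A, B)) :
  pres slice_l f x = pres F (tpure (P := (A', B)) (Q := (A, B)) f (idm (B : b))) x.
Proof. by []. Qed.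
End Left.
Section Right.
Context (A : sobj a).
Let res (B B' : b) (g : hom B' B) : {linear pval F (A, B) -> pval F (A, B')} :=
  pres F (tpure (P := (A, B')) (Q := (A, B)) (idm (A : a)) g).
Fact slice_r_lin (B B' : opcat b) : linear (fun g : hom B B' => @res B B' g
   : @hom _ (Modk k) (pval F (A, B)) (pval F (A, B'))).
Proof.
move=> c f g; apply: linear_ext => x; rewrite /res lin_linE -pres_lin.
by congr (pres F _ x); apply: (@tpure_linr (A, B') (A, B)).
Qed.
Fact slice_r_1 (B : opcat b) : @res B B (idm B) = lin_id (pval F (A, B)).
Proof. apply: linear_ext => x; exact: (pres1 (F := F) (A := (A, B)) x). Qed.
Fact slice_r_M (B B' B'' : opcat b) (g : hom B' B'') (f : hom B B') :
  @res B B'' (g \oc f) = lin_comp (@res B' B'' g) (@res B B' f).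
Proof.
apply: linear_ext => x; rewrite /res /= -presM tpureM; congr (pres F _ x).
by rewrite comp1l.
Qed.
Definition slice_r : presheaf b :=
  @Lfunctor k (opcat b) (Modk k) (fun B => pval F (A, B)) res slice_r_lin slice_r_1 slice_r_M.
Lemma slice_r_resE (B B' : b) (g : hom B' B) (x : pval F (A, B)) :
  pres slice_r g x = pres F (tpure (P := (A, B')) (Q := (A, B)) (idm (A : a)) g) x.
Proof. by []. Qed.
End Right.
Lemma slices_res (A A' : a) (B B' : b) (f : hom A' A) (g : hom B' B) (x : pval F (A, B)) :
  pres F (tpure (P := (A', B')) (Q := (A, B)) f g) x =
  pres (slice_l B') f (pres (slice_r A) g x).
Proof. by rewrite slice_l_resE slice_r_resE -presM tpureM comp1l comp1r. Qed.
Lemma slices_res' (A A' : a) (B B' : b) (f : hom A' A) (g : hom B' B) (x : pval F (A, B)) :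
  pres F (tpure (P := (A', B')) (Q := (A, B)) f g) x =
  pres (slice_r A') g (pres (slice_l B) f x).
Proof. by rewrite slice_l_resE slice_r_resE -presM tpureM comp1l comp1r. Qed.
Fact slice_l_map_nat (B B' : b) (g : hom B' B) (A A' : a) (f : hom A' A) (x : pval (slice_l B) A) :
  pres (slice_r A') g (pres (slice_l B) f x) = pres (slice_l B') f (pres (slice_r A) g x).
Proof. by rewrite -slices_res slices_res'. Qed.
Definition slice_l_map (B B' : b) (g : hom B' B) : pshom (slice_l B) (slice_l B') :=
  @Pshom _ _ (slice_l B) (slice_l B') (fun A => pres (slice_r A) g) (@slice_l_map_nat B B' g).
Fact slice_r_map_nat (A A' : a) (f : hom A' A) (B B' : b) (g : hom B' B) (x : pval (slice_r A) B) :
  pres (slice_l B') f (pres (slice_r A) g x) = pres (slice_r A') g (pres (slice_l B) f x).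
Proof. by rewrite -slices_res slices_res'. Qed.
Definition slice_r_map (A A' : a) (f : hom A' A) : pshom (slice_r A) (slice_r A') :=
  @Pshom _ _ (slice_r A) (slice_r A') (fun B => pres (slice_l B) f) (@slice_r_map_nat A A' f).
End Slices.

Lemma tensor_pshom (F G : presheaf ab) (f : forall P, {linear pval F P -> pval G P}) :
  (forall (P Q : ab) (x : hom (P.1 : a) Q.1) (y : hom (P.2 : b) Q.2) (z : pval F Q),
     f P (pres F (tpure x y) z) = pres G (tpure x y) (f Q z)) ->
  exists p : pshom F G, forall P z, papp p P z = f P z.
Proof.
move=> H.
have nat (Q P : ab) (x : hom P Q) (z : pval F Q) : f P (pres F x z) = pres G x (f Q z).
  have [s ->] := tpure_sum x; rewrite !pres_suml linear_sum; apply: eq_bigr => p _.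
  exact: H.
by exists (@Pshom _ _ F G f nat).
Qed.

Lemma ext_tensor_ext (F : presheaf ab) (M : presheaf a) (N : presheaf b)
    (p q : pshom (ext_tensor M N) F) :
  (forall P x y, papp p P (ext_tens x y) = papp q P (ext_tens x y)) -> p = q.
Proof.
move=> pq; apply: pshom_ext => P; apply: (@tens_lin_ext _ _ _ _ (papp p P) (papp q P)).
exact: pq.
Qed.

Lemma ext_tensor_univ (F : presheaf ab) (M : presheaf a) (N : presheaf b)
    (m : forall P, pval M P.1 -> pval N P.2 -> pval F P) :
  (forall P, bilin (m P)) ->
  (forall (P Q : ab) (f : hom (P.1 : a) Q.1) (g : hom (P.2 : b) Q.2) x y,
     m P (pres M f x) (pres N g y) = pres F (tpure f g : hom P Q) (m Q x y)) ->
  exists p : pshom (ext_tensor M N) F, forall P x y, papp p P (ext_tens x y) = m P x y.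
Proof.
move=> mb mn.
pose f P : {linear pval (ext_tensor M N) P -> pval F P} := mklinear (tens_lift_linear (mb P)).
have fE P x y : f P (ext_tens x y) = m P x y by exact: (tens_liftE _ _ (mb P)).
have [P Q x y z|p pP] := @tensor_pshom (ext_tensor M N) F f.
  apply: (@tens_lin_ext _ _ _ _
    (lin_comp (f P) (pres (ext_tensor M N) (tpure x y : hom P Q)))
    (lin_comp (pres F (tpure x y : hom P Q)) (f Q))) => v w.
  transitivity (f P (pres (ext_tensor M N) (tpure x y : hom P Q) (ext_tens v w))) => //.
  by rewrite ext_tens_res fE mn -fE.
by exists p => P x y; rewrite pP fE.
Qed.
End TensorCategory.

Section ClosedTopology.
Context (k : comPzRingType) (s : slcat k) (M : presheaf s) (N : subpresheaf M).

(** The largest topology for which [N] is closed in [M]. *)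
Definition closed_cov (P : sobj s) (W : sieve P) : Prop :=
  forall (Q : sobj s) (h : hom (Q : s) P) (x : pval M Q),
  (forall (X : sobj s) (f : hom (X : s) Q), sv W X (h \oc f) -> N X (pres M f x)) -> N Q x.
Fact closed_max P : closed_cov (max_sieve P).
Proof. by move=> Q h x H; rewrite -[x]pres1; apply: H. Qed.
Fact closed_pull P (W : sieve P) : closed_cov W ->
  forall (Q : s) (f : hom Q (P : s)), closed_cov (pullback_sieve f W).
Proof.
move=> cW Q f X h x H; apply: (cW X (f \oc h)) => Y g Wg.
by apply: H => /=; rewrite compA.
Qed.
Fact closed_glue P (W V : sieve P) : closed_cov W ->
  (forall (Q : s) (f : hom Q (P : s)), sv W Q f -> closed_cov (pullback_sieve f V)) ->
  closed_cov V.
Proof.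
move=> cW H Q h x Hx; apply: (cW Q h) => X f Wf.
apply: (H X _ Wf X (idm (X : s))) => Y g /=; rewrite comp1l => Vg.
by rewrite -presM; apply: Hx; rewrite compA.
Qed.
Definition closed_topology : topology s := Topology closed_max closed_pull closed_glue.
End ClosedTopology.

Lemma sheaf_of_bijective (k : comPzRingType) (s : slcat k) (T : topology s)
    (F G : presheaf s) (e : pshom F G) :
  (forall P x, papp e P x = 0 -> x = 0) -> (forall P y, exists x, papp e P x = y) ->
  is_sheaf T G -> is_sheaf T F.
Proof.
move=> ei es shG A R TR p.
have inj P x y : papp e P x = papp e P y -> x = y.
  move=> xy; apply/eqP; rewrite -subr_eq0; apply/eqP/ei.
  by rewrite linearB xy subrr.
have [y [yP yu]] := shG A R TR (ps_comp e p).
have [x xy] := es A y; exists x; split=> [A' f | x' x'P].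
  by apply: inj; rewrite pnat xy -yP.
by apply: inj; rewrite xy; apply: yu => A' f; rewrite -pnat -x'P.
Qed.

Section TensorTopology.
Context (k : comPzRingType) (a b : slcat k) (Ta : topology a) (Tb : topology b).
Local Notation ab := (tensor_cat a b).
Local Notation Tab := (tensor_topology Ta Tb).

Lemma tensor_sieve_pure (A : sobj a) (B : sobj b) (R : sieve A) (S : sieve B) (P : ab)
    (f : hom (P.1 : a) A) (g : hom (P.2 : b) B) : sv R P.1 f -> sv S P.2 g ->
  sv (tensor_sieve R S) P (tpure (Q := (A, B)) f g).
Proof. by move=> Rf Sg; exists (tens (Submod Rf) (Submod Sg)); rewrite /ts_map tens_mapE. Qed.

Lemma tensor_sieve_sum (A : sobj a) (B : sobj b) (R : sieve A) (S : sieve B) (P : ab)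
    (z : hom P ((A, B) : ab)) : sv (tensor_sieve R S) P z ->
  exists l : seq (submod (sv R P.1) * submod (sv S P.2)),
    z = \sum_(p <- l) tpure (P := P) (Q := (A, B)) (sval p.1) (sval p.2).
Proof.
case=> t <-; exists (repr t); rewrite {1}[t]tens_sum linear_sum.
by apply: eq_bigr => p _; rewrite /ts_map tens_mapE.
Qed.

Lemma tensor_cover_l (A : sobj a) (B : sobj b) (R : sieve A) : Ta A R ->
  Tab (A, B) (tensor_sieve R (max_sieve B)).
Proof. by move=> TR T [HT _]; apply: HT. Qed.
Lemma tensor_cover_r (A : sobj a) (B : sobj b) (S : sieve B) : Tb B S ->
  Tab (A, B) (tensor_sieve (max_sieve A) S).
Proof. by move=> TS T [_ HT]; apply: HT. Qed.

(** Finitely many coverings have a common refinement, so the generating coverings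
    can be pulled back along sums of elementary tensors. *)
Lemma pull_cover_l (A : sobj a) (B : sobj b) (R : sieve A) (Q : ab)
    (h : hom Q ((A, B) : ab)) : Ta A R -> exists2 R' : sieve Q.1, Ta Q.1 R' &
  forall (A' : a) (f : hom A' Q.1), sv R' A' f ->
    sv (tensor_sieve R (max_sieve B)) (A', Q.2) (h \oc tpure (P := (A', Q.2)) f (idm (Q.2 : b))).
Proof.
move=> TR; have [l ->] := tpure_sum h.
elim: l => [|[f g] l [R' TR' IH]].
  exists (max_sieve Q.1); first exact: tcov_max.
  by move=> A' f _; rewrite big_nil comp0l; apply: smem0.
exists (sieve_cap (pullback_sieve f R) R'); first by apply: tcov_cap => //; apply: tcov_pull.
move=> A' e [Re R'e]; rewrite big_cons compDl; apply: smemD; last exact: IH.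
by rewrite tpureM; apply: tensor_sieve_pure.
Qed.
Lemma pull_cover_r (A : sobj a) (B : sobj b) (S : sieve B) (Q : ab)
    (h : hom Q ((A, B) : ab)) : Tb B S -> exists2 S' : sieve Q.2, Tb Q.2 S' &
  forall (B' : b) (g : hom B' Q.2), sv S' B' g ->
    sv (tensor_sieve (max_sieve A) S) (Q.1, B') (h \oc tpure (P := (Q.1, B')) (idm (Q.1 : a)) g).
Proof.
move=> TS; have [l ->] := tpure_sum h.
elim: l => [|[f g] l [S' TS' IH]].
  exists (max_sieve Q.2); first exact: tcov_max.
  by move=> B' g _; rewrite big_nil comp0l; apply: smem0.
exists (sieve_cap (pullback_sieve g S) S'); first by apply: tcov_cap => //; apply: tcov_pull.
move=> B' e [Se S'e]; rewrite big_cons compDl; apply: smemD; last exact: IH.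
by rewrite tpureM; apply: tensor_sieve_pure.
Qed.

Lemma closed_contains (M : presheaf ab) (N : subpresheaf M) :
  (forall (A : sobj a) (B : sobj b) (R : sieve A) (x : pval (slice_l M B) A), Ta A R ->
     (forall (A' : a) (f : hom A' (A : a)), sv R A' f -> N (A', B) (pres (slice_l M B) f x)) ->
     N (A, B) x) ->
  (forall (A : sobj a) (B : sobj b) (S : sieve B) (x : pval (slice_r M A) B), Tb B S ->
     (forall (B' : b) (g : hom B' (B : b)), sv S B' g -> N (A, B') (pres (slice_r M A) g x)) ->
     N (A, B) x) ->
  contains_tensor_sieves Ta Tb (closed_topology N).
Proof.
move=> HA HB; split=> A B R TR [A' B'] h x Hx.
- have [R' TR' R'P] := pull_cover_l h TR.
  by apply: (HA _ _ _ _ TR') => A'' f /R'P /Hx.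
- have [R' TR' R'P] := pull_cover_r h TR.
  by apply: (HB _ _ _ _ TR') => A'' f /R'P /Hx.
Qed.

(** Zero is closed for the generating coverings, hence for all. *)
Lemma tensor_separated (F : presheaf ab) :
  (forall B, separated Ta (slice_l F B)) -> (forall A, separated Tb (slice_r F A)) ->
  separated Tab F.
Proof.
move=> sl sr P x Tx.
have HT : contains_tensor_sieves Ta Tb (closed_topology (zero_sub F)).
  apply: closed_contains => A B R y TR H.
  - by apply: (sl B A); apply: (tcov_up TR).
  - by apply: (sr A B); apply: (tcov_up TR).
by apply: (Tx _ HT P (idm (P : ab))) => X f; rewrite comp1l.
Qed.

(** In the sheafification, the elements that come from [F] are closed for the
    generating coverings, hence for all; so there are no others. *)
Lemma tensor_is_sheaf (F : presheaf ab) :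
  (forall B, is_sheaf Ta (slice_l F B)) -> (forall A, is_sheaf Tb (slice_r F A)) ->
  is_sheaf Tab F.
Proof.
move=> sl sr; have [G [e [shG e0 eloc]]] := sheafification_exists Tab F.
have sF : separated Tab F.
  by apply: tensor_separated => X; apply: sheaf_separated.
have ei P x : papp e P x = 0 -> x = 0 by move=> /e0; apply: sF.
have sG : separated Tab G := sheaf_separated shG.
have HT : contains_tensor_sieves Ta Tb (closed_topology (image_sub e)).
  apply: closed_contains => A B R y TR H.
  - have [|A' z|A' c f f' z z'|A' A'' f g z|x xP] := @sheaf_glue _ _ _ _ (sl B) A R
      (fun A' f z => papp e (A', B) z = pres (slice_l G B) f y) TR.
    + by move=> A' f /H[z zP]; exists z.
    + by rewrite pres0 => /ei.
    + by move=> zE zE'; rewrite pres_lin -zE -zE'; apply: linearP.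
    + by move=> zE; rewrite presM -zE slice_l_resE; apply: pnat.
    exists x; apply: (@separated_eq _ _ _ G sG (A, B) _ (papp e (A, B) x) y (@tensor_cover_l A B R TR)) => P z.
    move=> /tensor_sieve_sum[l ->]; rewrite !pres_suml; apply: eq_bigr => p _; move: (p.1) (p.2) => f g {p}.
    case: P {z} l f g => A' B' l f g.
    have [z zE] := H _ _ (svalP f).
    rewrite [LHS]slices_res' [RHS]slices_res' -zE; congr (pres _ _ _).
    by rewrite -(xP _ _ _ (svalP f) zE) [RHS]pnat.
  - have [|A' z|A' c f f' z z'|A' A'' f g z|x xP] := @sheaf_glue _ _ _ _ (sr A) B R
      (fun B' f z => papp e (A, B') z = pres (slice_r G A) f y) TR.
    + by move=> A' f /H[z zP]; exists z.
    + by rewrite pres0 => /ei.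
    + by move=> zE zE'; rewrite pres_lin -zE -zE'; apply: linearP.
    + by move=> zE; rewrite presM -zE slice_r_resE; apply: pnat.
    exists x; apply: (@separated_eq _ _ _ G sG (A, B) _ (papp e (A, B) x) y (@tensor_cover_r A B R TR)) => P z.
    move=> /tensor_sieve_sum[l ->]; rewrite !pres_suml; apply: eq_bigr => p _; move: (p.1) (p.2) => f g {p}.
    case: P {z} l f g => A' B' l f g.
    have [z zE] := H _ _ (svalP g).
    rewrite [LHS]slices_res [RHS]slices_res -zE; congr (pres _ _ _).
    by rewrite -(xP _ _ _ (svalP g) zE) [RHS]pnat.
apply: (sheaf_of_bijective ei _ shG).
move=> P y.
have cl : closed_cov (image_sub e) (transporter (image_sub e) y) := eloc P y _ HT.
by apply: (cl P (idm (P : ab)) y) => X f; rewrite comp1l.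
Qed.
End TensorTopology.

(** [R (x) N] need not embed into [a(-, A) (x) N], yet a bilinear map from [R]
    and [N] to a separated presheaf factors through the image: after
    sheafification it extends to all of [a(-, A)], because each pullback of [R]
    is a covering. *)
Lemma separated_bilinear (k : comPzRingType) (a : slcat k) (T : topology a)
    (Q : presheaf a) (A : sobj a) (R : sieve A) (N : lmodType k)
    (m : forall A' : sobj a, submod (sv R A') -> N -> pval Q A') :
  separated T Q -> T A R -> (forall A', bilin (m A')) ->
  (forall (A' A'' : a) (h : hom A'' A') f n,
     m A'' (sv_act R h f) n = pres Q h (m A' f n)) ->
  forall (A' : sobj a) (l : seq (submod (sv R A') * N)),
  (forall (V : lmodType k) (b : hom (A' : a) (A : a) -> N -> V), bilin b ->
     \sum_(p <- l) b (sval p.1) p.2 = 0) ->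
  \sum_(p <- l) m A' p.1 p.2 = 0.
Proof.
move=> sQ TR mb mn A' l Hl; have [G [e [shG e0 _]]] := sheafification_exists T Q.
have sG := sheaf_separated shG.
have ex (f : hom (A' : a) (A : a)) n : exists y : pval G A',
    forall (A'' : a) (h : hom A'' A') (Rfh : sv R A'' (f \oc h)),
    pres G h y = papp e A'' (m A'' (Submod Rfh) n).
  have [|A'' z|A'' c h h' z z'|A'' X h g z|y yP] := @sheaf_glue _ _ _ _ shG A' (pullback_sieve f R)
    (fun A'' h z => exists Rfh : sv R A'' (f \oc h), z = papp e A'' (m A'' (Submod Rfh) n))
    (tcov_pull TR f).
  - by move=> A'' h Rfh; exists (papp e A'' (m A'' (Submod (Rfh : sv R A'' (f \oc h))) n)), Rfh.
  - move=> [Rf0 ->]; rewrite -[RHS](linear0 (papp e A'')); congr (papp e A'' _).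
    rewrite -[RHS](linear0 (mklinear ((mb A'').1 n))) /=; congr (m A'' _ n).
    by apply: submod_ext; rewrite /= comp0r.
  - move=> [Rh ->] [Rh' ->].
    have Rhh : sv R A'' (f \oc (c *: h + h')) by rewrite comp_linr; apply: smemP.
    exists Rhh; rewrite -linearP -(mb A'').1; congr (papp e A'' (m A'' _ n)).
    by apply: submod_ext; rewrite /= comp_linr.
  - move=> [Rh ->]; have Rhg : sv R X (f \oc (h \oc g)) by rewrite compA; apply: svM.
    exists Rhg; rewrite -pnat -mn; congr (papp e X (m X _ n)).
    by apply: submod_ext; rewrite /= compA.
  by exists y => A'' h Rfh; apply: yP => //; exists Rfh.
pose b f n := projT1 (boolp.cid (ex f n)).
have bP f n (A'' : a) (h : hom A'' A') (Rfh : sv R A'' (f \oc h)) :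
    pres G h (b f n) = papp e A'' (m A'' (Submod Rfh) n).
  exact: (projT2 (boolp.cid (ex f n))).
have bb : bilin b.
  split=> [n c f f' | f c n n'].
  - apply: (separated_eq sG (tcov_cap (tcov_pull TR f) (tcov_pull TR f'))) => A'' h [/= Rf Rf'].
    have Rff : sv R A'' ((c *: f + f') \oc h) by rewrite comp_linl; apply: smemP.
    rewrite linearP (bP _ _ _ _ Rf) (bP _ _ _ _ Rf') (bP _ _ _ _ Rff).
    rewrite -linearP -(mb A'').1; congr (papp e A'' (m A'' _ n)).
    by apply: submod_ext; rewrite /= comp_linl.
  - apply: (separated_eq sG (tcov_pull TR f)) => A'' h /= Rf.
    by rewrite linearP !(bP _ _ _ _ Rf) -linearP (mb A'').2.
have bE f n : b (sval f) n = papp e A' (m A' f n).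
  apply: (separated_eq sG (tcov_pull TR (sval f))) => A'' h /= Rfh.
  rewrite (bP _ _ _ _ Rfh) -pnat -mn; congr (papp e A'' (m A'' _ n)).
  exact: submod_ext.
apply: sQ; apply/e0; rewrite linear_sum -[RHS](Hl _ b bb).
by apply: eq_bigr => p _; rewrite bE.
Qed.

Section TensorSheafSlices.
Context (k : comPzRingType) (a b : slcat k) (Ta : topology a) (Tb : topology b).
Local Notation ab := (tensor_cat a b).
Local Notation Tab := (tensor_topology Ta Tb).
Context (F : presheaf ab) (shF : is_sheaf Tab F).

(** The last hypothesis is needed since [R (x) S] may have elements that vanish in
    the Hom-modules of the tensor category. *)
Lemma tensor_sieve_glue (A : sobj a) (B : sobj b) (R : sieve A) (S : sieve B)
    (m : forall P : sobj ab, submod (sv R P.1) -> submod (sv S P.2) -> pval F P) :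
  Tab (A, B) (tensor_sieve R S) -> (forall P, bilin (m P)) ->
  (forall (P Q : ab) (x : hom (P.1 : a) Q.1) (y : hom (P.2 : b) Q.2) f g,
     m P (sv_act R x f) (sv_act S y g) = pres F (tpure x y : hom P Q) (m Q f g)) ->
  (forall (P : ab) (l : seq (submod (sv R P.1) * submod (sv S P.2))),
     (\sum_(p <- l) tpure (P := P) (Q := (A, B)) (sval p.1) (sval p.2) = 0) ->
     \sum_(p <- l) m P p.1 p.2 = 0) ->
  exists x : pval F (A, B), forall P f g,
    pres F (tpure (P := P) (Q := (A, B)) (sval f) (sval g)) x = m P f g.
Proof.
move=> TRS mb mn m0.
pose sm P (l : seq (submod (sv R P.1) * submod (sv S P.2))) : hom (P : ab) ((A, B) : ab) :=
  \sum_(p <- l) tpure (P := P) (Q := (A, B)) (sval p.1) (sval p.2).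
have [|P z|P c f f' z z'|P Q f g z|x xP] := @sheaf_glue _ _ _ _ shF (A, B) _
  (fun P h z => exists2 l, h = sm P l & z = \sum_(p <- l) m P p.1 p.2) TRS.
- by move=> P h /tensor_sieve_sum[l lE]; exists (\sum_(p <- l) m P p.1 p.2); exists l.
- by move=> [l /esym/m0 l0 ->].
- move=> [l -> ->] [l' -> ->]; exists ([seq (c *: p.1, p.2) | p <- l] ++ l').
  + rewrite /sm big_cat big_map scaler_sumr; congr (_ + _); apply: eq_bigr => p _ /=.
    exact: esym (linearZ_LR (mklinear (tpure_linl (P := P) (Q := (A, B)) (sval p.2))) c (sval p.1)).
  + rewrite big_cat big_map scaler_sumr; congr (_ + _); apply: eq_bigr => p _.
    exact: esym (linearZ_LR (mklinear ((mb P).1 p.2)) c p.1).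
- move=> [l -> ->]; have [t ->] := tpure_sum g.
  exists [seq (sv_act R q.1 p.1, sv_act S q.2 p.2) | p <- l, q <- t].
  + rewrite /sm big_allpairs_dep comp_suml; apply: eq_bigr => p _.
    by rewrite comp_sumr; apply: eq_bigr => q _; rewrite tpureM.
  + rewrite big_allpairs_dep linear_sum; apply: eq_bigr => p _.
    by rewrite pres_suml; apply: eq_bigr => q _; rewrite mn.
exists x => P f g; apply: xP; first by apply: tensor_sieve_pure; apply: svalP.
by exists [:: (f, g)]; rewrite ?/sm big_seq1.
Qed.

Lemma slice_l_separated (B : sobj b) : separated Ta (slice_l F B).
Proof.
move=> A x Tx.
apply: (separated_eq (sheaf_separated shF) (tensor_cover_l (Tb := Tb) B Tx)) => -[A' B'] z.
move=> /tensor_sieve_sum[l ->]; rewrite !pres_suml; apply: eq_bigr => p _.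
move: (p.1) (p.2) => f g {p}; rewrite linear0 slices_res'.
by have -> := svalP f; rewrite linear0.
Qed.
Lemma slice_r_separated (A : sobj a) : separated Tb (slice_r F A).
Proof.
move=> B x Tx.
apply: (separated_eq (sheaf_separated shF) (tensor_cover_r (Ta := Ta) A Tx)) => -[A' B'] z.
move=> /tensor_sieve_sum[l ->]; rewrite !pres_suml; apply: eq_bigr => p _.
move: (p.1) (p.2) => f g {p}; rewrite linear0 slices_res.
by have -> := svalP g; rewrite linear0.
Qed.

(** A matching family on [R] extends to the products of [R] with [b (-, B)] by
    restriction in the second variable, and this is well defined because the
    slices are separated. *)
Lemma slice_l_is_sheaf (B : sobj b) : is_sheaf Ta (slice_l F B).
Proof.
move=> A R TR s.
have sep := @slice_l_separated.
pose m (P : sobj ab) (f : submod (sv R P.1)) (g : submod (sv (max_sieve B) P.2)) : pval F P :=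
  pres F (tpure (P := P) (Q := (P.1, B)) (idm (P.1 : a)) (sval g)) (papp s P.1 f).
have mb P : bilin (m P).
  split=> [g c f f' | f c g g']; rewrite /m; first by rewrite !linearP.
  rewrite -pres_lin; congr (pres F _ _).
  by rewrite -(tpure_linr (P := P) (Q := (P.1, B)) (idm (P.1 : a)) c (sval g) (sval g')).
have [|P l l0|x xP] := @tensor_sieve_glue A B R (max_sieve B) m (tensor_cover_l B TR) mb.
- move=> P Q x y f g; rewrite /m -presM tpureM comp1l.
  have -> : papp s P.1 (sv_act R x f) = pres (slice_l F B) x (papp s Q.1 f) by rewrite -pnat.
  by rewrite slice_l_resE -presM tpureM comp1l comp1r.
- case: P l l0 => A' B' l l0.
  have H : separated Ta (slice_l F B') := sep B'.
  apply: (@separated_bilinear k a Ta (slice_l F B') A R (submod (sv (max_sieve B) B'))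
    (fun A' => m (A', B')) H TR _ _ A' l).
  + by move=> X; exact: (mb (X, B')).
  + move=> X Y h f g; rewrite /m slice_l_resE -presM tpureM comp1l comp1r /=.
    have -> : papp s Y (sv_act R h f) = pres (slice_l F B) h (papp s X f) by rewrite -pnat.
    by rewrite slice_l_resE -presM tpureM comp1l comp1r.
  + move=> V c cb.
    have cb' : bilin (fun (f : hom (A' : a) (A : a)) (g : hom (B' : b) (B : b)) =>
        c f (Submod (I : sv (max_sieve B) B' g))).
      split=> [g d f f' | f d g g']; first exact: cb.1.
      by rewrite -cb.2; congr (c f _); apply: submod_ext.
    have := congr1 (mklinear (tens_lift_linear cb')) l0; rewrite linear_sum linear0.
    move=> e; rewrite -[RHS]e; apply: eq_bigr => p _ /=; rewrite [RHS](tens_liftE _ _ cb').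
    by congr (c _ _); apply: submod_ext.
- exists x; split=> [A' f | x' x'P].
    have := xP (A', B) f (Submod (I : sv (max_sieve B) B (idm (B : b)))).
    rewrite slice_l_resE => ->; exact: esym (pres1 (F := F) (A := (A', B)) (papp s A' f)).
  apply: (separated_eq (sep B) TR) => A' f Rf.
  rewrite -[RHS](x'P A' (Submod Rf)) slice_l_resE.
  have -> := xP (A', B) (Submod Rf) (Submod (I : sv (max_sieve B) B (idm (B : b)))).
  exact: (pres1 (F := F) (A := (A', B)) (papp s A' (Submod Rf))).
Qed.

Lemma slice_r_is_sheaf (A : sobj a) : is_sheaf Tb (slice_r F A).
Proof.
move=> B S TS s.
have sep := @slice_r_separated.
pose m (P : sobj ab) (f : submod (sv (max_sieve A) P.1)) (g : submod (sv S P.2)) : pval F P :=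
  pres F (tpure (P := P) (Q := (A, P.2)) (sval f) (idm (P.2 : b))) (papp s P.2 g).
have mb P : bilin (m P).
  split=> [g c f f' | f c g g']; rewrite /m; last by rewrite !linearP.
  rewrite -pres_lin; congr (pres F _ _).
  by rewrite -(tpure_linl (P := P) (Q := (A, P.2)) (idm (P.2 : b)) c (sval f) (sval f')).
have [|P l l0|x xP] := @tensor_sieve_glue A B (max_sieve A) S m (tensor_cover_r A TS) mb.
- move=> P Q x y f g; rewrite /m -presM tpureM comp1l.
  have -> : papp s P.2 (sv_act S y g) = pres (slice_r F A) y (papp s Q.2 g) by rewrite -pnat.
  by rewrite slice_r_resE -presM tpureM comp1l comp1r.
- case: P l l0 => A' B' l l0.
  have H : separated Tb (slice_r F A') := sep A'.
  pose l' := [seq (p.2, p.1) | p <- l].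
  have -> : \sum_(p <- l) m (A', B') p.1 p.2 = \sum_(p <- l') m (A', B') p.2 p.1.
    by rewrite big_map.
  apply: (@separated_bilinear k b Tb (slice_r F A') B S (submod (sv (max_sieve A) A'))
    (fun B' g f => m (A', B') f g) H TS _ _ B' l').
  + by move=> X; split; [exact: (mb (A', X)).2 | exact: (mb (A', X)).1].
  + move=> X Y h f g; rewrite /m slice_r_resE -presM tpureM comp1l comp1r /=.
    have -> : papp s Y (sv_act S h f) = pres (slice_r F A) h (papp s X f) by rewrite -pnat.
    by rewrite slice_r_resE -presM tpureM comp1l comp1r.
  + move=> V c cb; rewrite big_map.
    have cb' : bilin (fun (f : hom (A' : a) (A : a)) (g : hom (B' : b) (B : b)) =>
        c g (Submod (I : sv (max_sieve A) A' f))).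
      split=> [g d f f' | f d g g']; last exact: cb.1.
      by rewrite -cb.2; congr (c g _); apply: submod_ext.
    have := congr1 (mklinear (tens_lift_linear cb')) l0; rewrite linear_sum linear0.
    move=> e; rewrite -[RHS]e; apply: eq_bigr => p _ /=; rewrite [RHS](tens_liftE _ _ cb').
    by congr (c _ _); apply: submod_ext.
- exists x; split=> [B' g | x' x'P].
    have := xP (A, B') (Submod (I : sv (max_sieve A) A (idm (A : a)))) g.
    rewrite slice_r_resE => ->; exact: esym (pres1 (F := F) (A := (A, B')) (papp s B' g)).
  apply: (separated_eq (sep A) TS) => B' g Sg.
  rewrite -[RHS](x'P B' (Submod Sg)) slice_r_resE.
  have -> := xP (A, B') (Submod (I : sv (max_sieve A) A (idm (A : a)))) (Submod Sg).
  exact: (pres1 (F := F) (A := (A, B')) (papp s B' (Submod Sg))).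
Qed.
End TensorSheafSlices.

(** * Bicocontinuous functors restricted to sites *)

Section Bifunctors.
Context (k : comPzRingType) (C D E : lcat k) (S : bifunctor C D E).

Lemma bmap_lr (X X' : C) (Y Y' : D) (f : hom X X') (g : hom Y Y') :
  bmap S f g = bmap S f (idm Y') \oc bmap S (idm X) g.
Proof. by rewrite -bmapM comp1l comp1r. Qed.
Lemma bmap_rl (X X' : C) (Y Y' : D) (f : hom X X') (g : hom Y Y') :
  bmap S f g = bmap S (idm X') g \oc bmap S f (idm Y).
Proof. by rewrite -bmapM comp1l comp1r. Qed.
Lemma bmap_bilin (X X' : C) (Y Y' : D) :
  bilin (fun (f : hom X X') (g : hom Y Y') => bmap S f g).
Proof.
split=> [g c f f' | f c g g'].
- by rewrite [LHS]bmap_lr bmap_linl comp_linl -!bmap_lr.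
- by rewrite [LHS]bmap_lr bmap_linr comp_linr -!bmap_lr.
Qed.

Context (a b : slcat k) (u : lfunctor (lcat_of_slcat a) C) (v : lfunctor (lcat_of_slcat b) D).
Let o (P : sobj a * sobj b) : E := S (u P.1) (v P.2).
Let m (P Q : sobj a * sobj b) (f : hom (P.1 : a) Q.1) (g : hom (P.2 : b) Q.2) :
  hom (o P) (o Q) := bmap S (fmap u f) (fmap v g).
Fact restrict_bilin P Q : bilin (@m P Q).
Proof.
split=> [g c f f' | f c g g']; rewrite /m fmap_lin.
- exact: (bmap_bilin _ _ _ _).1.
- exact: (bmap_bilin _ _ _ _).2.
Qed.
Fact restrict_1 (P : sobj a * sobj b) : m (idm (P.1 : a)) (idm (P.2 : b)) = idm (o P).
Proof. by rewrite /m !fmap1 bmap1. Qed.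
Fact restrict_M P Q R (g : hom (Q.1 : a) R.1) (g' : hom (Q.2 : b) R.2)
  (f : hom (P.1 : a) Q.1) (f' : hom (P.2 : b) Q.2) :
  m (g \oc f) (g' \oc f') = m g g' \oc m f f'.
Proof. by rewrite /m !fmapM bmapM. Qed.
Definition restrict : lfunctor (lcat_of_slcat (tensor_cat a b)) E :=
  tensor_functor restrict_bilin restrict_1 restrict_M.
Lemma restrictE (P Q : tensor_cat a b) (f : hom (P.1 : a) Q.1) (g : hom (P.2 : b) Q.2) :
  fmap restrict (tpure f g : hom P Q) = bmap S (fmap u f) (fmap v g).
Proof. exact: (tensor_functorE restrict_bilin restrict_1 restrict_M f g). Qed.
End Bifunctors.

(** [u A] is a colimit weighted by each covering sieve of [A], and [S] preserves
    it. *)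
Lemma cocontinuous_nerve_is_sheaf (k : comPzRingType) (a : slcat k) (T : topology a)
    (C E : lcat k) (u : lfunctor (lcat_of_slcat a) C) (S : lfunctor C E) :
  grothendieck C -> LC_morphism T u -> cocontinuous S ->
  forall Z, is_sheaf T (nerve (lfunctor_comp S u) Z).
Proof.
move=> grC hu cS Z A R TR s.
have [h [hP hq]] := wcolim_preserved (gr_cocomplete grC) cS (sieve_wcolim hu grC TR) s.
exists h; split=> [A' f | h' h'P]; first exact: esym (hP A' f).
by apply: hq => A' f; rewrite h'P.
Qed.

Section RestrictedBifunctor.
Context (k : comPzRingType) (C D E : lcat k) (grC : grothendieck C) (grD : grothendieck D).
Context (a b : slcat k) (Ta : topology a) (Tb : topology b).
Context (u : lfunctor (lcat_of_slcat a) C) (v : lfunctor (lcat_of_slcat b) D)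
  (hu : LC_morphism Ta u) (hv : LC_morphism Tb v).
Context (S : bifunctor C D E) (cS : bicocontinuous S).
Local Notation ab := (tensor_cat a b).
Local Notation Su := (restrict S u v).

(** In each variable the nerve is that of a cocontinuous functor. *)
Lemma restrict_nerve_is_sheaf (Z : E) : is_sheaf (tensor_topology Ta Tb) (nerve Su Z).
Proof.
apply: tensor_is_sheaf => [B | A].
- pose G := nerve (lfunctor_comp (partl S (v B)) u) Z.
  have nat (A A' : a) (f : hom A' A) (x : pval (slice_l (nerve Su Z) B) A) :
      lin_id (pval G A') (pres (slice_l (nerve Su Z) B) f x) = pres G f (lin_id (pval G A) x).
    by rewrite slice_l_resE nerve_resE [RHS]nerve_resE restrictE fmap1.
  apply: (@sheaf_of_bijective k a Ta (slice_l (nerve Su Z) B) G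
    (@Pshom _ _ (slice_l (nerve Su Z) B) G (fun A => lin_id (pval G A)) nat)) => //.
  + by move=> A y; exists y.
  + by apply: cocontinuous_nerve_is_sheaf => //; apply: cS.1.
- pose G := nerve (lfunctor_comp (partr S (u A)) v) Z.
  have nat (B B' : b) (f : hom B' B) (x : pval (slice_r (nerve Su Z) A) B) :
      lin_id (pval G B') (pres (slice_r (nerve Su Z) A) f x) = pres G f (lin_id (pval G B) x).
    by rewrite slice_r_resE nerve_resE [RHS]nerve_resE restrictE fmap1.
  apply: (@sheaf_of_bijective k b Tb (slice_r (nerve Su Z) A) G
    (@Pshom _ _ (slice_r (nerve Su Z) A) G (fun B => lin_id (pval G B)) nat)) => //.
  + by move=> B y; exists y.
  + by apply: cocontinuous_nerve_is_sheaf => //; apply: cS.2.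
Qed.

(** Density of [u] and of [v], used one variable at a time. *)
Lemma restrict_dense (X : C) (Y : D) (Z : E)
    (d : pshom (ext_tensor (nerve u X) (nerve v Y)) (nerve Su Z)) :
  exists! h : hom (S X Y) Z, forall (P : sobj ab) (x : hom (u P.1) X) (y : hom (v P.2) Y),
    h \oc bmap S x y = papp d P (ext_tens (M := nerve u X) (N := nerve v Y) x y).
Proof.
pose dv (A : sobj a) (B : sobj b) (x : hom (u A) X) (y : hom (v B) Y) : hom (S (u A) (v B)) Z :=
  papp d (A, B) (ext_tens (M := nerve u X) (N := nerve v Y) (P := (A, B)) x y).
have dvl A B y : linear (fun x => @dv A B x y).
  move=> c x x'; rewrite /dv -[RHS]linearP; congr (papp d (A, B) _).
  exact: (tens_bilin _ _).1.
have dvr A B x : linear (@dv A B x).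
  move=> c y y'; rewrite /dv -[RHS]linearP; congr (papp d (A, B) _).
  exact: (tens_bilin _ _).2.
have dvn (A A' : a) (B B' : b) (f : hom A' A) (g : hom B' B) x y :
    dv A' B' (x \oc fmap u f) (y \oc fmap v g) = dv A B x y \oc bmap S (fmap u f) (fmap v g).
  have := pnat d (tpure (P := (A', B')) (Q := (A, B)) f g)
    (ext_tens (M := nerve u X) (N := nerve v Y) (P := (A, B)) x y).
  rewrite ext_tens_res => e; apply: etrans e _.
  by rewrite [LHS]nerve_resE restrictE.
have ex B y : exists! h : hom (S X (v B)) Z,
    forall (A : sobj a) (x : hom (u A) X), h \oc bmap S x (idm (v B)) = dv A B x y.
  have nat (A A' : a) (f : hom A' A) (x : pval (nerve u X) A) :
      mklinear (dvl A' B y) (pres (nerve u X) f x) =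
      pres (nerve (lfunctor_comp (partl S (v B)) u) Z) f (mklinear (dvl A B y) x).
    by rewrite [RHS]nerve_resE /= -[in LHS](comp1r y) -(fmap1 v) dvn fmap1.
  have [t [tP tq]] := wcolim_preserved (gr_cocomplete grC) (cS.1 (v B))
    (@nerve_wcolim _ _ _ _ _ hu grC X) (@Pshom _ _ (nerve u X)
      (nerve (lfunctor_comp (partl S (v B)) u) Z) (fun A => mklinear (dvl A B y)) nat).
  exists t; split; first exact: tP.
  exact: tq.
pose h B y := projT1 (boolp.cid (ex B y)).
have hP B y : forall (A : sobj a) (x : hom (u A) X), h B y \oc bmap S x (idm (v B)) = dv A B x y.
  exact: (projT2 (boolp.cid (ex B y))).1.
have hq B y h' : (forall (A : sobj a) (x : hom (u A) X),
    h' \oc bmap S x (idm (v B)) = dv A B x y) -> h B y = h'.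
  exact: (projT2 (boolp.cid (ex B y))).2.
have hlin B : linear (h B).
  move=> c y y'; apply: hq => A x.
  by rewrite comp_linl !hP dvr.
have hnat (B B' : b) (g : hom B' B) (y : pval (nerve v Y) B) :
    mklinear (hlin B') (pres (nerve v Y) g y) =
    pres (nerve (lfunctor_comp (partr S X) v) Z) g (mklinear (hlin B) y).
  rewrite [RHS]nerve_resE /=; apply: hq => A x.
  rewrite -compA -bmap_rl bmap_lr compA hP.
  by rewrite -(fmap1 u) -dvn fmap1 comp1r.
have [t [tP tq]] := wcolim_preserved (gr_cocomplete grD) (cS.2 X) (@nerve_wcolim _ _ _ _ _ hv grD Y)
  (@Pshom _ _ (nerve v Y) (nerve (lfunctor_comp (partr S X) v) Z)
    (fun B => mklinear (hlin B)) hnat).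
exists t; split=> [[A B] x y | t' t'P].
  rewrite bmap_rl compA -[RHS]/(dv A B x y) -hP; congr (_ \oc _).
  exact: (tP B y).
apply: tq => B y; apply/esym; apply: hq => A x /=.
by rewrite -compA -bmap_rl; apply: (t'P (A, B)).
Qed.
End RestrictedBifunctor.

(** * The universal bifunctor into sheaves *)

Lemma sheafification_sig (k : comPzRingType) (s : slcat k) (T : topology s) (M : presheaf s) :
  {G : Sh T & {e : pshom M (proj1_sig G) | forall (F : Sh T) (f : pshom M (proj1_sig F)),
     exists! g : hom G F, ps_comp (shom g) e = f}}.
Proof.
pose G : Sh T := exist _ (sheafify T M) (@sheafify_is_sheaf _ _ T M).
exists G, (shf_unit T M) => -[F shF] f.
have [g gP] := sheafify_univ f shF; exists g; split=> // g' g'P.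
by apply: (sheafify_ext shF); rewrite gP g'P.
Qed.

Section UniversalBifunctor.
Context (k : comPzRingType) (C D : lcat k) (grC : grothendieck C) (grD : grothendieck D).
Context (a b : slcat k) (Ta : topology a) (Tb : topology b).
Context (u : lfunctor (lcat_of_slcat a) C) (v : lfunctor (lcat_of_slcat b) D)
  (hu : LC_morphism Ta u) (hv : LC_morphism Tb v).
Local Notation ab := (tensor_cat a b).
Local Notation Tab := (tensor_topology Ta Tb).
Local Notation sh := (@proj1_sig _ (fun F : presheaf ab => is_sheaf Tab F)).

(** Under the embeddings of [C] and [D] into presheaves by nerves, this is the
    sheafified external tensor product. *)
Definition boxt (X : C) (Y : D) : Sh Tab :=
  projT1 (sheafification_sig Tab (ext_tensor (nerve u X) (nerve v Y))).
Definition boxt_unit (X : C) (Y : D) : pshom (ext_tensor (nerve u X) (nerve v Y)) (sh (boxt X Y)) :=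
  proj1_sig (projT2 (sheafification_sig Tab (ext_tensor (nerve u X) (nerve v Y)))).
Lemma boxt_unitP (X : C) (Y : D) (F : Sh Tab) (f : pshom _ (sh F)) :
  exists! g : hom (boxt X Y) F, ps_comp (shom g) (boxt_unit X Y) = f.
Proof. exact: (proj2_sig (projT2 (sheafification_sig Tab _))). Qed.
Definition boxt_elt (X : C) (Y : D) (P : sobj ab) (x : hom (u P.1) X) (y : hom (v P.2) Y) :
  pval (sh (boxt X Y)) P := papp (boxt_unit X Y) P (ext_tens (M := nerve u X) (N := nerve v Y) x y).

Lemma boxt_elt_linl X Y P (y : hom (v P.2) Y) : linear (fun x => @boxt_elt X Y P x y).
Proof.
move=> c x x'; rewrite /boxt_elt -[RHS]linearP; congr (papp (boxt_unit X Y) P _).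
exact: (tens_bilin _ _).1.
Qed.
Lemma boxt_elt_linr X Y P (x : hom (u P.1) X) : linear (@boxt_elt X Y P x).
Proof.
move=> c y y'; rewrite /boxt_elt -[RHS]linearP; congr (papp (boxt_unit X Y) P _).
exact: (tens_bilin _ _).2.
Qed.
Lemma boxt_elt_res X Y (P Q : ab) (f : hom (P.1 : a) Q.1) (g : hom (P.2 : b) Q.2)
    (x : hom (u Q.1) X) (y : hom (v Q.2) Y) :
  pres (sh (boxt X Y)) (tpure f g : hom P Q) (boxt_elt x y) = boxt_elt (P := P) (x \oc fmap u f) (y \oc fmap v g).
Proof. by rewrite /boxt_elt -pnat ext_tens_res. Qed.

Lemma boxt_univ X Y (F : presheaf ab) (m : forall P : sobj ab, hom (u P.1) X -> hom (v P.2) Y -> pval F P) :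
  is_sheaf Tab F -> (forall P, bilin (m P)) ->
  (forall (P Q : ab) (f : hom (P.1 : a) Q.1) (g : hom (P.2 : b) Q.2) x y,
     m P (x \oc fmap u f) (y \oc fmap v g) = pres F (tpure f g : hom P Q) (m Q x y)) ->
  exists g : pshom (sh (boxt X Y)) F, forall P x y, papp g P (boxt_elt x y) = m P x y.
Proof.
move=> shF mb mn.
have [p pP] := @ext_tensor_univ k a b F (nerve u X) (nerve v Y) m mb mn.
have [g [gP _]] := @boxt_unitP X Y (exist _ F shF) p.
exists g => P x y; rewrite -pP.
exact: (congr1 (fun h : pshom _ F => papp h P (ext_tens (M := nerve u X) (N := nerve v Y) x y)) gP).
Qed.

Lemma boxt_ext X Y (F : presheaf ab) (f g : pshom (sh (boxt X Y)) F) : is_sheaf Tab F ->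
  (forall P (x : hom (u P.1) X) (y : hom (v P.2) Y), papp f P (boxt_elt x y) = papp g P (boxt_elt x y)) ->
  f = g.
Proof.
move=> shF fg; have [h [hP hq]] := @boxt_unitP X Y (exist _ F shF) (ps_comp g (boxt_unit X Y)).
rewrite -(hq g) // (hq f) //.
by apply: ext_tensor_ext => P x y; apply: fg.
Qed.

Lemma boxt_map_ex X X' Y Y' (f : hom X X') (g : hom Y Y') :
  {h : hom (boxt X Y) (boxt X' Y') | forall (P : sobj ab) (x : hom (u P.1) X) (y : hom (v P.2) Y),
     papp (shom h) P (boxt_elt x y) = boxt_elt (f \oc x) (g \oc y)}.
Proof.
apply: boolp.cid.
apply: (@boxt_univ X Y (sh (boxt X' Y')) (fun P x y => boxt_elt (f \oc x) (g \oc y))).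
- exact: is_sh.
- move=> P; split=> [y c x x' | x c y y']; rewrite comp_linr; [exact: boxt_elt_linl | exact: boxt_elt_linr].
- by move=> P Q s t x y; rewrite boxt_elt_res !compA.
Qed.
Definition boxt_map X X' Y Y' (f : hom X X') (g : hom Y Y') : hom (boxt X Y) (boxt X' Y') :=
  proj1_sig (boxt_map_ex f g).
Lemma boxt_mapE X X' Y Y' (f : hom X X') (g : hom Y Y') (P : sobj ab) (x : hom (u P.1) X)
    (y : hom (v P.2) Y) : papp (shom (boxt_map f g)) P (boxt_elt x y) = boxt_elt (f \oc x) (g \oc y).
Proof. exact: (proj2_sig (boxt_map_ex f g)). Qed.

Lemma sh_compE (F G H : Sh Tab) (g : hom G H) (f : hom F G) P x :
  papp (shom (g \oc f)) P x = papp (shom g) P (papp (shom f) P x).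
Proof. by []. Qed.
Lemma sh_linE (F G : Sh Tab) c (f g : hom F G) P x :
  papp (shom (c *: f + g)) P x = c *: papp (shom f) P x + papp (shom g) P x.
Proof. by []. Qed.
Lemma boxt_hom_ext X Y (F : Sh Tab) (f g : hom (boxt X Y) F) :
  (forall P (x : hom (u P.1) X) (y : hom (v P.2) Y),
     papp (shom f) P (boxt_elt x y) = papp (shom g) P (boxt_elt x y)) -> f = g.
Proof. by apply: boxt_ext; apply: is_sh. Qed.

Fact boxt_1 X Y : boxt_map (idm X) (idm Y) = idm (boxt X Y).
Proof. by apply: boxt_hom_ext => P x y; rewrite boxt_mapE !comp1l. Qed.
Fact boxt_M X X' X'' Y Y' Y'' (f' : hom X' X'') (f : hom X X') (g' : hom Y' Y'') (g : hom Y Y') :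
  boxt_map (f' \oc f) (g' \oc g) = boxt_map f' g' \oc boxt_map f g.
Proof. by apply: boxt_hom_ext => P x y; rewrite sh_compE !boxt_mapE !compA. Qed.
Fact boxt_linl X X' Y : linear (fun f : hom X X' => boxt_map f (idm Y)).
Proof.
move=> c f g; apply: boxt_hom_ext => P x y.
by rewrite sh_linE !boxt_mapE comp_linl boxt_elt_linl.
Qed.
Fact boxt_linr X Y Y' : linear (fun g : hom Y Y' => boxt_map (idm X) g).
Proof.
move=> c f g; apply: boxt_hom_ext => P x y.
by rewrite sh_linE !boxt_mapE comp_linl boxt_elt_linr.
Qed.
Definition boxt_bifunctor : bifunctor C D (Sh Tab) :=
  @Bifunctor k C D (Sh Tab) boxt boxt_map boxt_1 boxt_M boxt_linl boxt_linr.

Section PartialMaps.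
Context (X : C) (Y : D) (F : presheaf ab) (g : pshom (sh (boxt X Y)) F).
Lemma boxt_slice_l (B : sobj b) (y : hom (v B) Y) : exists p : pshom (nerve u X) (slice_l F B),
  forall (A : sobj a) x, papp p A x = papp g (A, B) (boxt_elt (P := (A, B)) x y).
Proof.
pose m (A : sobj a) (x : pval (nerve u X) A) : pval (slice_l F B) A :=
  papp g (A, B) (boxt_elt (P := (A, B)) x y).
have ml A : linear (@m A) by move=> c x x'; rewrite /m boxt_elt_linl; apply: linearP.
have mn (A A' : a) (f : hom A' A) (x : pval (nerve u X) A) :
    mklinear (ml A') (pres (nerve u X) f x) = pres (slice_l F B) f (mklinear (ml A) x).
  by rewrite slice_l_resE /= /m -pnat boxt_elt_res fmap1 comp1r.
by exists (@Pshom _ _ (nerve u X) (slice_l F B) (fun A => mklinear (ml A)) mn).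
Qed.
Lemma boxt_slice_r (A : sobj a) (x : hom (u A) X) : exists p : pshom (nerve v Y) (slice_r F A),
  forall (B : sobj b) y, papp p B y = papp g (A, B) (boxt_elt (P := (A, B)) x y).
Proof.
pose m (B : sobj b) (y : pval (nerve v Y) B) : pval (slice_r F A) B :=
  papp g (A, B) (boxt_elt (P := (A, B)) x y).
have ml B : linear (@m B) by move=> c y y'; rewrite /m boxt_elt_linr; apply: linearP.
have mn (B B' : b) (f : hom B' B) (y : pval (nerve v Y) B) :
    mklinear (ml B') (pres (nerve v Y) f y) = pres (slice_r F A) f (mklinear (ml B) y).
  by rewrite slice_r_resE /= /m -pnat boxt_elt_res fmap1 comp1r.
by exists (@Pshom _ _ (nerve v Y) (slice_r F A) (fun B => mklinear (ml B)) mn).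
Qed.
End PartialMaps.

(** The universal property with one variable fixed, so that what is known about maps
    from [C (u -, X)] to sheaves applies. *)
Lemma boxt_univ_l X Y (F : presheaf ab)
    (p : forall (B : sobj b) (y : hom (v B) Y), pshom (nerve u X) (slice_l F B)) :
  is_sheaf Tab F ->
  (forall B c y y', p B (c *: y + y') = c *: p B y + p B y') ->
  (forall (B B' : b) (g : hom B' B) y (A : sobj a) x, papp (p B' (y \oc fmap v g)) A x =
     pres (slice_r F A) g (papp (p B y) A x)) ->
  exists g : pshom (sh (boxt X Y)) F, forall (A : sobj a) (B : sobj b) x y,
    papp g (A, B) (boxt_elt (P := (A, B)) x y) = papp (p B y) A x.
Proof.
move=> shF pl pn; pose m (P : sobj ab) (x : hom (u P.1) X) (y : hom (v P.2) Y) : pval F P :=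
  match P return hom (u P.1) X -> hom (v P.2) Y -> pval F P with
  | (A, B) => fun x y => papp (p B y) A x end x y.
have [[A B]|[A' B'] [A B] f g x y|h hP] := @boxt_univ X Y F m shF.
- split=> [y c x x' | x c y y']; rewrite /m /=; first exact: linearP.
  by rewrite pl.
- by rewrite slices_res' /m /= pn -[x \oc _]/(pres (nerve u X) f x) pnat slices_res -slices_res'.
by exists h => A B x y; rewrite hP.
Qed.
Lemma boxt_univ_r X Y (F : presheaf ab)
    (p : forall (A : sobj a) (x : hom (u A) X), pshom (nerve v Y) (slice_r F A)) :
  is_sheaf Tab F ->
  (forall A c x x', p A (c *: x + x') = c *: p A x + p A x') ->
  (forall (A A' : a) (f : hom A' A) x (B : sobj b) y, papp (p A' (x \oc fmap u f)) B y =
     pres (slice_l F B) f (papp (p A x) B y)) ->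
  exists g : pshom (sh (boxt X Y)) F, forall (A : sobj a) (B : sobj b) x y,
    papp g (A, B) (boxt_elt (P := (A, B)) x y) = papp (p A x) B y.
Proof.
move=> shF pl pn; pose m (P : sobj ab) (x : hom (u P.1) X) (y : hom (v P.2) Y) : pval F P :=
  match P return hom (u P.1) X -> hom (v P.2) Y -> pval F P with
  | (A, B) => fun x y => papp (p A x) B y end x y.
have [[A B]|[A' B'] [A B] f g x y|h hP] := @boxt_univ X Y F m shF.
- split=> [y c x x' | x c y y']; rewrite /m /=; last exact: linearP.
  by rewrite pl.
- by rewrite slices_res /m /= pn -[y \oc _]/(pres (nerve v Y) g y) pnat slices_res' -slices_res.
by exists h => A B x y; rewrite hP.
Qed.

Lemma ps_linE (s : slcat k) (F G : presheaf s) c (f g : pshom F G) P x :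
  papp (c *: f + g) P x = c *: papp f P x + papp g P x.
Proof. by []. Qed.

(** For a sheaf [F], the maps from [boxt X Y] to [F] are families of maps from
    [C (u -, X)] to slices of [F]; the slices are sheaves, hence see colimits
    in [C]. *)
Lemma boxt_cocontinuous_l (Y : D) : cocontinuous (partl boxt_bifunctor Y).
Proof.
move=> J X L cL [F l lP].
have shF : is_sheaf Tab (sh F) := @is_sh _ _ _ F.
have sl (B : sobj b) : is_sheaf Ta (slice_l (sh F) B) by exact: (@slice_l_is_sheaf k a b Ta Tb (sh F) shF B).
have ex1 j B (y : hom (v B) Y) := boolp.cid (boxt_slice_l (shom (l j)) y).
pose p B (y : hom (v B) Y) j := projT1 (ex1 j B y).
have pP B y j A x : papp (p B y j) A x = papp (shom (l j)) (A, B) (boxt_elt (P := (A, B)) x y).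
  exact: (projT2 (ex1 j B y)).
have pc B y i j (e : @imor J i j) : ps_comp (p B y j) (nerve_post u (dmap X e)) = p B y i.
  apply: pshom_ext => A x; rewrite [RHS]pP -(lP i j e) sh_compE.
  by rewrite [papp (shom (dmap _ _)) _ _]boxt_mapE comp1l [LHS]pP.
have ex2 B y := boolp.cid (nerve_colimit hu grC (@sl B) cL (pc B y)).
pose q B (y : hom (v B) Y) := projT1 (ex2 B y).
have qP B y j : ps_comp (q B y) (nerve_post u (leg L j)) = p B y j.
  exact: (projT2 (ex2 B y)).1.
have qE B y j A x : papp (q B y) A (leg L j \oc x) =
    papp (shom (l j)) (A, B) (boxt_elt (P := (A, B)) x y).
  by rewrite -pP -qP.
have qq (B : sobj b) (y : hom (v B) Y) (r : pshom (nerve u (apex L)) (slice_l (sh F) B)) :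
  (forall j (A : sobj a) (x : hom (u A) (X j)), papp r A (leg L j \oc x) =
    papp (shom (l j)) (A, B) (boxt_elt (P := (A, B)) x y)) -> q B y = r.
  move=> rP; apply: (projT2 (ex2 B y)).2 => j; apply: pshom_ext => A x.
  by rewrite pP -rP.
have [B c y y'|B B' g y A x|h hP] := @boxt_univ_l (apex L) Y (sh F) q shF.
- by apply: qq => j A x; rewrite ps_linE !qE boxt_elt_linr linearP.
- rewrite (qq B' _ (ps_comp (slice_l_map (sh F) g) (q B y))) // => j A' x'.
  transitivity (pres (slice_r (sh F) A') g (papp (q B y) A' (leg L j \oc x'))) => //.
  by rewrite qE slice_r_resE -pnat boxt_elt_res fmap1 comp1r.
exists h; split=> [j | h' h'P].
- apply: boxt_hom_ext => -[A B] x y; rewrite sh_compE.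
  by rewrite [papp (shom (fmap _ _)) _ _]boxt_mapE comp1l [LHS]hP qE.
- apply: boxt_hom_ext => -[A B] x y; rewrite [LHS]hP.
  have [r rP] := boxt_slice_l (shom h') y; rewrite -rP (qq B y r) // => j A' x'.
  rewrite rP -[l j](h'P j) sh_compE.
  by rewrite [papp (shom (fmap _ _)) _ _]boxt_mapE comp1l.
Qed.
Lemma boxt_cocontinuous_r (X : C) : cocontinuous (partr boxt_bifunctor X).
Proof.
move=> J Y L cL [F l lP].
have shF : is_sheaf Tab (sh F) := @is_sh _ _ _ F.
have sr (A : sobj a) : is_sheaf Tb (slice_r (sh F) A) by exact: (@slice_r_is_sheaf k a b Ta Tb (sh F) shF A).
have ex1 j A (x : hom (u A) X) := boolp.cid (boxt_slice_r (shom (l j)) x).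
pose p A (x : hom (u A) X) j := projT1 (ex1 j A x).
have pP A x j B y : papp (p A x j) B y = papp (shom (l j)) (A, B) (boxt_elt (P := (A, B)) x y).
  exact: (projT2 (ex1 j A x)).
have pc A x i j (e : @imor J i j) : ps_comp (p A x j) (nerve_post v (dmap Y e)) = p A x i.
  apply: pshom_ext => B y; rewrite [RHS]pP -(lP i j e) sh_compE.
  by rewrite [papp (shom (dmap _ _)) _ _]boxt_mapE comp1l [LHS]pP.
have ex2 A x := boolp.cid (nerve_colimit hv grD (@sr A) cL (pc A x)).
pose q A (x : hom (u A) X) := projT1 (ex2 A x).
have qP A x j : ps_comp (q A x) (nerve_post v (leg L j)) = p A x j.
  exact: (projT2 (ex2 A x)).1.
have qE A x j B y : papp (q A x) B (leg L j \oc y) =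
    papp (shom (l j)) (A, B) (boxt_elt (P := (A, B)) x y).
  by rewrite -pP -qP.
have qq (A : sobj a) (x : hom (u A) X) (r : pshom (nerve v (apex L)) (slice_r (sh F) A)) :
  (forall j (B : sobj b) (y : hom (v B) (Y j)), papp r B (leg L j \oc y) =
    papp (shom (l j)) (A, B) (boxt_elt (P := (A, B)) x y)) -> q A x = r.
  move=> rP; apply: (projT2 (ex2 A x)).2 => j; apply: pshom_ext => B y.
  by rewrite pP -rP.
have [A c x x'|A A' f x B y|h hP] := @boxt_univ_r X (apex L) (sh F) q shF.
- by apply: qq => j B y; rewrite ps_linE !qE boxt_elt_linl linearP.
- rewrite (qq A' _ (ps_comp (slice_r_map (sh F) f) (q A x))) // => j B' y'.
  transitivity (pres (slice_l (sh F) B') f (papp (q A x) B' (leg L j \oc y'))) => //.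
  by rewrite qE slice_l_resE -pnat boxt_elt_res fmap1 comp1r.
exists h; split=> [j | h' h'P].
- apply: boxt_hom_ext => -[A B] x y; rewrite sh_compE.
  by rewrite [papp (shom (fmap _ _)) _ _]boxt_mapE comp1l [LHS]hP qE.
- apply: boxt_hom_ext => -[A B] x y; rewrite [LHS]hP.
  have [r rP] := boxt_slice_r (shom h') x; rewrite -rP (qq A x r) // => j B' y'.
  rewrite rP -[l j](h'P j) sh_compE.
  by rewrite [papp (shom (fmap _ _)) _ _]boxt_mapE comp1l.
Qed.

Lemma boxt_bicocontinuous : bicocontinuous boxt_bifunctor.
Proof. by split; [exact: boxt_cocontinuous_l | exact: boxt_cocontinuous_r]. Qed.
End UniversalBifunctor.

Section SheafDensity.
Context (k : comPzRingType) (C D : lcat k) (grC : grothendieck C) (grD : grothendieck D).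
Context (a b : slcat k) (Ta : topology a) (Tb : topology b).
Context (u : lfunctor (lcat_of_slcat a) C) (v : lfunctor (lcat_of_slcat b) D)
  (hu : LC_morphism Ta u) (hv : LC_morphism Tb v).
Local Notation ab := (tensor_cat a b).
Local Notation Tab := (tensor_topology Ta Tb).
Local Notation sh := (@proj1_sig _ (fun F : presheaf ab => is_sheaf Tab F)).
Local Notation BX := (boxt_bifunctor Ta Tb u v).
Local Notation BXuv := (restrict BX u v).

(** The image of the universal element of the presheaf represented by [P]. *)
Definition boxt_gen (P : sobj ab) : pval (sh (BXuv P)) P := boxt_elt Ta Tb (P := P) (idm (u P.1)) (idm (v P.2)).

Lemma sh_slice_l (F : Sh Tab) (B : sobj b) : is_sheaf Ta (slice_l (sh F) B).
Proof. exact: (@slice_l_is_sheaf k a b Ta Tb (sh F) (@is_sh _ _ _ F) B). Qed.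
Lemma sh_slice_r (F : Sh Tab) (A : sobj a) : is_sheaf Tb (slice_r (sh F) A).
Proof. exact: (@slice_r_is_sheaf k a b Ta Tb (sh F) (@is_sh _ _ _ F) A). Qed.

(** Sheaves do not distinguish [boxt (u A) (v B)] from the presheaf represented by
    [(A, B)]: this holds in each variable. *)
Lemma boxt_rep_ext (P : sobj ab) (F : Sh Tab) (f g : hom (BXuv P) F) :
  papp (shom f) P (boxt_gen P) = papp (shom g) P (boxt_gen P) -> f = g.
Proof.
case: P f g => A B f g fg; apply: boxt_hom_ext => -[A' B'] x y.
have e1 B'' (y' : hom (v B'') (v B)) : papp (shom f) (A, B'') (boxt_elt Ta Tb (P := (A, B'')) (idm (u A)) y') =
    papp (shom g) (A, B'') (boxt_elt Ta Tb (P := (A, B'')) (idm (u A)) y').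
  have [p pP] := boxt_slice_r (shom f) (idm (u A)); have [q qP] := boxt_slice_r (shom g) (idm (u A)).
  suff pq : p = q by rewrite -pP -qP pq.
  by apply: (nerve_rep_ext hv (@sh_slice_r F A)); rewrite pP qP.
have [p pP] := boxt_slice_l (shom f) y; have [q qP] := boxt_slice_l (shom g) y.
suff pq : p = q by rewrite -pP -qP pq.
apply: (nerve_rep_ext hu (@sh_slice_l F B')); rewrite pP qP; exact: e1.
Qed.

Lemma boxt_rep (P : sobj ab) (F : Sh Tab) (x : pval (sh F) P) :
  exists f : hom (BXuv P) F, papp (shom f) P (boxt_gen P) = x.
Proof.
have shF : is_sheaf Tab (sh F) := @is_sh _ _ _ F.
case: P x => A B x.
have [q qx] := @nerve_rep _ _ _ _ _ hv _ (@sh_slice_r F A) B x.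
have ex (B' : sobj b) (y : hom (v B') (v B)) := boolp.cid
  (@nerve_rep _ _ _ _ _ hu _ (@sh_slice_l F B') A (papp q B' y)).
pose p (B' : sobj b) (y : hom (v B') (v B)) := projT1 (ex B' y).
have pP (B' : sobj b) (y : hom (v B') (v B)) : papp (p B' y) A (idm (u A)) = papp q B' y.
  exact: (projT2 (ex B' y)).
have [B' c y y'|B1 B' g y A' z|h hP] := @boxt_univ_l _ _ _ _ _ Ta Tb u v (u A) (v B) (sh F) p shF.
- by apply: (nerve_rep_ext hu (@sh_slice_l F B')); rewrite ps_linE !pP linearP.
- have -> : p B' (y \oc fmap v g) = ps_comp (slice_l_map (sh F) g) (p B1 y); last by [].
  apply: (nerve_rep_ext hu (@sh_slice_l F B')); rewrite pP.
  transitivity (pres (slice_r (sh F) A) g (papp (p B1 y) A (idm (u A)))) => //.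
  by rewrite pP -[RHS]pnat.
by exists h; rewrite [LHS]hP pP.
Qed.

Lemma boxt_gen_res (P Q : ab) (z : hom P Q) :
  papp (shom (fmap BXuv z)) P (boxt_gen P) = pres (sh (BXuv Q)) z (boxt_gen Q).
Proof.
have [s ->] := tpure_sum z; rewrite fmap_sum pres_suml.
have sumE I (r : seq I) (f : I -> hom (BXuv P) (BXuv Q)) :
    papp (shom (\sum_(i <- r) f i)) P (boxt_gen P) = \sum_(i <- r) papp (shom (f i)) P (boxt_gen P).
  elim: r => [|i r IH]; first by rewrite !big_nil.
  by rewrite !big_cons -IH.
rewrite sumE; apply: eq_bigr => p _.
by rewrite restrictE [LHS]boxt_mapE /boxt_gen boxt_elt_res !comp1r !comp1l.
Qed.

(** As maps from [boxt (u A) (v B)] to a sheaf [G] are elements of [G (A, B)], natural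
    families of such maps indexed by the elements of [F] are maps from [F] to
    [G]. *)
Lemma boxt_dense (F : Sh Tab) : exists c : pshom (sh F) (nerve BXuv F),
  is_wcolim c /\ forall P x, papp (shom (papp c P x)) P (boxt_gen P) = x.
Proof.
pose c (P : sobj ab) (x : pval (sh F) P) : pval (nerve BXuv F) P := projT1 (boolp.cid (boxt_rep x)).
have cP P x : papp (shom (@c P x)) P (boxt_gen P) = x by exact: (projT2 (boolp.cid (boxt_rep x))).
have cl P : linear (@c P).
  by move=> d x y; apply: boxt_rep_ext; rewrite sh_linE !cP.
have cn (Q P : ab) (z : hom P Q) (x : pval (sh F) Q) :
    mklinear (cl P) (pres (sh F) z x) = pres (nerve BXuv F) z (mklinear (cl Q) x).
  by apply: boxt_rep_ext; rewrite [LHS]cP nerve_resE sh_compE boxt_gen_res pnat; congr (pres (sh F) z _); exact: esym (cP Q x).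
exists (@Pshom _ _ (sh F) (nerve BXuv F) (fun P => mklinear (cl P)) cn); split; last exact: cP.
move=> G d.
pose h P (x : pval (sh F) P) : pval (sh G) P := papp (shom (papp d P x : hom (BXuv P) G)) P (boxt_gen P).
have hl P : linear (@h P) by move=> e x y; rewrite /h linearP.
have hn (Q P : ab) (z : hom P Q) (x : pval (sh F) Q) :
    mklinear (hl P) (pres (sh F) z x) = pres (sh G) z (mklinear (hl Q) x).
  by rewrite /= /h pnat nerve_resE sh_compE boxt_gen_res pnat.
exists (@Pshom _ _ (sh F) (sh G) (fun P => mklinear (hl P)) hn); split=> [P x | h' h'P].
  apply: boxt_rep_ext; rewrite sh_compE; exact: (congr1 (@h P) (cP P x)).
apply: pshom_ext => P x; rewrite /= /h -h'P sh_compE.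
exact: (congr1 (papp (shom h') P) (cP P x)).
Qed.
End SheafDensity.

(** * The colimit weighted by a sheaf *)

Section WeightedColimitFunctor.
Context (k : comPzRingType) (s : slcat k) (T : topology s) (E : lcat k) (cE : cocomplete E)
  (V : lfunctor (lcat_of_slcat s) E) (shV : forall Z, is_sheaf T (nerve V Z)).
Local Notation sh := (@proj1_sig _ (fun F : presheaf s => is_sheaf T F)).

Definition wcolim_sig (F : Sh T) : {X : E & {c : pshom (sh F) (nerve V X) | is_wcolim c}}.
Proof.
have /boolp.cid[X /boolp.cid[c cP]] := wcolim_exists V (sh F) cE.
by exists X, c.
Qed.
Definition realize (F : Sh T) : E := projT1 (wcolim_sig F).
Definition realize_leg (F : Sh T) : pshom (sh F) (nerve V (realize F)) := proj1_sig (projT2 (wcolim_sig F)).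
Lemma realize_legP (F : Sh T) : is_wcolim (realize_leg F). Proof. exact: (proj2_sig (projT2 (wcolim_sig F))). Qed.

Lemma realize_map_ex (F G : Sh T) (f : hom F G) : {h : hom (realize F) (realize G) |
  forall (P : sobj s) (x : pval (sh F) P), h \oc papp (realize_leg F) P x = papp (realize_leg G) P (papp (shom f) P x)}.
Proof.
apply: boolp.cid; have [h [hP _]] := realize_legP (ps_comp (realize_leg G) (shom f)).
by exists h.
Qed.
Definition realize_map (F G : Sh T) (f : hom F G) : hom (realize F) (realize G) := proj1_sig (realize_map_ex f).
Lemma realize_mapE (F G : Sh T) (f : hom F G) (P : sobj s) (x : pval (sh F) P) :
  realize_map f \oc papp (realize_leg F) P x = papp (realize_leg G) P (papp (shom f) P x).
Proof. exact: (proj2_sig (realize_map_ex f)). Qed.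
Fact realize_lin (F G : Sh T) : linear (@realize_map F G).
Proof.
move=> c f g; apply: (wcolim_ext (@realize_legP F)) => P x.
by rewrite comp_linl !realize_mapE -linearP.
Qed.
Fact realize_1 (F : Sh T) : realize_map (idm F) = idm (realize F).
Proof. by apply: (wcolim_ext (@realize_legP F)) => P x; rewrite realize_mapE comp1l. Qed.
Fact realize_M (F G H : Sh T) (g : hom G H) (f : hom F G) : realize_map (g \oc f) = realize_map g \oc realize_map f.
Proof. by apply: (wcolim_ext (@realize_legP F)) => P x; rewrite -compA !realize_mapE. Qed.
Definition realization : lfunctor (Sh T) E :=
  @Lfunctor k (Sh T) E realize realize_map realize_lin realize_1 realize_M.

(** The functor is left adjoint to the nerve, which takes values in sheaves. *)
Lemma realization_cocontinuous : cocontinuous realization.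
Proof.
move=> J X L cL [Z l lP]; rewrite /= in l lP *.
pose N : Sh T := exist _ (nerve V Z) (shV (Z := Z)).
pose m j : hom (X j) N := ps_comp (nerve_post V (l j)) (realize_leg (X j)).
have mP i j (e : @imor J i j) : m j \oc dmap X e = m i.
  apply: pshom_ext => P x.
  transitivity (l j \oc papp (realize_leg (X j)) P (papp (shom (dmap X e)) P x)) => //.
  by rewrite -realize_mapE compA lP.
have [h [hP hq]] := cL (@Cocone k J (Sh T) X N m mP).
have [t [tP tq]] := realize_legP (shom h : pshom _ (nerve V Z)).
exists t; split=> [j | t' t'P].
  apply: (wcolim_ext (@realize_legP (X j))) => P x; rewrite -compA [realize_map _ \oc _]realize_mapE tP.
  exact: (congr1 (fun f : pshom _ (nerve V Z) => papp f P x) (hP j)).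
apply: tq => P x.
have e : h = (ps_comp (nerve_post V t') (realize_leg (apex L)) : hom (apex L) N).
  apply: hq => j; apply: pshom_ext => Q y.
  transitivity (t' \oc papp (realize_leg (apex L)) Q (papp (shom (leg L j)) Q y)) => //.
  rewrite -realize_mapE compA; exact: (congr1 (fun f => f \oc papp (realize_leg (X j)) Q y) (t'P j)).
by rewrite e.
Qed.
End WeightedColimitFunctor.

Lemma wcolim_unique (k : comPzRingType) (s : slcat k) (E : lcat k)
    (V V' : lfunctor (lcat_of_slcat s) E) (t : lnat V V') (M : presheaf s) (X X' : E)
    (c : pshom M (nerve V X)) (c' : pshom M (nerve V' X')) :
  (forall A, is_iso (t A)) -> is_wcolim c -> is_wcolim c' ->
  exists h : hom X X', is_iso h /\
    forall (A : sobj s) (m : pval M A), h \oc papp c A m = papp c' A m \oc t A.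
Proof.
move=> ti realize wc'.
have ex (A : sobj s) := boolp.cid (ti A).
pose r A : hom (V' A) (V A) := projT1 (ex A).
have rt (A : sobj s) : r A \oc t A = idm (V A) by exact: (projT2 (ex A)).1.
have tr (A : sobj s) : t A \oc r A = idm (V' A) by exact: (projT2 (ex A)).2.
have rn (A' A : s) (f : hom A' A) : r A \oc fmap V' f = fmap V f \oc r A'.
  by rewrite -[LHS]comp1r -(tr A') -compA (compA _ (t A')) -nnat -!compA (compA (r A)) rt comp1l.
have dl A : linear (fun m : pval M A => papp c' A m \oc t A).
  by move=> x m m'; rewrite linearP comp_linl.
have dn (A A' : s) (f : hom A' A) (m : pval M A) :
    mklinear (dl A') (pres M f m) = pres (nerve V X') f (mklinear (dl A) m).
  by rewrite [RHS]nerve_resE /= pnat nerve_resE -!compA nnat.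
have dl' A : linear (fun m : pval M A => papp c A m \oc r A).
  by move=> x m m'; rewrite linearP comp_linl.
have dn' (A A' : s) (f : hom A' A) (m : pval M A) :
    mklinear (dl' A') (pres M f m) = pres (nerve V' X) f (mklinear (dl' A) m).
  by rewrite [RHS]nerve_resE /= pnat nerve_resE -!compA rn.
have [h [hP _]] := realize X' (@Pshom _ _ M (nerve V X') (fun A => mklinear (dl A)) dn).
have [h' [h'P _]] := wc' X (@Pshom _ _ M (nerve V' X) (fun A => mklinear (dl' A)) dn').
exists h; split; last by move=> A m; rewrite hP.
exists h'; split.
- apply: (wcolim_ext realize) => A m.
  by rewrite -compA hP /= compA h'P /= -compA rt comp1r comp1l.
- apply: (wcolim_ext wc') => A m.
  by rewrite -compA h'P /= compA hP /= -compA tr comp1r comp1l.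
Qed.

Section RestrictNat.
Context (k : comPzRingType) (C D E E' : lcat k) (a b : slcat k).
Context (u : lfunctor (lcat_of_slcat a) C) (v : lfunctor (lcat_of_slcat b) D).
Context (S : bifunctor C D E) (H : lfunctor E E') (R : bifunctor C D E') (t : bnat (bpost H S) R).
Fact restrict_nat_nat (P Q : tensor_cat a b) (z : hom P Q) :
  t (u Q.1) (v Q.2) \oc fmap (lfunctor_comp H (restrict S u v)) z =
  fmap (restrict R u v) z \oc t (u P.1) (v P.2).
Proof.
have [l ->] := tpure_sum z; rewrite !fmap_sum comp_sumr comp_suml.
apply: eq_bigr => p _.
rewrite restrictE -bnatP; congr (_ \oc _).
by rewrite /= -[X in _ = fmap H X](restrictE S u v).
Qed.
Definition restrict_nat : lnat (lfunctor_comp H (restrict S u v)) (restrict R u v) :=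
  @Lnat k _ _ (lfunctor_comp H (restrict S u v)) (restrict R u v)
    (fun P => t (u P.1) (v P.2)) restrict_nat_nat.
End RestrictNat.

(** * Representability *)

Section Plain.
Lemma cfunctor_iso (X Y : cat) (F : cfunctor X Y) (x y : X) (f : cmor x y) :
  ciso f -> ciso (cfmap F f).
Proof. by move=> [g [gf fg]]; exists (cfmap F g); rewrite -!cfmapM gf fg !cfmap1. Qed.
Lemma ciso_comp (X : cat) (x y z : X) (g : cmor y z) (f : cmor x y) :
  ciso g -> ciso f -> ciso (ccomp g f).
Proof.
move=> [g' [g'g gg']] [f' [f'f ff']]; exists (ccomp f' g'); split.
- by rewrite -ccompA (ccompA g') g'g ccomp1l.
- by rewrite -ccompA (ccompA f) ff' ccomp1l.
Qed.
Lemma ciso_inv (X : cat) (x y : X) (f : cmor x y) : ciso f -> exists g : cmor y x, ciso g.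
Proof. by move=> [g [gf fg]]; exists g, f. Qed.
Lemma cequivalence_reflects (X Y : cat) (F : cfunctor X Y) (x y : X) (f : cmor (F x) (F y)) :
  cequivalence F -> ciso f -> exists g : cmor x y, ciso g.
Proof.
move=> [G [eta [_ [_ _ ei _]]]] fi; have [h hi] := ciso_inv (ei y).
exists (ccomp h (ccomp (cfmap G f) (eta x))).
by apply: ciso_comp => //; apply: ciso_comp => //; apply: cfunctor_iso.
Qed.
End Plain.

Section Isos.
Context (k : comPzRingType).
Lemma is_iso_comp (E : lcat k) (X Y Z : E) (g : hom Y Z) (f : hom X Y) :
  is_iso g -> is_iso f -> is_iso (g \oc f).
Proof.
move=> [g' [g'g gg']] [f' [f'f ff']]; exists (f' \oc g'); split.
- by rewrite -compA (compA g') g'g comp1l.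
- by rewrite -compA (compA f) ff' comp1l.
Qed.
Lemma is_iso_fmap (E E' : lcat k) (F : lfunctor E E') (X Y : E) (f : hom X Y) :
  is_iso f -> is_iso (fmap F f).
Proof. by move=> [g [gf fg]]; exists (fmap F g); rewrite -!fmapM gf fg !fmap1. Qed.

Lemma bicocont_ciso (C D E : lcat k) (S R : Bicocont C D E) (t : cmor S R) :
  (forall X Y, is_iso ((t : bnat _ _) X Y)) <-> ciso t.
Proof.
split=> [ti | [r [rt tr]] X Y].
  have ex X Y := boolp.cid (ti X Y).
  pose r X Y := projT1 (ex X Y).
  have rt X Y : r X Y \oc (t : bnat _ _) X Y = idm _ by exact: (projT2 (ex X Y)).1.
  have tr X Y : (t : bnat _ _) X Y \oc r X Y = idm _ by exact: (projT2 (ex X Y)).2.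
  have rn (X X' : C) (Y Y' : D) (f : hom X X') (g : hom Y Y') :
      r X' Y' \oc bmap R f g = bmap S f g \oc r X Y.
    rewrite -[LHS]comp1r -(tr X Y) -compA (compA _ ((t : bnat _ _) X Y)).
    by rewrite -(bnatP (t : bnat S R)) -!compA (compA (r X' Y')) rt comp1l.
  exists (@Bnat k C D E R S r rn); split; apply: bnat_ext => X Y; [exact: rt | exact: tr].
exists ((r : bnat _ _) X Y); split.
- exact: (congr1 (fun w : bnat S S => w X Y) rt).
- exact: (congr1 (fun w : bnat R R => w X Y) tr).
Qed.
End Isos.

Section Representation.
Context (k : comPzRingType) (C D P : lcat k) (cP : cocomplete P) (rep : represents C D P).

Definition universal_bifunctor : bicocont_functor C D P := rho rep cP (cocont_id P).

Section RightUnit.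
Context (E : lcat k) (H : cocont_functor P E).
Fact runit_nat (X Y : P) (f : hom X Y) :
  idm (H Y) \oc fmap (lfunctor_comp H (lfunctor_id P)) f = fmap H f \oc idm (H X).
Proof. by rewrite comp1l comp1r. Qed.
Definition runit : @cmor (Cocont P E) (cocont_comp H (cocont_id P)) H :=
  @Lnat k P E (lfunctor_comp H (lfunctor_id P)) H (fun X => idm (H X)) runit_nat.
Fact runit_inv_nat (X Y : P) (f : hom X Y) :
  idm (H Y) \oc fmap H f = fmap (lfunctor_comp H (lfunctor_id P)) f \oc idm (H X).
Proof. by rewrite comp1l comp1r. Qed.
Lemma runit_iso : ciso runit.
Proof.
exists (@Lnat k P E H (lfunctor_comp H (lfunctor_id P)) (fun X => idm (H X)) runit_inv_nat).
by split; apply: lnat_ext => X; apply: comp1l.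
Qed.
End RightUnit.

(** By naturality, the representation is isomorphic to composition with
    [universal_bifunctor], and every [S] is in its essential image. *)
Lemma universal_factor (E : lcat k) (cE : cocomplete E) (S : bicocont_functor C D E) :
  exists (H : cocont_functor P E) (t : bnat (bpost H universal_bifunctor) S),
    forall X Y, is_iso (t X Y).
Proof.
have [G [eta [eps [_ _ _ epsi]]]] := rho_equiv rep cE.
pose H : cocont_functor P E := G S; exists H.
pose n : @cmor (Bicocont C D E) (bicocont_post H universal_bifunctor)
  (rho rep cE (cocont_comp H (cocont_id P))) := rho_nat rep cP cE H (cocont_id P).
have ni : ciso n by apply/bicocont_ciso => X Y; apply: (rho_nat_iso rep).
have i2 := cfunctor_iso (rho rep cE) (runit_iso H).
have i := ciso_comp (epsi S) (ciso_comp i2 ni).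
by exists (ccomp (eps S) (ccomp (cfmap (rho rep cE) (runit H)) n)); exact: (bicocont_ciso _).2 i.
Qed.

(** [H] and the identity correspond to isomorphic bifunctors, and an equivalence
    reflects isomorphism of objects. *)
Lemma universal_id (H : cocont_functor P P) (t : bnat (bpost H universal_bifunctor) universal_bifunctor) :
  (forall X Y, is_iso (t X Y)) -> nat_iso H (lfunctor_id P).
Proof.
move=> ti.
pose n : @cmor (Bicocont C D P) (bicocont_post H universal_bifunctor)
  (rho rep cP (cocont_comp H (cocont_id P))) := rho_nat rep cP cP H (cocont_id P).
have ni : ciso n by apply/bicocont_ciso => X Y; apply: (rho_nat_iso rep).
have [n' n'i] := ciso_inv ni.
pose t' : @cmor (Bicocont C D P) (bicocont_post H universal_bifunctor) universal_bifunctor := t.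
have t'i : ciso t' by apply/bicocont_ciso.
have [g [g' [g'g gg']]] := cequivalence_reflects (rho_equiv rep cP) (ciso_comp t'i n'i).
have nn (X Y : P) (f : hom X Y) :
    (g : lnat _ _) Y \oc fmap H f = fmap (lfunctor_id P) f \oc (g : lnat _ _) X.
  exact: (nnat (g : lnat (lfunctor_comp H (lfunctor_id P)) (lfunctor_id P)) f).
exists (@Lnat k P P H (lfunctor_id P) (fun X => (g : lnat _ _) X) nn) => X.
exists ((g' : lnat _ _) X); split.
- exact: (congr1 (fun w : lnat (lfunctor_comp H (lfunctor_id P)) _ => w X) g'g).
- exact: (congr1 (fun w : lnat (lfunctor_id P) _ => w X) gg').
Qed.
End Representation.

(** * The equivalence *)

Section Comparison.
Context (k : comPzRingType) (C D : lcat k) (grC : grothendieck C) (grD : grothendieck D).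
Context (a b : slcat k) (Ta : topology a) (Tb : topology b).
Context (u : lfunctor (lcat_of_slcat a) C) (v : lfunctor (lcat_of_slcat b) D)
  (hu : LC_morphism Ta u) (hv : LC_morphism Tb v).
Local Notation ab := (tensor_cat a b).
Local Notation Tab := (tensor_topology Ta Tb).
Local Notation sh := (@proj1_sig _ (fun F : presheaf ab => is_sheaf Tab F)).
Local Notation BX := (boxt_bifunctor Ta Tb u v).
Context (E : lcat k) (cE : cocomplete E) (S : bifunctor C D E) (cS : bicocontinuous S).
Local Notation Su := (restrict S u v).
Let shS Z : is_sheaf Tab (nerve Su Z) := @restrict_nerve_is_sheaf k C D E grC grD a b Ta Tb u v hu hv S cS Z.

Definition bifunctor_realization : lfunctor (Sh Tab) E := @realization k ab Tab E cE Su.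
Local Notation G := bifunctor_realization.
Local Notation gin F := (@realize_leg k ab Tab E cE Su F).
Lemma bifunctor_realization_cocontinuous : cocontinuous G.
Proof. exact: realization_cocontinuous. Qed.

(** Maps to [Z] from either side are families of maps from [S (u A) (v B)] to [Z],
    bilinear and natural in elements of [C (u A, X)] and [D (v B, Y)]. *)
Lemma realization_boxt_ex (X : C) (Y : D) : exists h : hom (G (BX X Y)) (S X Y),
  is_iso h /\ forall P (x : hom (u P.1) X) (y : hom (v P.2) Y),
    h \oc papp (gin (BX X Y)) P (boxt_elt Ta Tb x y) = bmap S x y.
Proof.
have [||t tP] := @boxt_univ k C D a b Ta Tb u v X Y (nerve Su (S X Y))
    (fun P x y => bmap S x y) (@shS (S X Y)).
- by move=> P; apply: bmap_bilin.
- by move=> P Q f g x y; rewrite nerve_resE restrictE -bmapM.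
have [h [hP _]] := @realize_legP k ab Tab E cE Su (BX X Y) _ t.
have hw P (x : hom (u P.1) X) (y : hom (v P.2) Y) :
    h \oc papp (gin (BX X Y)) P (boxt_elt Ta Tb x y) = bmap S x y by rewrite hP tP.
exists h; split=> //.
have [h' [h'P _]] := restrict_dense grC grD hu hv cS
  (ps_comp (gin (BX X Y)) (boxt_unit Ta Tb u v X Y)).
have h'w P (x : hom (u P.1) X) (y : hom (v P.2) Y) :
    h' \oc bmap S x y = papp (gin (BX X Y)) P (boxt_elt Ta Tb x y) by exact: h'P.
exists h'; split.
- apply: (wcolim_ext (@realize_legP k ab Tab E cE Su (BX X Y))) => P x.
  rewrite comp1l.
  suff e : ps_comp (nerve_post Su (h' \oc h)) (gin (BX X Y)) = gin (BX X Y).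
    exact: (congr1 (fun f : pshom _ (nerve Su _) => papp f P x) e).
  apply: (@boxt_ext k C D a b Ta Tb u v X Y _ _ _ (@shS (G (BX X Y)))) => Q y z.
  by rewrite /= -compA hw h'w.
- have [d0 [_ uq]] := restrict_dense grC grD hu hv cS
    (ps_comp t (boxt_unit Ta Tb u v X Y)).
  have q1 : d0 = idm (S X Y) by apply: uq => P x y; rewrite comp1l -tP.
  rewrite -q1; apply/esym/uq => P x y.
  by rewrite -compA h'w hw -tP.
Qed.

Lemma realization_boxt : exists t : bnat (bpost G BX) S, forall X Y, is_iso (t X Y).
Proof.
pose t X Y := projT1 (boolp.cid (realization_boxt_ex X Y)).
have ti X Y : is_iso (t X Y) := (projT2 (boolp.cid (realization_boxt_ex X Y))).1.
have tw X Y P (x : hom (u P.1) X) (y : hom (v P.2) Y) :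
    t X Y \oc papp (gin (BX X Y)) P (boxt_elt Ta Tb x y) = bmap S x y.
  exact: (projT2 (boolp.cid (realization_boxt_ex X Y))).2.
have tn (X X' : C) (Y Y' : D) (f : hom X X') (g : hom Y Y') :
    t X' Y' \oc fmap G (bmap BX f g) = bmap S f g \oc t X Y.
  apply: (wcolim_ext (@realize_legP k ab Tab E cE Su (BX X Y))) => P x.
  suff e : ps_comp (nerve_post Su (t X' Y' \oc fmap G (bmap BX f g))) (gin (BX X Y)) =
    ps_comp (nerve_post Su (bmap S f g \oc t X Y)) (gin (BX X Y)).
    exact: (congr1 (fun f : pshom _ (nerve Su _) => papp f P x) e).
  apply: (@boxt_ext k C D a b Ta Tb u v X Y _ _ _ (@shS (S X' Y'))) => Q y z.
  have e0 : fmap G (bmap BX f g) \oc papp (gin (BX X Y)) Q (boxt_elt Ta Tb y z) =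
      papp (gin (BX X' Y')) Q (boxt_elt Ta Tb (f \oc y) (g \oc z)).
    by rewrite [LHS]realize_mapE [papp (shom _) _ _]boxt_mapE.
  transitivity ((t X' Y' \oc fmap G (bmap BX f g)) \oc papp (gin (BX X Y)) Q (boxt_elt Ta Tb y z)) => //.
  transitivity ((bmap S f g \oc t X Y) \oc papp (gin (BX X Y)) Q (boxt_elt Ta Tb y z)) => //.
  by rewrite -!compA e0 !tw -bmapM.
by exists (@Bnat k C D E (bpost G BX) S t tn).
Qed.

(** As [H] preserves colimits and takes [S] to [boxt], it takes the colimit of the
    [S (u A) (v B)] weighted by [F] to that of the [boxt (u A) (v B)], which is [F]. *)
Lemma realization_section (H : lfunctor E (Sh Tab)) (t : bnat (bpost H S) BX) : cocontinuous H ->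
  (forall X Y, is_iso (t X Y)) -> nat_iso (lfunctor_comp H G) (lfunctor_id (Sh Tab)).
Proof.
move=> cH ti.
have exd (F : Sh Tab) := boolp.cid (boxt_dense hu hv F).
pose c (F : Sh Tab) := projT1 (exd F).
have cw (F : Sh Tab) : is_wcolim (c F) := (projT2 (exd F)).1.
have c1 (F : Sh Tab) P x : papp (shom (papp (c F) P x)) P (boxt_gen Ta Tb u v P) = x.
  exact: (projT2 (exd F)).2.
pose r := restrict_nat u v t.
have wH (F : Sh Tab) := wcolim_preserved cE cH (@realize_legP k ab Tab E cE Su F).
have ex (F : Sh Tab) := boolp.cid (@wcolim_unique k ab (Sh Tab) _ _ r _ _ _ _ _
  (fun P => ti (u P.1) (v P.2)) (wH F) (cw F)).
pose h (F : Sh Tab) : hom (H (G F)) F := projT1 (ex F).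
have hi (F : Sh Tab) : is_iso (h F) := (projT2 (ex F)).1.
have hE (F : Sh Tab) P x : h F \oc fmap H (papp (gin F) P x) = papp (c F) P x \oc t (u P.1) (v P.2).
  exact: (projT2 (ex F)).2.
have hn (F F' : Sh Tab) (f : hom F F') : h F' \oc fmap H (fmap G f) = f \oc h F.
  apply: (wcolim_ext (wH F)) => P x.
  transitivity (h F' \oc fmap H (fmap G f) \oc fmap H (papp (gin F) P x)) => //.
  transitivity (f \oc h F \oc fmap H (papp (gin F) P x)) => //.
  have e0 : fmap G f \oc papp (gin F) P x = papp (gin F') P (papp (shom f) P x) by apply: realize_mapE.
  rewrite -!compA -fmapM e0 !hE compA; congr (_ \oc _).
  apply: (boxt_rep_ext hu hv); rewrite c1 sh_compE.
  exact: esym (congr1 (papp (shom f) P) (c1 F P x)).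
by exists (@Lnat k _ _ (lfunctor_comp H G) (lfunctor_id (Sh Tab)) h hn).
Qed.
End Comparison.

Theorem theorem5p4 (k : comPzRingType) (C D : lcat k)
    (hC : grothendieck C) (hD : grothendieck D)
    (a b : slcat k) (Ta : topology a) (Tb : topology b)
    (u : lfunctor (lcat_of_slcat a) C) (v : lfunctor (lcat_of_slcat b) D)
    (hu : LC_morphism Ta u) (hv : LC_morphism Tb v)
    (P : lcat k) (hP : is_LP_tensor C D P) :
  equivalent (Sh (tensor_topology Ta Tb)) P.
Proof.
case: hP => [[cP _] [rep]].
pose U := universal_bifunctor cP rep.
have cU : bicocontinuous U := @bc_cocont _ _ _ _ U.
pose BX0 : bicocont_functor C D (Sh (tensor_topology Ta Tb)) :=
  BicocontFunctor (boxt_bicocontinuous hC hD hu hv).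
have [H [t ti]] := universal_factor cP rep (@Sh_cocomplete _ _ (tensor_topology Ta Tb)) BX0.
have cH := @cc_cocont _ _ _ H.
pose G := bifunctor_realization Ta Tb u v cP U.
have cG : cocontinuous G := bifunctor_realization_cocontinuous hC hD hu hv cU.
have [s si] := realization_boxt hC hD hu hv cP cU.
exists G, H; split; first exact: (realization_section hu hv cP cH ti).
pose GH := cocont_comp (CocontFunctor cG) H.
have rn (X X' : C) (Y Y' : D) (f : hom X X') (g : hom Y Y') :
    (s X' Y' \oc fmap G (t X' Y')) \oc bmap (bpost GH U) f g =
    bmap U f g \oc (s X Y \oc fmap G (t X Y)).
  have e1 := congr1 (@fmap _ _ _ G _ _) (bnatP t f g); rewrite !fmapM in e1.
  have e2 : s X' Y' \oc fmap G (bmap BX0 f g) = bmap U f g \oc s X Y := bnatP s f g.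
  transitivity (s X' Y' \oc (fmap G (t X' Y') \oc fmap G (bmap (bpost H U) f g))).
    by rewrite compA.
  rewrite e1 (compA (s X' Y')).
  exact: etrans (congr1 (fun h => h \oc fmap G (t X Y)) e2) (esym (compA _ _ _)).
apply: (@universal_id _ _ _ _ cP rep GH (@Bnat k C D P (bpost GH U) U
  (fun X Y => s X Y \oc fmap G (t X Y)) rn)) => X Y.
by apply: is_iso_comp; [exact: si | apply: is_iso_fmap; exact: ti].
Qed.
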